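(* Let $T$ and $R$ be contractions on a Hilbert space $\mathcal{H}$, let $T_t=(1-t)T+tR$ for $t\in[0,1]$, and let $\mathcal{E}_t$ be a semi-spectral measure of $T_t$. Let $\varphi\in\big(B^2_{\infty1}\big)_+$. Then the function $$ t\mapsto\varphi(T_t),\quad 0\le t\le1, $$ has second derivative in the operator norm and $$ \frac{d^2}{ds^2}\varphi(T_s)\Big|_{s=t}=2\iiint\limits_{\mathbb{T}\times\mathbb{T}\times\mathbb{T}} (\mathfrak{D}^2\varphi)(\zeta,\tau,\upsilon)\,d\mathcal{E}_t(\zeta)\,(R-T)\,d\mathcal{E}_t(\tau)\,(R-T)\,d\mathcal{E}_t(\upsilon). $$
   Context: $\mathbb{D}$ is the open unit disk, $\mathbb{T}$ the unit circle. A contraction is an operator of norm at most $1$; each $T_t$ is a contraction. $C_A$ is the disk-algebra (functions analytic in $\mathbb{D}$ and continuous on the closed disk). For $f\in C_A$ and a contraction $T$, $f(T)$ is defined by extending the polynomial calculus by continuity using von Neumann's inequality $\|f(T)\|\le\max_{|\zeta|\le1}|f(\zeta)|$. Derivatives on $[0,1]$ are one-sided at the endpoints. Besov class: let $w\ge0$ be the piecewise linear function on $\mathbb{R}$ supported in $[1/2,2]$, with $w(1)=1$ and linear on $[1/2,1]$ and on $[1,2]$. Put $W_n(z)=\sum_{k\in\mathbb{Z}}w(k/2^n)z^k$ for $n\ge1$, $W_0(z)=\bar z+1+z$, $W_n^\#=\overline{W_n}$. For $s>0$, $1\le p,q\le\infty$, $B^s_{pq}$ consists of functions $f$ on $\mathbb{T}$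 with $\{2^{ns}\|f*W_n\|_{L^p}\}_{n\ge0}\in\ell^q$ and $\{2^{ns}\|f*W_n^\#\|_{L^p}\}_{n\ge1}\in\ell^q$. $\big(B^s_{pq}\big)_+$ is the set of $f\in B^s_{pq}$ with $\hat f(k)=0$ for $k<0$; such functions are identified with their analytic extensions to $\mathbb{D}$. Divided differences: $\mathfrak{D}^0\varphi=\varphi$ and, for $k\ge1$ and distinct points $\lambda_1,\dots,\lambda_{k+1}\in\mathbb{T}$, $$(\mathfrak{D}^{k}\varphi)(\lambda_1,\dots,\lambda_{k+1})=\frac{(\mathfrak{D}^{k-1}\varphi)(\lambda_1,\dots,\lambda_{k-1},\lambda_k)-(\mathfrak{D}^{k-1}\varphi)(\lambda_1,\dots,\lambda_{k-1},\lambda_{k+1})}{\lambda_{k}-\lambda_{k+1}};$$ for $\varphi\in C^k(\mathbb{T})$, $\mathfrak{D}^k\varphi$ is extended by continuity to all points of $\mathbb{T}^{k+1}$. Semi-spectral measures: for a measurable space $(\mathcal{X},\mathcal{B})$ and a Hilbert space $\mathcal{H}$, a semi-spectral measure is a map $\mathcal{E}$ from $\mathcal{B}$ to the bounded operators on $\mathcal{H}$ with $\mathcal{E}(\Delta)\ge0$, $\mathcal{E}(\varnothing)=0$, $\mathcal{E}(\mathcal{X})=I$, countably additive in the weak operator topology. By Naimark's theorem it has a spectral dilation, i.e., a spectral measure $E$ on a Hilbert space $\mathcal{K}\supset\mathcal{H}$ with $\mathcal{E}(\Delta)=P_{\mathcal{H}}E(\Delta)|\mathcal{H}$, and $\int f\,d\mathcal{E}:=P_{\mathcal{H}}\left(\int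 f\,dE\right)\big|\mathcal{H}$ for bounded measurable $f$ (independent of the dilation). A semi-spectral measure of a contraction $T$ on $\mathcal{H}$ is $\mathcal{E}_T(\Delta)=P_{\mathcal{H}}E_U(\Delta)|\mathcal{H}$, $\Delta\subset\mathbb{T}$ Borel, where $E_U$ is the spectral measure of a unitary dilation $U$ of $T$ (a unitary operator on some $\mathcal{K}\supset\mathcal{H}$ with $T^n=P_{\mathcal{H}}U^n|\mathcal{H}$, $n\ge0$); thus $T^n=\int_{\mathbb{T}}\zeta^n\,d\mathcal{E}_T(\zeta)$, $n\ge0$. Triple operator integrals: if $\Phi(\zeta,\tau,\upsilon)=\sum_{n}f_n(\zeta)g_n(\tau)h_n(\upsilon)$ with $f_n,g_n,h_n\in C_A$ and $\sum_n\|f_n\|_\infty\|g_n\|_\infty\|h_n\|_\infty<\infty$ (i.e. $\Phi\in C_A\hat\otimes C_A\hat\otimes C_A$), then for bounded operators $Q_1,Q_2$ and semi-spectral measures $\mathcal{E}_1,\mathcal{E}_2,\mathcal{E}_3$ on $\mathbb{T}$, $\iiint\Phi\,d\mathcal{E}_1\,Q_1\,d\mathcal{E}_2\,Q_2\,d\mathcal{E}_3:=\sum_n\left(\int f_n\,d\mathcal{E}_1\right)Q_1\left(\int g_n\,d\mathcal{E}_2\right)Q_2\left(\int h_n\,d\mathcal{E}_3\right)$, which does not depend on the representation. For $\varphi\in\big(B^2_{\infty1}\big)_+$ it is known that $\mathfrak{D}^2\varphi\in C_A\hat\otimes C_A\hat\otimes C_A$. *)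

(* Defs.v *)
From HB Require Import structures.
From mathcomp Require Import all_boot all_order all_algebra.
From mathcomp Require Import complex.
From mathcomp Require Import all_classical all_reals all_analysis.

Set Implicit Arguments.
Unset Strict Implicit.
Unset Printing Implicit Defensive.

Import Order.TTheory GRing.Theory Num.Theory.
Import numFieldNormedType.Exports.

Local Open Scope classical_set_scope.
Local Open Scope ring_scope.
Local Open Scope complex_scope.

(* The generic topology on a numClosedFieldType is not found by unification on
   the concrete type R[i]. *)
HB.instance Definition _ (R : realType) := NormedModule.copy R[i] (R[i])^o.

(* Norms over R[i] take their values in R[i]; this is the real-valued norm. *)
Definition rnorm (R : realType) (V : normedModType R[i]) (x : V) : R :=
  complex.Re `|x|.

(* A set used as a type carries the subspace topology. *)
Definition circle (R : realType) : set R[i] := [set z | `|z| = 1].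
Arguments circle : clear implicits.

Lemma circle_cis (R : realType) (x : R) : circle R (cos x +i* sin x).
Proof. by rewrite /circle/= normc_def cos2Dsin2 sqrtr1. Qed.

Definition cis (R : realType) (x : R) : circle R :=
  exist _ (cos x +i* sin x) (mem_set (circle_cis x)).

Definition borel (R : realType) : set (set (circle R)) := <<s open >>.

Lemma pi2_gt0 (R : realType) : 0 < 2 * pi :> R.
Proof. by rewrite mulr_gt0// pi_gt0. Qed.

(* Normalized Lebesgue measure on the circle, in the angle variable. *)
Definition haar (R : realType) : probability (measurableTypeR R) R :=
  uniform_prob (@pi2_gt0 R).

Definition circle_integrable (R : realType) (g : R -> R[i]) : Prop :=
  (haar R).-integrable setT (fun x => (complex.Re (g x))%:E) /\
  (haar R).-integrable setT (fun x => (complex.Im (g x))%:E).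

Definition circle_int (R : realType) (g : R -> R[i]) : R[i] :=
  (\int[haar R]_x complex.Re (g x)) +i* (\int[haar R]_x complex.Im (g x)).

Definition fourier (R : realType) (f : circle R -> R[i]) (k : int) : R[i] :=
  circle_int (fun x => f (cis x) * val (cis x) ^ (- k)).

Definition conv (R : realType) (f : circle R -> R[i]) (g : R[i] -> R[i])
    (z : R[i]) : R[i] :=
  circle_int (fun x => f (cis x) * g (z * (val (cis x))^*)).

Definition Lp (R : realType) (p : \bar R) (g : R[i] -> R[i]) : \bar R :=
  ('N[haar R]_p[(fun x => (rnorm (g (val (cis x))))%:E)])%E.

Definition hat (R : realType) (x : R) : R :=
  Num.max 0 (if x <= 1 then 2 * x - 1 else 2 - x).

(* hat (k / 2 ^ n) vanishes unless 0 < k < 2 ^ n.+1. *)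
Definition W (R : realType) (n : nat) (z : R[i]) : R[i] :=
  if n is 0 then z^* + 1 + z
  else \sum_(0 <= k < 2 ^ n.+1) (hat (k%:R / 2 ^+ n))%:C * z ^+ k.

Definition Wsharp (R : realType) (n : nat) (z : R[i]) : R[i] := (W n z)^*.

Definition ellq (R : realType) (q : \bar R) (a : nat -> \bar R) : Prop :=
  ('N[counting]_q[a] < +oo)%E.

Definition besov (R : realType) (s : R) (p q : \bar R)
    (f : circle R -> R[i]) : Prop :=
  [/\ circle_integrable (fun x => f (cis x)),
      ellq q (fun n => (2 `^ (n%:R * s))%:E * Lp p (conv f (@W R n)))%E
    & ellq q (fun n => (2 `^ (n.+1%:R * s))%:E *
                       Lp p (conv f (@Wsharp R n.+1)))%E].

Definition besov_plus (R : realType) (s : R) (p q : \bar R)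
    (f : circle R -> R[i]) : Prop :=
  besov s p q f /\ forall k : int, k < 0 -> fourier f k = 0.

(* The analytic extension of a function whose negative Fourier coefficients
   vanish, extended by the same power series to the points of the circle where
   it converges: there it is the good representative of f, which the Besov
   condition determines only almost everywhere. *)
Definition disk_ext (R : realType) (f : circle R -> R[i]) (z : R[i]) : R[i] :=
  lim (series (fun k : nat => fourier f k%:Z * z ^+ k) @ \oo).

Definition ddiff1 (R : realType) (phi : R[i] -> R[i]) (a b : R[i]) : R[i] :=
  (phi a - phi b) / (a - b).

Definition ddiff2 (R : realType) (phi : R[i] -> R[i]) (a b c : R[i]) : R[i] :=
  (ddiff1 phi a b - ddiff1 phi a c) / (b - c).

Definition distinct_triples (R : realType) : set (circle R * circle R * circle R) :=
  [set u | [/\ u.1.1 != u.1.2, u.1.1 != u.2 & u.1.2 != u.2]].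

(* Extension by continuity to all triples of points of the circle. *)
Definition D2 (R : realType) (phi : R[i] -> R[i]) (a b c : circle R) : R[i] :=
  lim (ddiff2 phi (val u.1.1) (val u.1.2) (val u.2)
       @[u --> within (@distinct_triples R) (nbhs (a, b, c))]).

Definition closed_disk (R : realType) : set R[i] := [set z | `|z| <= 1].
Arguments closed_disk : clear implicits.

(* Differentiability is over R[i], i.e. complex. *)
Definition disk_algebra (R : realType) (f : R[i] -> R[i]) : Prop :=
  (forall z, `|z| < 1 -> derivable f z 1) /\
  {within closed_disk R, continuous f}.

Definition disk_norm (R : realType) (f : R[i] -> R[i]) : \bar R :=
  ereal_sup [set (rnorm (f z))%:E | z in closed_disk R].

(* The inner product is linear in its first argument. *)
Record hilbert (R : realType) := Hilbert {
  hilbert_sort :> completeNormedModType R[i];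
  inner : {dot hilbert_sort for (@Num.conj R[i])};
  normE : forall x : hilbert_sort, `|x| ^+ 2 = inner x x }.

Definition opnorm (R : realType) (H K : hilbert R) (A : H -> K) : \bar R :=
  ereal_sup [set (rnorm (A x))%:E | x in [set x : H | `|x| <= 1]].

Definition bounded_op (R : realType) (H K : hilbert R) (A : H -> K) : Prop :=
  linear A /\ (opnorm A < +oo)%E.

Definition contraction_op (R : realType) (H : hilbert R) (A : H -> H) : Prop :=
  linear A /\ (opnorm A <= 1)%E.

Definition isometric_embedding (R : realType) (H K : hilbert R) (V : H -> K) :=
  linear V /\ forall x y, inner K (V x) (V y) = inner H x y.

Definition unitary (R : realType) (K : hilbert R) (U : K -> K) : Prop :=
  isometric_embedding U /\ forall y, exists x, U x = y.

(* A = P B | H, where H is seen in K through V and P is the orthogonal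
   projection of K onto H. *)
Definition compression (R : realType) (H K : hilbert R) (V : H -> K)
    (B : K -> K) (A : H -> H) : Prop :=
  forall x y, inner K (B (V x) - V (A x)) (V y) = 0.

Definition horner_op (R : realType) (H : hilbert R) (p : {poly R[i]})
    (A : H -> H) : H -> H :=
  fun x => \sum_(i < size p) p`_i *: iter i A x.

(* A is the norm limit of p_n(T) for polynomials p_n converging to f uniformly
   on the closed disk. *)
Definition is_fcalc (R : realType) (H : hilbert R) (f : R[i] -> R[i])
    (T A : H -> H) : Prop :=
  bounded_op A /\
  forall e : R, 0 < e -> exists p : {poly R[i]},
    (forall z, closed_disk R z -> rnorm (f z - p.[z]) <= e) /\
    (opnorm (A - horner_op p T)%R <= e%:E)%E.

Definition fcalc (R : realType) (H : hilbert R) (f : R[i] -> R[i])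
    (T : H -> H) : H -> H :=
  xget 0 [set A | is_fcalc f T A].

(* Only the values of E on Borel sets are constrained. *)
Definition semispectral (R : realType) (H : hilbert R)
    (E : set (circle R) -> H -> H) : Prop :=
  [/\ forall D, borel D ->
        bounded_op (E D) /\ forall x, 0 <= inner H (E D x) x,
      E set0 = 0,
      E setT = id
    & forall D : nat -> set (circle R),
        (forall n, borel (D n)) -> trivIset setT D -> forall x y,
        series (fun n => inner H (E (D n) x) y) @ \oo -->
          inner H (E (\bigcup_n D n) x) y].

Definition spectral (R : realType) (K : hilbert R)
    (F : set (circle R) -> K -> K) : Prop :=
  semispectral F /\
  forall D D', borel D -> borel D' -> F (D `&` D') = F D \o F D'.

(* B is the norm limit of the integrals of simple Borel functions converging
   to f uniformly. *)
Definition is_spectral_int (R : realType) (K : hilbert R)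
    (F : set (circle R) -> K -> K) (f : circle R -> R[i]) (B : K -> K) : Prop :=
  bounded_op B /\
  forall e : R, 0 < e ->
    exists (n : nat) (c : 'I_n -> R[i]) (D : 'I_n -> set (circle R)),
    [/\ forall i, borel (D i),
        trivIset setT D,
        \bigcup_i D i = setT,
        forall i z, D i z -> rnorm (f z - c i) <= e
      & (opnorm (B - \sum_(i < n) c i *: F (D i))%R <= e%:E)%E].

Definition spectral_dilation (R : realType) (H K : hilbert R)
    (E : set (circle R) -> H -> H) (V : H -> K)
    (F : set (circle R) -> K -> K) : Prop :=
  [/\ isometric_embedding V, spectral F
    & forall D, borel D -> compression V (F D) (E D)].

Definition is_semispectral_int (R : realType) (H : hilbert R)
    (E : set (circle R) -> H -> H) (f : circle R -> R[i]) (A : H -> H) : Prop :=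
  exists (K : hilbert R) (V : H -> K) (F : set (circle R) -> K -> K)
         (B : K -> K),
  [/\ spectral_dilation E V F, is_spectral_int F f B & compression V B A].

Definition semispectral_int (R : realType) (H : hilbert R)
    (E : set (circle R) -> H -> H) (f : circle R -> R[i]) : H -> H :=
  xget 0 [set A | is_semispectral_int E f A].

Definition unitary_dilation (R : realType) (H K : hilbert R) (T : H -> H)
    (V : H -> K) (U : K -> K) : Prop :=
  [/\ isometric_embedding V, unitary U
    & forall n, compression V (iter n U) (iter n T)].

Definition spectral_measure_of (R : realType) (K : hilbert R) (U : K -> K)
    (F : set (circle R) -> K -> K) : Prop :=
  spectral F /\ is_spectral_int F val U.

Definition semispectral_measure_of (R : realType) (H : hilbert R) (T : H -> H)
    (E : set (circle R) -> H -> H) : Prop :=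
  semispectral E /\
  exists (K : hilbert R) (V : H -> K) (U : K -> K)
         (F : set (circle R) -> K -> K),
  [/\ unitary_dilation T V U, spectral_measure_of U F
    & forall D, borel D -> compression V (F D) (E D)].

Definition tensor_rep (R : realType)
    (Phi : circle R -> circle R -> circle R -> R[i])
    (f g h : nat -> R[i] -> R[i]) : Prop :=
  [/\ forall n, [/\ disk_algebra (f n), disk_algebra (g n)
                  & disk_algebra (h n)],
      (\sum_(0 <= n <oo) disk_norm (f n) * disk_norm (g n) * disk_norm (h n)
         < +oo)%E
    & forall a b c,
        series (fun n => f n (val a) * g n (val b) * h n (val c)) @ \oo -->
          Phi a b c].

Definition is_triple_int (R : realType) (H : hilbert R)
    (Phi : circle R -> circle R -> circle R -> R[i])
    (E1 : set (circle R) -> H -> H) (Q1 : H -> H)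
    (E2 : set (circle R) -> H -> H) (Q2 : H -> H)
    (E3 : set (circle R) -> H -> H) (J : H -> H) : Prop :=
  bounded_op J /\
  exists f g h : nat -> R[i] -> R[i], tensor_rep Phi f g h /\
  opnorm (J - \sum_(n < N) (semispectral_int E1 (f n \o val) \o Q1 \o
                            semispectral_int E2 (g n \o val) \o Q2 \o
                            semispectral_int E3 (h n \o val)))%R
    @[N --> \oo] --> 0%E.

Definition triple_int (R : realType) (H : hilbert R)
    (Phi : circle R -> circle R -> circle R -> R[i])
    (E1 : set (circle R) -> H -> H) (Q1 : H -> H)
    (E2 : set (circle R) -> H -> H) (Q2 : H -> H)
    (E3 : set (circle R) -> H -> H) : H -> H :=
  xget 0 [set J | is_triple_int Phi E1 Q1 E2 Q2 E3 J].

Definition segment_op (R : realType) (H : hilbert R) (T S : H -> H) (t : R) :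
    H -> H :=
  (1 - t)%:C *: T + t%:C *: S.

(* One-sided at the endpoints. *)
Definition op_derivative (R : realType) (H : hilbert R) (F : R -> H -> H)
    (t : R) (L : H -> H) : Prop :=
  bounded_op L /\
  opnorm ((s - t)^-1%:C *: (F s - F t) - L)%R
    @[s --> within `[0, 1] (t^')] --> 0%E.

(* Main.v *)
(** Write phi = sum_n p_n with p_n = phi * W_n, a polynomial of degree < 2^(n+1) without
    coefficients of index <= 2^(n-1) (n >= 1), so that sum_n 4^n max |p_n| is finite. The
    function D^2 p_n (a, b, c) = sum_(i,j,l) p_n[i+j+l+2] a^i b^j c^l is a finite sum of
    products f(a) g(b) h(c) of polynomials with total norm at most C 4^n max |p_n|: one of
    i, j, l is large whenever p_n[i+j+l+2] <> 0, and in that variable a smooth (Fejer)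
    truncation of p_n is bounded by a multiple of max |p_n|. Summing over n represents
    D^2 phi in the projective tensor product. Replacing the scalars by T_s and T_t and
    inserting Q = R - T between the factors turns the algebraic identities
    A^k - B^k = sum A^i (A - B) B^j into exact formulas for the difference quotients of
    phi(T_t) and of its first derivative; these are series dominated uniformly in s and t
    by von Neumann's inequality, so the limit s -> t can be taken term by term. *)
Require Import Defs.
From HB Require Import structures.
From mathcomp Require Import all_boot all_order all_algebra.
From mathcomp Require Import complex.
From mathcomp Require Import all_classical all_reals all_analysis.
From mathcomp Require Import cyclic separable cyclotomic ess_sup_inf.
From mathcomp Require Import zify ring lra.

Set Implicit Arguments.
Unset Strict Implicit.
Unset Printing Implicit Defensive.

Import Order.TTheory GRing.Theory Num.Theory.
Import numFieldNormedType.Exports.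

Local Open Scope classical_set_scope.
Local Open Scope ring_scope.
Local Open Scope complex_scope.

(** Bounding a block by the number of its coefficients costs [4 ^ n] for the first difference
    quotient, which the Besov condition pays for, but [8 ^ n] for the second; hence the detour
    through products of polynomials controlled by von Neumann's inequality. The truncation is smooth
    because a sharp cut of the coefficients costs a factor of order [n] in sup norm. The integral on
    the right-hand side is chosen among candidates built from arbitrary disk-algebra representations
    of the kernel and arbitrary dilations, so uniqueness must be proved: every candidate is close in
    norm to one and the same Riemann sum over a fine Borel partition of the circle. Such partitions
    are read off from the spectral integral of the unitary dilation, which also yields von Neumann's
    inequality. The facts on sup norms of polynomials (coefficient bound, maximum principle, Fejer
    multipliers) rest on averages over roots of unity, without contour integrals. Finally, the
    kernel is a limit along triples of distinct points, so such triples must exist near every point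
    of the torus, diagonals included. *)

Section RNorm.
Variables (R : realType) (V : normedModType R[i]).
Implicit Types x y : V.

Lemma norm_rnorm x : `|x| = (rnorm x)%:C.
Proof.
rewrite /rnorm; move: (normr_ge0 x).
by case: `|x| => a b; rewrite lecE/= => /andP[/eqP -> _].
Qed.

Lemma rnorm_le x (c : R) : (`|x| <= c%:C) = (rnorm x <= c).
Proof. by rewrite norm_rnorm lecR. Qed.

Lemma rnorm_lt x (c : R) : (`|x| < c%:C) = (rnorm x < c).
Proof. by rewrite norm_rnorm ltcR. Qed.

Lemma rnorm_ge0 x : 0 <= rnorm x.
Proof. by rewrite -lecR -norm_rnorm normr_ge0. Qed.
Lemma rnorm0 : rnorm (0 : V) = 0.
Proof. by rewrite /rnorm normr0. Qed.

Lemma rnormN x : rnorm (- x) = rnorm x.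
Proof. by rewrite /rnorm normrN. Qed.

Lemma rnormB x y : rnorm (x - y) = rnorm (y - x).
Proof. by rewrite /rnorm distrC. Qed.

Lemma rnormD x y : rnorm (x + y) <= rnorm x + rnorm y.
Proof. by rewrite -lecR rmorphD/= -!norm_rnorm ler_normD. Qed.

Lemma rnormBD x y : rnorm (x - y) <= rnorm x + rnorm y.
Proof. by rewrite (le_trans (rnormD _ _))// rnormN. Qed.

Lemma rnorm_dist x y z : rnorm (x - z) <= rnorm (x - y) + rnorm (y - z).
Proof. by apply: le_trans (rnormD _ _); rewrite addrA subrK. Qed.

Lemma rnormZ (a : R[i]) x : rnorm (a *: x) = rnorm (a : R[i]) * rnorm x.
Proof. by apply: complexI; rewrite rmorphM/= -!norm_rnorm normrZ. Qed.

Lemma rnorm_eq0 x : rnorm x = 0 -> x = 0.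
Proof. by move=> h; apply/eqP; rewrite -normr_eq0 norm_rnorm h. Qed.

Lemma rnorm_sum (I : Type) (r : seq I) (P : pred I) (F : I -> V) :
  rnorm (\sum_(i <- r | P i) F i) <= \sum_(i <- r | P i) rnorm (F i).
Proof.
elim/big_ind2: _ => //; first by rewrite rnorm0.
by move=> x a y b hx hy; rewrite (le_trans (rnormD _ _))// lerD.
Qed.

Lemma rnorm_small x : (forall e : R, 0 < e -> rnorm x <= e) -> x = 0.
Proof.
move=> h; apply: rnorm_eq0; apply/eqP; rewrite eq_le rnorm_ge0 andbT.
by apply/ler_addgt0Pr => e e0; rewrite add0r h.
Qed.

Lemma gt0_real_complex (e : R[i]) : 0 < e -> exists2 r : R, 0 < r & e = r%:C.
Proof. by case: e => a b; rewrite ltcE/= => /andP[/eqP -> a0]; exists a. Qed.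

Lemma cvg_rnormP (T : Type) (F : set_system T) {FF : Filter F} (f : T -> V) (l : V) :
  (f x @[x --> F] --> l) <->
  (forall e : R, 0 < e -> \forall x \near F, rnorm (l - f x) <= e).
Proof.
rewrite cvgrPdist_le; split=> h e e0.
  have /h : 0 < e%:C by rewrite ltcR.
  by apply: filterS => x; rewrite rnorm_le.
have [r r0 ->] := gt0_real_complex e0.
by have := h _ r0; apply: filterS => x; rewrite rnorm_le.
Qed.

End RNorm.
#[global] Hint Extern 0 (is_true (0 <= rnorm _)) => exact: rnorm_ge0 : core.

Section RNormC.
Variable R : realType.
Implicit Types a b : R[i].

Lemma rnormM a b : rnorm (a * b) = rnorm a * rnorm b.
Proof. by rewrite -rnormZ. Qed.

Lemma rnorm1 : rnorm (1 : R[i]) = 1.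
Proof. by rewrite /rnorm normr1. Qed.

Lemma rnormX a n : rnorm (a ^+ n) = rnorm a ^+ n.
Proof. by elim: n => [|n IH]; rewrite ?expr0 ?rnorm1// !exprS rnormM IH. Qed.

Lemma rnorm_real (x : R) : rnorm (x%:C : R[i]) = `|x|.
Proof. by apply: complexI; rewrite -norm_rnorm normc_def/= expr0n/= addr0 sqrtr_sqr. Qed.

Lemma rnormV a : rnorm a^-1 = (rnorm a)^-1.
Proof. by apply: complexI; rewrite fmorphV/= -!norm_rnorm normfV. Qed.

Lemma mul_conj a : a * a^* = (rnorm a ^+ 2)%:C.
Proof.
rewrite /rnorm normc_def/=; case: a => x y /=.
rewrite sqr_sqrtr ?addr_ge0 ?sqr_ge0//; apply/eqP; rewrite eq_complex/=.
by apply/andP; split; apply/eqP; ring.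
Qed.

Lemma rnorm_conj a : rnorm (a^*) = rnorm a.
Proof. by case: a => x y; rewrite /rnorm !normc_def/= sqrrN. Qed.

Lemma rnorm1_neq0 a : rnorm a = 1 -> a != 0.
Proof. by apply: contra_eq_neq => ->; rewrite rnorm0 eq_sym oner_eq0. Qed.

Lemma rnorm_nat n : rnorm (n%:R : R[i]) = n%:R.
Proof. by rewrite /rnorm normr_nat -(rmorph_nat (real_complex R)). Qed.

Lemma circleP (z : R[i]) : circle R z <-> rnorm z = 1.
Proof.
split; rewrite /circle/= => h; first by rewrite /rnorm h.
by rewrite norm_rnorm h.
Qed.

Lemma closed_diskP (z : R[i]) : closed_disk R z <-> rnorm z <= 1.
Proof. by rewrite /closed_disk/= -rnorm_le. Qed.

Lemma val_circle (z : circle R) : rnorm (val z) = 1.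
Proof. by apply/circleP; have /set_mem := valP z. Qed.

End RNormC.

(** * Operator bounds and series *)

Section OpBound.
Variables (R : realType).
Implicit Types H K : hilbert R.

(** Homogeneous form of a norm bound, with real constants and no linearity requirement, so that it
    passes directly to sums, compositions and iterates; [opnormP] and [cvg_opnormP] link it to
    [opnorm]. *)
Definition opb (V W : normedModType R[i]) (A : V -> W) (c : R) : Prop :=
  forall x, rnorm (A x) <= c * rnorm x.

Lemma linfun0 (V W : lmodType R[i]) (A : V -> W) : linear A -> A 0 = 0.
Proof. by move=> lA; have := lA (-1) 0 0; rewrite scaler0 addr0 scaleN1r addNr. Qed.

Lemma linfunD (V W : lmodType R[i]) (A : V -> W) x y :
  linear A -> A (x + y) = A x + A y.
Proof. by move=> lA; have := lA 1 x y; rewrite !scale1r. Qed.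

Lemma linfunZ (V W : lmodType R[i]) (A : V -> W) a x :
  linear A -> A (a *: x) = a *: A x.
Proof. by move=> lA; have := lA a x 0; rewrite (linfun0 lA) !addr0. Qed.

Lemma linfunB (V W : lmodType R[i]) (A : V -> W) x y :
  linear A -> A (x - y) = A x - A y.
Proof. by move=> lA; rewrite (linfunD _ _ lA) -scaleN1r (linfunZ _ _ lA) scaleN1r. Qed.

Lemma linfun_sum (V W : lmodType R[i]) (A : V -> W) (I : Type) (r : seq I)
  (P : pred I) (F : I -> V) :
  linear A -> A (\sum_(i <- r | P i) F i) = \sum_(i <- r | P i) A (F i).
Proof.
move=> lA; apply: (big_morph A) => [x y|]; [exact: linfunD|exact: linfun0].
Qed.

Lemma opnormP H K (A : H -> K) (c : R) : linear A -> 0 <= c ->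
  (opnorm A <= c%:E)%E <-> opb A c.
Proof.
move=> lA c0; split=> [h x|h].
  have [->|x0] := eqVneq x 0.
    by rewrite (linfun0 lA) !rnorm0 mulr0.
  have n0 : 0 < rnorm x.
    by rewrite lt0r rnorm_ge0 andbT; apply: contra x0 => /eqP/rnorm_eq0 ->.
  have : ((rnorm (A ((rnorm x)^-1%:C *: x)))%:E <= c%:E)%E.
    apply: le_trans h; apply: ereal_sup_ubound.
    exists ((rnorm x)^-1%:C *: x) => //=.
    rewrite -[1]/(1%:C) rnorm_le rnormZ rnorm_real ger0_norm ?invr_ge0 ?rnorm_ge0//.
    by rewrite mulVf// gt_eqF.
  rewrite (linfunZ _ _ lA) rnormZ rnorm_real ger0_norm ?invr_ge0 ?rnorm_ge0//.
  by rewrite lee_fin mulrC ler_pdivrMr.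
apply: ge_ereal_sup => _ [x /= xle <-]; rewrite lee_fin (le_trans (h x))//.
by rewrite ler_piMr// -rnorm_le; exact: xle.
Qed.

Lemma opbZ (V W : normedModType R[i]) (A : V -> W) (a : R[i]) c :
  opb A c -> opb (a *: A) (rnorm a * c).
Proof. by move=> h x; rewrite /= rnormZ -mulrA ler_wpM2l. Qed.

Lemma opbD (V W : normedModType R[i]) (A B : V -> W) c d :
  opb A c -> opb B d -> opb (A + B) (c + d).
Proof.
by move=> h k x; rewrite mulrDl (le_trans (rnormD _ _))// lerD.
Qed.

Lemma opbB (V W : normedModType R[i]) (A B : V -> W) c d :
  opb A c -> opb B d -> opb (A - B) (c + d).
Proof.
by move=> h k x; rewrite mulrDl (le_trans (rnormBD _ _))// lerD.
Qed.

Lemma opb_sum (V W : normedModType R[i]) (I : Type) (r : seq I) (P : pred I)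
  (A : I -> V -> W) (c : I -> R) : (forall i, P i -> opb (A i) (c i)) ->
  opb (\sum_(i <- r | P i) A i) (\sum_(i <- r | P i) c i).
Proof.
move=> h; elim/big_ind2 : _ => //.
  by move=> x; rewrite rnorm0 mul0r.
by move=> A1 c1 A2 c2; exact: opbD.
Qed.

Lemma opb_comp (V W X : normedModType R[i]) (A : W -> X) (B : V -> W) c d :
  0 <= c -> opb A c -> opb B d -> opb (A \o B) (c * d).
Proof.
by move=> c0 h k x; rewrite (le_trans (h _))// -mulrA ler_wpM2l.
Qed.

Lemma opb_le (V W : normedModType R[i]) (A : V -> W) c d :
  c <= d -> opb A c -> opb A d.
Proof. by move=> cd h x; rewrite (le_trans (h _))// ler_wpM2r. Qed.

Lemma opb_ext (V W : normedModType R[i]) (A B : V -> W) c :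
  A =1 B -> opb A c -> opb B c.
Proof. by move=> AB h x; rewrite -AB. Qed.

Lemma opb_dist (V W : normedModType R[i]) (A B C : V -> W) c d :
  opb (A - B) c -> opb (B - C) d -> opb (A - C) (c + d).
Proof.
by move=> h k; apply: opb_ext (opbD h k) => x; rewrite /= !fctE addrA subrK.
Qed.

Lemma opb_sym (V W : normedModType R[i]) (A B : V -> W) c :
  opb (A - B) c -> opb (B - A) c.
Proof. by move=> h x; rewrite /= !fctE rnormB; exact: h. Qed.

(** The uniqueness statements behind the [xget] definitions of the integrals and of the functional
    calculus end here: two candidates are shown to be within every positive distance. *)
Lemma opb0_eq (V W : normedModType R[i]) (A B : V -> W) :
  (forall e, 0 < e -> opb (A - B) e) -> A = B.
Proof.
move=> h; apply/funext => x; apply/eqP; rewrite -subr_eq0; apply/eqP.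
have [x0|x0] := eqVneq (rnorm x) 0.
  apply: rnorm_eq0; apply/eqP; rewrite eq_le rnorm_ge0 andbT.
  by have := h 1 ltr01 x; rewrite /= !fctE x0 mulr0.
apply: rnorm_small => e e0; have n0 : 0 < rnorm x by rewrite lt0r x0 rnorm_ge0.
by have := h (e / rnorm x) (divr_gt0 e0 n0) x; rewrite mulfVK.
Qed.

Lemma linear_sum_fct (V W : lmodType R[i]) (I : Type) (r : seq I) (P : pred I)
  (A : I -> V -> W) : (forall i, P i -> linear (A i)) ->
  linear (\sum_(i <- r | P i) A i).
Proof.
move=> h a x y; rewrite !fct_sumE scaler_sumr -big_split/=.
by apply: eq_bigr => i Pi; rewrite h.
Qed.

Lemma linear_comp (V W X : lmodType R[i]) (A : W -> X) (B : V -> W) :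
  linear A -> linear B -> linear (A \o B).
Proof. by move=> h k a x y; rewrite /= k h. Qed.

Lemma linear_addf (V W : lmodType R[i]) (A B : V -> W) :
  linear A -> linear B -> linear (A + B).
Proof. by move=> h k a x y; rewrite !fctE k h scalerDr addrACA. Qed.

Lemma linear_scalef (V W : lmodType R[i]) (A : V -> W) (c : R[i]) :
  linear A -> linear (c *: A).
Proof. by move=> h a x y; rewrite !fctE h scalerDr !scalerA mulrC. Qed.

Lemma linear_oppf (V W : lmodType R[i]) (A : V -> W) :
  linear A -> linear (- A).
Proof. by move=> h a x y; rewrite !fctE h opprD scalerN. Qed.

Lemma linear_subf (V W : lmodType R[i]) (A B : V -> W) :
  linear A -> linear B -> linear (A - B).
Proof. by move=> h k; apply: linear_addf => //; exact: linear_oppf. Qed.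

Lemma linear_iter (V : lmodType R[i]) (A : V -> V) n :
  linear A -> linear (iter n A).
Proof. by move=> h; elim: n => [a x y|n IH a x y] //=; rewrite IH h. Qed.

Lemma opnorm_ge0 H K (A : H -> K) : linear A -> (0 <= opnorm A)%E.
Proof.
move=> lA; apply: ereal_sup_ubound; exists 0 => /=; rewrite ?normr0//.
by rewrite (linfun0 lA) rnorm0.
Qed.

Lemma bounded_opP H K (A : H -> K) :
  bounded_op A <-> linear A /\ exists2 c, 0 <= c & opb A c.
Proof.
split=> [[lA h]|[lA [c c0 h]]]; split=> //.
  exists (fine (opnorm A)).
    exact/fine_ge0/opnorm_ge0.
  have o0 := opnorm_ge0 lA.
  apply/opnormP => //; first exact: fine_ge0.
  by rewrite fineK// ge0_fin_numE.
by apply: le_lt_trans (_ : (c%:E < +oo)%E); [apply/opnormP|rewrite ltry].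
Qed.

Lemma cvg_opnormP H K (T : Type) (F : set_system T) {FF : Filter F}
  (A : T -> H -> K) : (forall t, linear (A t)) ->
  (opnorm (A t) @[t --> F] --> 0%E) <->
  (forall e : R, 0 < e -> \forall t \near F, opb (A t) e).
Proof.
move=> lA; split=> h.
  move=> e e0.
  have h0 : \forall x \near 0%E, (x <= e%:E)%E.
    exists e => //= r; rewrite /ball_/= sub0r normrN => re.
    by rewrite lee_fin (le_trans (ler_norm _))// ltW.
  by refine (@filterS T F FF _ _ _ (h _ h0)) => t ot; apply/(opnormP (lA t) (ltW e0)); exact: ot.
move=> B [e /= e0 eB].
suff : F (fun t => B (opnorm (A t))) by [].
have := h _ (divr_gt0 e0 (ltr0n R 2)); apply: filterS => t.
move/(opnormP (lA t) (ltW (divr_gt0 e0 (ltr0n R 2)))) => ot.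
have := opnorm_ge0 (lA t); case: (opnorm (A t)) ot => [r| |]//.
rewrite lee_fin => re; rewrite lee_fin => r0; apply: eB => /=.
by rewrite sub0r normrN ger0_norm// (le_lt_trans re)// ltr_pdivrMr// ltr_pMr// ltr1n.
Qed.

End OpBound.

(** * Dominated series of vectors and of operators *)

Section Series.
Variable R : realType.

Definition summ (b : nat -> R) : Prop :=
  (forall k, 0 <= b k) /\ exists M, forall n, \sum_(0 <= k < n) b k <= M.

Lemma summ_tail (b : nat -> R) : summ b -> forall e, 0 < e ->
  exists N, forall n m, (N <= n)%N -> \sum_(n <= k < m) b k <= e.
Proof.
move=> [b0 [M bM]] e e0.
have nd : nondecreasing_seq (fun n => \sum_(0 <= k < n) b k).
  apply/nondecreasing_seqP => n; rewrite big_nat_recr//= lerDl; exact: b0.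
have ub : has_ubound (range (fun n => \sum_(0 <= k < n) b k)).
  by exists M => _ [n _ <-]; exact: bM.
have /cvgrPdist_le/(_ _ e0) [N _ hN] := nondecreasing_cvgn nd ub.
exists N => n m Nn; have [mn|nm] := leqP m n; first by rewrite big_geq// ltW.
have := hN n Nn; rewrite ler_distl => /andP[_ h].
rewrite -(lerD2l (\sum_(0 <= k < n) b k)) -big_cat_nat//=; last exact: ltnW.
rewrite (le_trans _ h)//.
by apply: ub_le_sup => //; exists m.
Qed.

Lemma summ_le (b c : nat -> R) : (forall k, 0 <= b k <= c k) -> summ c -> summ b.
Proof.
move=> h [c0 [M cM]]; split; first by move=> k; have /andP[] := h k.
exists M => n; rewrite (le_trans _ (cM n))// ler_sum// => k _.
by have /andP[] := h k.
Qed.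

Lemma summZ (b : nat -> R) (c : R) : 0 <= c -> summ b -> summ (fun k => c * b k).
Proof.
move=> c0 [b0 [M bM]]; split; first by move=> k; rewrite mulr_ge0.
by exists (c * M) => n; rewrite -mulr_sumr ler_wpM2l.
Qed.

Lemma summD (b c : nat -> R) : summ b -> summ c -> summ (fun k => b k + c k).
Proof.
move=> [b0 [M bM]] [c0 [M' cM]]; split; first by move=> k; rewrite addr_ge0.
by exists (M + M') => n; rewrite big_split/= lerD.
Qed.

Definition slim (V : normedModType R[i]) (u : nat -> V) (l : V) : Prop :=
  forall e : R, 0 < e -> exists N, forall n, (N <= n)%N -> rnorm (l - u n) <= e.

Lemma slimP (V : normedModType R[i]) (u : nat -> V) (l : V) :
  slim u l <-> (u n @[n --> \oo] --> l).
Proof.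
rewrite cvg_rnormP; split=> h e e0.
  by have [N hN] := h e e0; exists N => // n /hN.
by have [N _ hN] := h e e0; exists N => n /hN.
Qed.

Lemma slim_unique (V : normedModType R[i]) (u : nat -> V) (l l' : V) :
  slim u l -> slim u l' -> l = l'.
Proof.
move=> h h'; apply/eqP; rewrite -subr_eq0; apply/eqP; apply: rnorm_small => e e0.
have e2 : 0 < e / 2 by rewrite divr_gt0.
have [N hN] := h _ e2; have [N' hN'] := h' _ e2.
rewrite (le_trans (rnorm_dist l (u (maxn N N')) l'))// [leRHS](splitr e) lerD//.
  by apply: hN; exact: leq_maxl.
by rewrite rnormB; apply: hN'; exact: leq_maxr.
Qed.

(** Sequential form of completeness, shared by Hilbert spaces and by the scalars [R[i]], so that one
    lemma on dominated series serves both. *)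
Definition scomplete (V : normedModType R[i]) : Prop := forall u : nat -> V,
  (forall e : R, 0 < e -> exists N, forall m n, (N <= m)%N -> (N <= n)%N ->
     rnorm (u m - u n) <= e) -> exists l, slim u l.

Lemma complete_scomplete (V : completeNormedModType R[i]) : scomplete V.
Proof.
move=> u hu.
have cu : cauchy (u n @[n --> \oo]).
  apply: cauchy_exP => e e0.
  have [r r0 ->] := gt0_real_complex e0.
  have [N hN] := hu _ (divr_gt0 r0 (ltr0n R 2)).
  exists (u N); exists N => //= n /= Nn.
  rewrite -ball_normE/= rnorm_lt (le_lt_trans (hN _ _ _ Nn))//.
  by rewrite ltr_pdivrMr// ltr_pMr// ltr1n.
have /cvg_ex[l hl] : cvg (u n @[n --> \oo]) by exact: cauchy_cvg cu.
by exists l; apply/slimP.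
Qed.

Lemma Re_le_rnorm (z : R[i]) : `|complex.Re z| <= rnorm z.
Proof. by rewrite /rnorm normc_def/= -sqrtr_sqr ler_wsqrtr// lerDl sqr_ge0. Qed.

Lemma Im_le_rnorm (z : R[i]) : `|complex.Im z| <= rnorm z.
Proof. by rewrite /rnorm normc_def/= -sqrtr_sqr ler_wsqrtr// lerDr sqr_ge0. Qed.

Lemma rnorm_ReIm (z : R[i]) : rnorm z <= `|complex.Re z| + `|complex.Im z|.
Proof.
rewrite /rnorm normc_def/= -[leRHS]ger0_norm ?addr_ge0// -sqrtr_sqr ler_wsqrtr//.
rewrite sqrrD !real_normK ?num_real// lerD2r lerDl mulrn_wge0// mulr_ge0//.
Qed.

Lemma scomplete_R (u : nat -> R) :
  (forall e : R, 0 < e -> exists N, forall m n, (N <= m)%N -> (N <= n)%N ->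
     `|u m - u n| <= e) -> exists l, forall e, 0 < e -> exists N, forall n,
       (N <= n)%N -> `|l - u n| <= e.
Proof.
move=> hu.
have cu : cauchy (u n @[n --> \oo]).
  apply: cauchy_exP => e e0.
  have [N hN] := hu _ (divr_gt0 e0 (ltr0n R 2)).
  exists (u N); exists N => //= n /= Nn.
  rewrite -ball_normE/= (le_lt_trans (hN _ _ _ Nn))//.
  by rewrite ltr_pdivrMr// ltr_pMr// ltr1n.
have /cvg_ex[l hl] : cvg (u n @[n --> \oo]) by exact: R_complete cu.
by exists l => e e0; have /cvgrPdist_le/(_ _ e0) [N _ hN] := hl; exists N => n /hN.
Qed.

Lemma scomplete_C : scomplete (R[i] : normedModType R[i]).
Proof.
move=> u hu.
have [a ha] : exists l, forall e, 0 < e -> exists N, forall n,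
       (N <= n)%N -> `|l - complex.Re (u n)| <= e.
  apply: scomplete_R => e e0; have [N hN] := hu e e0; exists N => m n Nm Nn.
  apply: le_trans (hN m n Nm Nn); apply: le_trans (Re_le_rnorm _).
  by case: (u m) (u n) => ? ? [? ?].
have [b hb] : exists l, forall e, 0 < e -> exists N, forall n,
       (N <= n)%N -> `|l - complex.Im (u n)| <= e.
  apply: scomplete_R => e e0; have [N hN] := hu e e0; exists N => m n Nm Nn.
  apply: le_trans (hN m n Nm Nn); apply: le_trans (Im_le_rnorm _).
  by case: (u m) (u n) => ? ? [? ?].
exists (a +i* b) => e e0; have e2 : 0 < e / 2 by rewrite divr_gt0.
have [N hN] := ha _ e2; have [N' hN'] := hb _ e2.
exists (maxn N N') => n; rewrite geq_max => /andP[/hN h1 /hN' h2].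
rewrite (le_trans (rnorm_ReIm _))// [leRHS](splitr e) lerD//.
  by move: h1; case: (u n).
by move: h2; case: (u n).
Qed.

(** The second conclusion keeps the tail of the majorant as an explicit error. Since it depends on
    [b] alone, it later yields uniform convergence of functions and norm convergence of
    operators. *)
Lemma vseries (V : normedModType R[i]) (u : nat -> V) (b : nat -> R) :
  scomplete V -> (forall n, rnorm (u n) <= b n) -> summ b ->
  exists2 l, slim (fun n => \sum_(0 <= k < n) u k) l &
    forall n e, (forall m, \sum_(n <= k < m) b k <= e) ->
      rnorm (l - \sum_(0 <= k < n) u k) <= e.
Proof.
move=> cV ub sb.
have tl n m : rnorm (\sum_(n <= k < m) u k) <= \sum_(n <= k < m) b k.
  by rewrite (le_trans (rnorm_sum _ _ _))// ler_sum.
have df n m : (n <= m)%N ->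
    \sum_(0 <= k < m) u k - \sum_(0 <= k < n) u k = \sum_(n <= k < m) u k.
  by move=> nm; rewrite (big_cat_nat (n := n))//= addrAC subrr add0r.
have [e e0|l hl] := cV (fun n => \sum_(0 <= k < n) u k).
  have [N hN] := summ_tail sb e0; exists N => m n Nm Nn.
  have [nm|/ltnW mn] := leqP n m; last rewrite rnormB.
    by rewrite df// (le_trans (tl _ _))// hN.
  by rewrite df// (le_trans (tl _ _))// hN.
exists l => // n e he; apply/ler_addgt0Pr => d d0.
have [N hN] := hl d d0.
rewrite (le_trans (rnorm_dist _ (\sum_(0 <= k < maxn N n) u k) _))//.
rewrite addrC lerD//; last by apply: hN; exact: leq_maxl.
by rewrite df ?leq_maxr// (le_trans (tl _ _)).
Qed.

(** The sum is taken strongly, vector by vector; [osumP] shows that a summable majorant makes it a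
    norm-convergent sum. *)
Definition osum (V W : normedModType R[i]) (u : nat -> V -> W) (x : V) : W :=
  xget 0 [set l | slim (fun n => \sum_(0 <= k < n) u k x) l].

Lemma osum_slim (V W : normedModType R[i]) (u : nat -> V -> W) x l :
  slim (fun n => \sum_(0 <= k < n) u k x) l -> osum u x = l.
Proof.
by move=> h; rewrite /osum; case: xgetP => [y _ /slim_unique|/(_ l)//]; exact.
Qed.

Lemma osumP (V W : normedModType R[i]) (u : nat -> V -> W) (b : nat -> R) :
  scomplete W -> (forall n, opb (u n) (b n)) -> summ b ->
  (forall x, slim (fun n => \sum_(0 <= k < n) u k x) (osum u x)) /\
    forall n e, (forall m, \sum_(n <= k < m) b k <= e) ->
      opb (osum u - \sum_(0 <= k < n) u k) e.
Proof.
move=> cW ub sb.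
have key x : exists2 l, slim (fun n => \sum_(0 <= k < n) u k x) l &
    forall n e, (forall m, \sum_(n <= k < m) b k * rnorm x <= e) ->
      rnorm (l - \sum_(0 <= k < n) u k x) <= e.
  apply: vseries => // [n|]; first exact: ub.
  have := summZ (rnorm_ge0 x) sb; apply: summ_le => k.
  by rewrite mulrC lexx andbT mulr_ge0//; case: sb.
split=> [x|n e he x]; have [l hl1 hl2] := key x; first by rewrite (osum_slim hl1).
rewrite !fctE fct_sumE (osum_slim hl1); apply: hl2 => m.
by rewrite -mulr_suml ler_wpM2r.
Qed.

Lemma slim_linear (V W : normedModType R[i]) (A : nat -> V -> W) (L : V -> W) :
  (forall n, linear (A n)) -> (forall x, slim (fun n => A n x) (L x)) -> linear L.
Proof.
move=> lA hL a x y; apply: slim_unique (hL _) _ => e e0.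
have c0 : 0 < rnorm a + 1 by rewrite ltr_wpDl.
have [N hN] := hL x _ (divr_gt0 e0 (mulr_gt0 (ltr0n R 2) c0)).
have [N' hN'] := hL y _ (divr_gt0 e0 (ltr0n R 2)).
exists (maxn N N') => n; rewrite geq_max => /andP[/hN h1 /hN' h2].
rewrite lA opprD addrACA -scalerN -scalerDr.
rewrite (le_trans (rnormD _ _))// [leRHS](splitr e) lerD// rnormZ.
rewrite (le_trans (ler_wpM2l _ h1))// mulrA ler_pdivrMr ?mulr_gt0//.
have -> : e / 2 * (2 * (rnorm a + 1)) = (rnorm a + 1) * e by field.
by rewrite ler_pM2r// lerDl.
Qed.

End Series.

(** * Spectral and semi-spectral integrals *)

Section Inner.
Variables (R : realType) (H : hilbert R).
Implicit Types x y z : H.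
Local Notation "''[' x , y ]" := (inner H x y).

Lemma innerC x y : '[x, y] = Num.conj '[y, x].
Proof. by rewrite hermC expr0 mul1r. Qed.
Lemma innerDl x y z : '[x + y, z] = '[x, z] + '[y, z].
Proof. exact: linearDl. Qed.
Lemma innerZl a x y : '[a *: x, y] = a * '[x, y].
Proof. exact: linearZl_LR. Qed.
Lemma innerDr x y z : '[z, x + y] = '[z, x] + '[z, y].
Proof. exact: linearDr. Qed.
Lemma innerZr a x y : '[x, a *: y] = a^* * '[x, y].
Proof. exact: linearZr_LR. Qed.
Lemma innerBl x y z : '[x - y, z] = '[x, z] - '[y, z].
Proof. exact: linearBl. Qed.
Lemma innerBr x y z : '[z, x - y] = '[z, x] - '[z, y].
Proof. exact: linearBr. Qed.
Lemma inner0l y : '[0, y] = 0.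
Proof. exact: linear0l. Qed.
Lemma inner_suml I (r : seq I) (P : pred I) (F : I -> H) y :
  '[\sum_(i <- r | P i) F i, y] = \sum_(i <- r | P i) '[F i, y].
Proof. exact: linear_sumlz. Qed.
Lemma inner_sumr I (r : seq I) (P : pred I) (F : I -> H) y :
  '[y, \sum_(i <- r | P i) F i] = \sum_(i <- r | P i) '[y, F i].
Proof. exact: linear_sumr. Qed.

Lemma innerxx x : '[x, x] = (rnorm x ^+ 2)%:C.
Proof. by rewrite -normE norm_rnorm rmorphXn. Qed.

Lemma inner_ext x y : (forall z, '[x, z] = '[y, z]) -> x = y.
Proof.
move=> h; apply/eqP; rewrite -subr_eq0; apply/eqP; apply: rnorm_eq0; apply/eqP.
rewrite -sqrf_eq0; apply/eqP; apply: complexI.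
by rewrite -innerxx innerBl h subrr.
Qed.

(** With [a] the inner product and [b] the squared norm of [y], the squared norm of
    [b *: x - a *: y] is [b] times the Gram determinant of [x] and [y], which is therefore
    nonnegative. *)
Lemma cauchy_schwarz x y : rnorm ('[x, y] : R[i]) <= rnorm x * rnorm y.
Proof.
have [y0|y0] := eqVneq (rnorm y) 0.
  by rewrite (rnorm_eq0 y0) innerC inner0l rmorph0 !rnorm0 mulr0.
have {}y0 : 0 < rnorm y by rewrite lt0r y0 rnorm_ge0.
set a : R[i] := '[x, y]; pose b : R[i] := (rnorm y ^+ 2)%:C.
have bb : Num.conj b = b by exact: conjc_real.
have aa := mul_conj a.
have : '[b *: x - a *: y, b *: x - a *: y] = b * (b * '[x, x] - a * a^*).
  have ba : '[y, x] = Num.conj a by rewrite innerC.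
  have by' : '[y, y] = b by rewrite innerxx.
  rewrite !(innerBl, innerBr, innerZl, innerZr).
  rewrite bb ba by' -/a; ring.
rewrite aa !innerxx /b -!(rmorphM, rmorphB)/= => /complexI e.
have : 0 <= rnorm y ^+ 2 * (rnorm y ^+ 2 * rnorm x ^+ 2 - rnorm a ^+ 2).
  by rewrite -e sqr_ge0.
rewrite pmulr_rge0 ?exprn_gt0// subr_ge0 -exprMn mulrC.
by rewrite ler_pXn2r// ?nnegrE ?mulr_ge0.
Qed.

End Inner.

(** * Compressions to a subspace *)

Section Compression.
Variables (R : realType) (H K : hilbert R) (V : H -> K).
Hypothesis isoV : isometric_embedding V.

Lemma compressionE B A : compression V B A <->
  forall x y, inner H (A x) y = inner K (B (V x)) (V y).
Proof.
case: isoV => lV iV; split=> h x y.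
  by have := h x y; rewrite innerBl iV => /eqP; rewrite subr_eq0 => /eqP ->.
by rewrite innerBl iV h subrr.
Qed.

Lemma iso_norm x : rnorm (V x) = rnorm x.
Proof.
case: isoV => lV iV; apply/eqP; rewrite -(@eqrXn2 _ 2)//; apply/eqP.
by apply: complexI; rewrite -!innerxx iV.
Qed.

(** Testing against [A x] itself gives |A x|^2 = <B V x, V A x>, and [V] preserves norms. Bounds
    proved on the dilation space descend to [H] in this way. *)
Lemma compression_norm B A x : compression V B A -> rnorm (A x) <= rnorm (B (V x)).
Proof.
move=> /compressionE h; have [->|n0] := eqVneq (rnorm (A x)) 0 => //.
have n1 : 0 < rnorm (A x) by rewrite lt0r n0 rnorm_ge0.
rewrite -(ler_pM2r n1) -expr2 -lecR -innerxx h (le_trans (real_ler_norm _))//.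
  by rewrite -h innerxx; apply: ger0_real; rewrite lecR sqr_ge0.
by rewrite norm_rnorm lecR (le_trans (cauchy_schwarz _ _))// iso_norm.
Qed.

Lemma compression_opb B A c : compression V B A -> opb B c -> opb A c.
Proof.
by move=> h k x; rewrite (le_trans (compression_norm x h))// -(iso_norm x).
Qed.

Lemma compression_linear B A : linear B -> compression V B A -> linear A.
Proof.
move=> lB /compressionE h a x y; apply: inner_ext => z.
case: isoV => lV iV.
by rewrite h lV lB innerDl innerZl -!h -innerZl -innerDl.
Qed.

Lemma compressionD B A B' A' :
  compression V B A -> compression V B' A' -> compression V (B + B') (A + A').
Proof.
move=> /compressionE h /compressionE k; apply/compressionE => x y.
by rewrite !fctE !innerDl h k.
Qed.

Lemma compressionZ B A (c : R[i]) :
  compression V B A -> compression V (c *: B) (c *: A).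
Proof.
move=> /compressionE h; apply/compressionE => x y.
by rewrite !fctE !innerZl h.
Qed.

Lemma compressionB B A B' A' :
  compression V B A -> compression V B' A' -> compression V (B - B') (A - A').
Proof.
move=> /compressionE h /compressionE k; apply/compressionE => x y.
by rewrite !fctE !innerBl h k.
Qed.

Lemma compression_sum I (r : seq I) (P : pred I) (B : I -> K -> K) (A : I -> H -> H) :
  (forall i, P i -> compression V (B i) (A i)) ->
  compression V (\sum_(i <- r | P i) B i) (\sum_(i <- r | P i) A i).
Proof.
move=> h; elim/big_ind2 : _ => //; last by move=> ? ? ? ?; exact: compressionD.
by apply/compressionE => x y; rewrite !inner0l.
Qed.

End Compression.

(** * Integrals of simple functions against a spectral measure *)

Section Spectral.
Variables (R : realType) (K : hilbert R) (F : set (circle R) -> K -> K).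
Hypothesis spF : spectral F.

Lemma spectral_linear D : borel D -> linear (F D).
Proof. by case: spF => -[h _ _ _] _ /h[[]]. Qed.

Lemma spectral_ge0 D x : borel D -> 0 <= inner K (F D x) x.
Proof. by case: spF => -[h _ _ _] _ /h[_]; exact. Qed.

Lemma spectral0 : F set0 = 0.
Proof. by case: spF => -[]. Qed.

Lemma borel0 : borel (set0 : set (circle R)).
Proof. exact: sigma_algebra0. Qed.

Lemma borelI (D D' : set (circle R)) : borel D -> borel D' -> borel (D `&` D').
Proof.
move=> bD bD'.
have bC A : borel A -> borel (~` A : set (circle R)).
  by move=> bA; rewrite -setTD; exact: sigma_algebraCD.
rewrite -[_ `&` _]setCK setCI; apply: (bC); rewrite -bigcup2E.
by apply: sigma_algebra_bigcup => -[|[|n]]; [exact: bC|exact: bC|exact: borel0].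
Qed.

(** The definition grants positivity, not symmetry; the latter follows by polarization, the
    quadratic form of [F D] being real at [x + y] and at [x + 'i *: y]. *)
Lemma spectral_sym D x y : borel D -> inner K (F D x) y = inner K x (F D y).
Proof.
move=> bD; have lF := spectral_linear bD.
have re z : complex.Im (inner K (F D z) z) = 0.
  by have := spectral_ge0 z bD; rewrite lecE/= => /andP[/eqP ->].
rewrite (innerC x).
set p := inner K (F D x) y; set q := inner K (F D y) x.
have h1 := re (x + y); have h2 := re (x + 'i *: y).
have e1 : inner K (F D (x + y)) (x + y) =
    inner K (F D x) x + inner K (F D y) y + (p + q).
  by rewrite (linfunD _ _ lF) !(innerDl, innerDr) -/p -/q; ring.
have e2 : inner K (F D (x + 'i *: y)) (x + 'i *: y) =
    inner K (F D x) x + inner K (F D y) y + 'i * (q - p).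
  rewrite (linfunD _ _ lF) (linfunZ _ _ lF) !(innerDl, innerDr, innerZl, innerZr).
  rewrite conjCi -/p -/q; have i2 : 'i * 'i = -1 :> R[i] by rewrite -expr2 sqrCi.
  apply/eqP; rewrite -subr_eq0.
  rewrite (_ : _ - _ = - (('i * 'i + 1) * inner K (F D y) y)); last by ring.
  by rewrite i2 addNr mul0r oppr0.
move: h1 h2; rewrite e1 e2 !raddfD/= !re !add0r.
case: (p) (q) => [a b] [c d] /=; rewrite mul0r mul1r add0r => h1 /eqP.
rewrite subr_eq0 => /eqP h2; apply/eqP; rewrite eq_complex/= h2 eqxx/=.
by rewrite -addr_eq0 h1.
Qed.

Definition borel_partition (I : finType) (D : I -> set (circle R)) : Prop :=
  [/\ forall i, borel (D i), trivIset setT D & \bigcup_i D i = setT].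

Definition step (E : set (circle R) -> K -> K) (I : finType)
    (D : I -> set (circle R)) (c : I -> R[i]) : K -> K := \sum_i c i *: E (D i).

(** Additivity is granted for sequences of sets, in the weak sense. The finite family is extended by
    empty sets to a sequence, whose series of inner products is constant from rank [#|I|] on. *)
Lemma partition_sum (I : finType) (D : I -> set (circle R)) x :
  borel_partition D -> \sum_i F (D i) x = x.
Proof.
move=> [bD tD cD]; apply: inner_ext => y.
pose D' n := if insub n is Some i then D (enum_val (i : 'I_#|I|)) else set0.
have bD' n : borel (D' n).
  by rewrite /D'; case: insubP => [i _ _|_]; [exact: bD|exact: borel0].
have tD' : trivIset setT D'.
  apply/trivIsetP => i j _ _ ij; rewrite /D'.
  case: insubP => [i' _ ii|_]; last by rewrite set0I.
  case: insubP => [j' _ jj|_]; last by rewrite setI0.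
  move/trivIsetP: tD; apply => //; apply: contra ij => /eqP/enum_val_inj.
  by rewrite -ii -jj => ->.
have cD' : \bigcup_n D' n = setT.
  rewrite -cD; apply/seteqP; split=> z [i _ Di].
    by move: Di; rewrite /D'; case: insubP => // i' _ _ Di; exists (enum_val i').
  exists (enum_rank i) => //; rewrite /D'.
  by rewrite (valK (enum_rank i)) enum_rankK.
case: spF => -[_ _ FT ad] _.
have := ad D' bD' tD' x y; rewrite cD' FT => /slimP h.
apply: slim_unique h => e e0; exists #|I| => n In.
rewrite [X in _ - X](_ : _ = inner K (\sum_i F (D i) x) y).
  by rewrite subrr rnorm0 ltW.
rewrite (big_cat_nat (n := #|I|))//= [X in _ + X]big1_seq ?addr0.
  rewrite big_mkord inner_suml (reindex (@enum_val I I))/=; last first.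
    by apply: onW_bij; exact: enum_val_bij.
  apply: eq_big => [i|i _]; first by rewrite ?inE.
  by rewrite /D' (valK i).
move=> i; rewrite mem_index_iota => /andP[_ /andP[Ii _]].
by rewrite /D' insubF ?spectral0 ?inner0l// ltnNge Ii.
Qed.

Lemma spectral_ortho (D D' : set (circle R)) x y : borel D -> borel D' -> D `&` D' = set0 ->
  inner K (F D x) (F D' y) = 0.
Proof.
move=> bD bD' DD'; rewrite -spectral_sym//.
by case: spF => _ mu; rewrite -[F D' (F D x)]/((F D' \o F D) x) -mu// setIC DD' spectral0 inner0l.
Qed.

Lemma spectral_idem D x : borel D -> F D (F D x) = F D x.
Proof. by move=> bD; case: spF => _ mu; rewrite -[LHS]/((F D \o F D) x) -mu// setIid. Qed.

(** The vectors [F (D i) x] are pairwise orthogonal, so the squared norms of [x] and of its image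
    are sums of the nonnegative numbers <F (D i) x, x>, weighted by |c i|^2 for the image. An empty
    cell contributes 0, so its coefficient is left free. *)
Lemma step_opb (I : finType) (D : I -> set (circle R)) (c : I -> R[i]) (M : R) :
  borel_partition D -> (forall i z, D i z -> rnorm (c i) <= M) -> 0 <= M ->
  opb (step F D c) M.
Proof.
move=> pD cM M0 x; have [bD tD cD] := pD.
have key : inner K (step F D c x) (step F D c x) =
    \sum_i (rnorm (c i) ^+ 2)%:C * inner K (F (D i) x) x.
  rewrite /step fct_sumE inner_suml; apply: eq_bigr => i _.
  rewrite fctE innerZl inner_sumr (bigD1 i)//= big1 ?addr0.
    rewrite fctE innerZr mulrA mul_conj; congr (_ * _).
    by rewrite -spectral_sym// spectral_idem.
  move=> j ji; rewrite fctE innerZr spectral_ortho ?mulr0//.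
  by move/trivIsetP: tD; apply => //; rewrite eq_sym.
rewrite -(ler_pXn2r (ltn0Sn 1)) ?nnegrE ?mulr_ge0// -lecR -innerxx key.
have e : inner K x x = \sum_i inner K (F (D i) x) x.
  by rewrite -inner_suml partition_sum.
rewrite exprMn rmorphM/= -innerxx [inner K x x]e mulr_sumr.
apply: ler_sum => i _; have [/eqP D0|/set0P[z Dz]] := boolP (D i == set0).
  by rewrite D0 spectral0 !inner0l !mulr0.
rewrite ler_wpM2r ?spectral_ge0// lecR ler_pXn2r ?nnegrE//.
exact: cM Dz.
Qed.

Lemma step_linear (I : finType) (D : I -> set (circle R)) (c : I -> R[i]) :
  borel_partition D -> linear (step F D c).
Proof.
by move=> [bD _ _]; apply: linear_sum_fct => i _; apply: linear_scalef; exact: spectral_linear.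
Qed.

Lemma step_mul (I : finType) (D : I -> set (circle R)) (c d : I -> R[i]) x :
  borel_partition D -> step F D c (step F D d x) = step F D (fun i => c i * d i) x.
Proof.
move=> [bD tD cD]; rewrite /step !fct_sumE; apply: eq_bigr => i _.
have lF := spectral_linear (bD i).
rewrite !fctE (linfun_sum _ _ _ lF) (bigD1 i)//= big1 ?addr0.
  by rewrite fctE (linfunZ _ _ lF) spectral_idem// scalerA.
move=> j ji; rewrite fctE (linfunZ _ _ lF).
case: spF => _ mu; rewrite -[F _ (F _ x)]/((F (D i) \o F (D j)) x) -mu//.
rewrite (_ : D i `&` D j = set0) ?spectral0 ?scaler0//.
by move/trivIsetP: tD; apply => //; rewrite eq_sym.
Qed.

Lemma step1 (I : finType) (D : I -> set (circle R)) x :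
  borel_partition D -> step F D (fun=> 1) x = x.
Proof.
move=> pD; rewrite /step fct_sumE -[RHS](partition_sum x pD).
by apply: eq_bigr => i _; rewrite fctE scale1r.
Qed.

Lemma partition_prod (I J : finType) (D : I -> set (circle R)) (D' : J -> set (circle R)) :
  borel_partition D -> borel_partition D' -> borel_partition (fun ij : I * J => D ij.1 `&` D' ij.2).
Proof.
move=> [bD tD cD] [bD' tD' cD']; split.
- by move=> ij; exact: borelI.
- apply/trivIsetP => -[i j] [i' j'] _ _ ne /=.
  have [ii|ii] := eqVneq i i'; last first.
    by rewrite setIACA (_ : D i `&` D i' = set0) ?set0I//; move/trivIsetP: tD; apply.
  rewrite setIACA (_ : D' j `&` D' j' = set0) ?setI0//; move/trivIsetP: tD'; apply => //.
  by apply: contra ne => /eqP ->; rewrite ii.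
- apply/seteqP; split=> // z _.
  have : [set: circle R] z by []. rewrite -{1}cD => -[i _ Di].
  have : [set: circle R] z by []. rewrite -{1}cD' => -[j _ Dj].
  by exists (i, j).
Qed.

(** On the common refinement the difference has coefficients [c i - c' j], and any point of a
    nonempty intersection compares both with the value of [f] there. *)
Lemma step_diff (I J : finType) (D : I -> set (circle R)) (D' : J -> set (circle R))
   (c : I -> R[i]) (c' : J -> R[i]) (f : circle R -> R[i]) (e e' : R) :
  0 <= e -> 0 <= e' ->
  borel_partition D -> borel_partition D' ->
  (forall i z, D i z -> rnorm (f z - c i) <= e) ->
  (forall j z, D' j z -> rnorm (f z - c' j) <= e') ->
  opb (step F D c - step F D' c') (e + e').
Proof.
move=> e0 e'0 pD pD' h h'; have [bD _ _] := pD; have [bD' _ _] := pD'.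
have mu : forall i j x, F (D i `&` D' j) x = F (D i) (F (D' j) x).
  by move=> i j x; case: spF => _ mu; rewrite mu.
suff -> : step F D c - step F D' c' =
    step F (fun ij : I * J => D ij.1 `&` D' ij.2) (fun ij => c ij.1 - c' ij.2).
  apply: step_opb; [exact: partition_prod| |exact: addr_ge0].
  move=> [i j] z [/= /h hi /h' hj].
  by rewrite (le_trans (rnorm_dist _ (f z) _))// lerD// rnormB.
apply/funext => x; rewrite !fctE /step !fct_sumE.
rewrite -(pair_bigA_idem _ (fun i j => ((c i - c' j) *: F (D i `&` D' j)) x))/=; last first.
  by rewrite addr0.
under [RHS]eq_bigr do under eq_bigr do rewrite fctE scalerBl.
under [RHS]eq_bigr do rewrite big_split/=.
rewrite big_split/=; congr (_ + _).
  apply: eq_bigr => i _; rewrite fctE -scaler_sumr; congr (_ *: _).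
  rewrite -{1}(partition_sum x pD') (linfun_sum _ _ _ (spectral_linear (bD i))).
  by apply: eq_bigr => j _; rewrite mu.
rewrite exchange_big/= -sumrN; apply: eq_bigr => j _.
rewrite fctE -scaleNr; under eq_bigr do rewrite -scaleNr.
rewrite -scaler_sumr; congr (_ *: _).
rewrite -{1}(partition_sum (F (D' j) x) pD).
by apply: eq_bigr => i _; rewrite mu.
Qed.

End Spectral.

(** * Norm limits of operators and perturbation of polynomials *)

Section OpLimit.
Variables (R : realType).

Lemma op_limit (V W : normedModType R[i]) (S : nat -> V -> W) (a : nat -> R) :
  scomplete W -> (forall m, linear (S m)) ->
  (forall m n, opb (S m - S n) (a m + a n)) ->
  (forall e, 0 < e -> exists N, forall n, (N <= n)%N -> a n <= e) ->
  exists2 L : V -> W, linear L & forall m, opb (L - S m) (a m).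
Proof.
move=> cW lS hS ha.
have hx x : exists l, slim (fun n => S n x) l.
  apply: cW => e e0.
  have c0 : 0 < rnorm x + 1 by rewrite ltr_wpDl.
  have [N hN] := ha _ (divr_gt0 e0 (mulr_gt0 (ltr0n R 2) c0)).
  exists N => m n /hN am /hN an; rewrite (le_trans (hS m n x))//.
  rewrite (le_trans (ler_wpM2r _ (lerD am an)))//.
  rewrite (_ : _ + _ = e / (rnorm x + 1)); last by field; rewrite gt_eqF.
  by rewrite mulrAC ler_pdivrMr// ler_pM2l// lerDl.
have [L hL] := choice hx; exists L; first exact: slim_linear hL.
move=> m x; apply/ler_addgt0Pr => e e0; rewrite !fctE.
have c0 : 0 < rnorm x + 1 by rewrite ltr_wpDl.
have [N hN] := ha _ (divr_gt0 (divr_gt0 e0 (ltr0n R 2)) c0).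
have [N' hN'] := hL x _ (divr_gt0 e0 (ltr0n R 2)).
pose n := maxn N N'.
rewrite (le_trans (rnorm_dist _ (S n x) _))// addrC.
have -> : a m * rnorm x + e = (a m * rnorm x + e / 2) + e / 2 by field.
rewrite lerD ?hN' ?leq_maxr// rnormB (le_trans (hS m n x))// mulrDl lerD2l.
have an := hN n (leq_maxl _ _); rewrite (le_trans (ler_wpM2r _ an))//.
by rewrite mulrAC ler_pdivrMr// ler_pM2l ?divr_gt0// lerDl.
Qed.

Lemma invn_small (e : R) : 0 < e -> exists N, forall n, (N <= n)%N -> (n.+1%:R : R)^-1 <= e.
Proof.
move=> e0; exists (Num.trunc e^-1) => n Nn.
rewrite -[leRHS]invrK lef_pV2 ?posrE ?invr_gt0//.
have /andP[_ /ltW h] := truncn_itv (ltW (etrans (invr_gt0 e) e0)).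
by rewrite (le_trans h)// ler_nat.
Qed.

Lemma iter_opb (V : normedModType R[i]) (S : V -> V) (c : R) n :
  0 <= c -> opb S c -> opb (iter n S) (c ^+ n).
Proof.
move=> c0 h; elim: n => [x|n IH x]; first by rewrite expr0 mul1r.
by rewrite iterS exprS (le_trans (h _))// -mulrA ler_wpM2l// IH.
Qed.

(** Telescoping U^(n+1) - S^(n+1) = U (U^n - S^n) + (U - S) S^n. The bound 2 on [S] leaves room for
    simple-function approximations of a contraction, which need not be contractions themselves. *)
Lemma iter_diff (V : normedModType R[i]) (U S : V -> V) (e : R) n :
  linear U -> 0 <= e ->
  opb U 1 -> opb S 2 -> opb (U - S) e -> opb (iter n U - iter n S) (2 ^+ n * e).
Proof.
move=> lU e0 hU hS h; elim: n => [|n IH] x.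
  by rewrite !fctE/= subrr rnorm0 mulr_ge0// mulr_ge0.
rewrite !fctE !iterS -(subrK (U (iter n S x)) (U _)) -addrA.
rewrite -(linfunB _ _ lU) (le_trans (rnormD _ _))//.
have -> : 2 ^+ n.+1 * e * rnorm x = 2 ^+ n * e * rnorm x + e * (2 ^+ n * rnorm x).
  by rewrite exprS; ring.
apply: lerD.
  by rewrite (le_trans (hU _))// mul1r; exact: IH.
by rewrite (le_trans (h _))// ler_wpM2l// iter_opb.
Qed.

Lemma horner_op_diff (H : hilbert R) (U S : H -> H) (e : R) (p : {poly R[i]}) :
  linear U -> 0 <= e ->
  opb U 1 -> opb S 2 -> opb (U - S) e ->
  opb (horner_op p U - horner_op p S) ((\sum_(i < size p) rnorm p`_i * 2 ^+ i) * e).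
Proof.
move=> lU e0 hU hS h x; rewrite !fctE /horner_op -sumrB.
rewrite (le_trans (rnorm_sum _ _ _))// !mulr_suml ler_sum// => i _.
rewrite -scalerBr rnormZ -!mulrA ler_wpM2l// mulrA.
exact: (iter_diff i lU e0 hU hS h x).
Qed.

Lemma horner_diff (z c : R[i]) (e : R) (p : {poly R[i]}) :
  0 <= e -> rnorm z <= 1 -> rnorm c <= 2 -> rnorm (z - c) <= e ->
  rnorm (p.[z] - p.[c]) <= (\sum_(i < size p) rnorm p`_i * 2 ^+ i) * e.
Proof.
move=> e0 hz hc zc; rewrite !horner_coef -sumrB.
rewrite (le_trans (rnorm_sum _ _ _))// mulr_suml ler_sum// => i _.
rewrite -mulrBr rnormM -mulrA ler_wpM2l//.
have it (w : R[i]) n : iter n ( *%R w) 1 = w ^+ n.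
  by elim: n => [|n /= ->]; rewrite ?expr0// exprS.
have bd (w : R[i]) (d : R) : rnorm w <= d -> opb (fun v : R[i] => w * v) d.
  by move=> h x; rewrite rnormM ler_wpM2r.
(* Multiplication by a scalar is an operator on [R[i]] whose iterates applied to 1 are the powers,
   so the operator estimate contains the scalar one. *)
have := @iter_diff (R[i] : normedModType R[i]) ( *%R z) ( *%R c) e i _ e0 (bd _ _ hz) (bd _ _ hc).
move=> /(_ _ _ 1); rewrite !fctE !it rnorm1 mulr1; apply.
  by move=> a x y; rewrite mulrDr; congr (_ + _); exact: mulrCA.
move=> x; rewrite -[rnorm _]/(rnorm (z * x - c * x)) -mulrBl rnormM.
by rewrite ler_wpM2r.
Qed.

Lemma horner_op_linear (H : hilbert R) (T : H -> H) p : linear T -> linear (horner_op p T).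
Proof.
move=> lT a x y; rewrite /horner_op scaler_sumr -big_split/=; apply: eq_bigr => i _.
by rewrite (linear_iter _ lT) scalerDr !scalerA mulrC.
Qed.

End OpLimit.

(** * Polynomials of a spectral integral *)

Section SpectralIntegral.
Variables (R : realType) (K : hilbert R) (F : set (circle R) -> K -> K).
Hypothesis spF : spectral F.

Lemma spint_opb f B M : is_spectral_int F f B -> 0 <= M ->
  (forall z, rnorm (f z) <= M) -> opb B M.
Proof.
move=> [bB hB] M0 fM x; apply/ler_addgt0Pr => e e0.
have c0 : 0 < rnorm x + 1 by rewrite ltr_wpDl.
have d0 := divr_gt0 (divr_gt0 e0 (ltr0n R 2)) c0; set d := _ / _ in d0.
have [n [c [D [bD tD cD hc hS]]]] := hB _ d0.
have pD : borel_partition D by [].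
have lB : linear B by case: bB.
have lS := step_linear spF c pD.
have {}hS : opb (B - step F D c) d.
  apply/opnormP => //; [exact: linear_subf|exact: ltW].
have cM : opb (step F D c) (M + d).
  apply: step_opb => // [i z Dz|]; last by rewrite addr_ge0// ltW.
  rewrite -[c i](subrK (f z)) (le_trans (rnormD _ _))// addrC lerD//.
  by rewrite rnormB; exact: hc Dz.
have := opbD hS cM x; rewrite !fctE subrK => /le_trans; apply.
rewrite addrCA mulrDl lerD2l -mulr2n -mulr_natr /d.
rewrite (_ : _ * 2 = e / (rnorm x + 1)); last by field; rewrite gt_eqF.
by rewrite mulrAC ler_pdivrMr// ler_pM2l// lerDl.
Qed.

Lemma spint_val_opb U : is_spectral_int F val U -> opb U 1.
Proof. by move=> h; apply: spint_opb h ler01 _ => z; rewrite val_circle. Qed.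

Lemma horner_op_step (I : finType) (D : I -> set (circle R)) (c : I -> R[i]) p x :
  borel_partition D ->
  horner_op p (step F D c) x = step F D (fun i => p.[c i]) x.
Proof.
move=> pD.
have it n : iter n (step F D c) x = step F D (fun i => c i ^+ n) x.
  elim: n => [|n /= ->]; first by rewrite step1.
  by rewrite step_mul//; congr step; apply/funext => i; rewrite exprS.
rewrite /horner_op; under eq_bigr do rewrite it.
rewrite /step; under eq_bigr do rewrite fct_sumE scaler_sumr.
rewrite exchange_big fct_sumE; apply: eq_bigr => i _.
rewrite fctE horner_coef scaler_suml; apply: eq_bigr => k _.
by rewrite fctE scalerA.
Qed.

Lemma spint_fine U (e : R) : is_spectral_int F val U -> 0 < e ->
  exists n (D : 'I_n -> set (circle R)) c, [/\ borel_partition D,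
    forall i z, D i z -> rnorm (val z - c i) <= e & opb (U - step F D c) e].
Proof.
move=> [bB hB] e0; have [n [c [D [bD tD cD hc hS]]]] := hB _ e0.
have pD : borel_partition D by [].
exists n, D, c; split => //.
apply/opnormP => //; last exact: ltW.
by apply: linear_subf; [case: bB|exact: step_linear].
Qed.

Lemma spint_poly U p : is_spectral_int F val U ->
  is_spectral_int F (fun z => p.[val z]) (horner_op p U).
Proof.
move=> hU; have lU : linear U by case: hU => -[].
have U1 := spint_val_opb hU.
set L := \sum_(i < size p) rnorm p`_i * 2 ^+ i.
have L0 : 0 <= L by apply: sumr_ge0 => i _; rewrite mulr_ge0.
split.
  apply/bounded_opP; split; first exact: horner_op_linear.
  exists (\sum_(i < size p) rnorm p`_i); first by apply: sumr_ge0 => i _.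
  move=> x; rewrite /horner_op (le_trans (rnorm_sum _ _ _))// mulr_suml ler_sum// => i _.
  by rewrite rnormZ ler_wpM2l// (le_trans (iter_opb i ler01 U1 x))// expr1n mul1r.
move=> e e0.
(* The minimum with 1 keeps the sampled values [c i] in the disk of radius 2, where [horner_diff]
   applies with constant [L]; the other bound makes the error [L * d] at most [e], also when [L] is
   0. *)
pose d : R := Num.min 1 (e / (L + 1)).
have L1 : 0 < L + 1 by rewrite ltr_wpDl.
have d0 : 0 < d by rewrite lt_min ltr01 divr_gt0.
have d1 : d <= 1 by rewrite ge_min lexx.
have Lde : L * d <= e.
  rewrite (@le_trans _ _ (L * (e / (L + 1))))//.
    by rewrite ler_wpM2l// ge_min lexx orbT.
  by rewrite mulrCA ler_piMr ?(ltW e0)// ler_pdivrMr// mul1r lerDl.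
have [n [D [c [pD hc hS]]]] := spint_fine hU d0.
have cn i z : D i z -> rnorm (c i) <= 2.
  move=> Dz; rewrite -[c i](subrK (val z)) (le_trans (rnormD _ _))//.
  by rewrite val_circle -[2]/(1+1) lerD2r rnormB (le_trans _ d1)//; exact: hc Dz.
exists n, (fun i => p.[c i]), D; case: (pD) => bD tD cD; split => //.
  move=> i z Dz; rewrite (le_trans _ Lde)//; apply: horner_diff.
  - exact: ltW.
  - by rewrite val_circle.
  - exact: cn Dz.
  - exact: hc Dz.
have lS := step_linear spF c pD.
apply/opnormP; last 1 first.
- apply: opb_le Lde _.
  apply: opb_ext (horner_op_diff p lU (ltW d0) U1 (step_opb spF pD cn (ler0n _ 2)) hS).
  by move=> x; rewrite !fctE horner_op_step.
- apply: linear_subf; first exact: horner_op_linear.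
  exact: step_linear.
- exact: ltW.
Qed.

End SpectralIntegral.

(** * Integrals against a semi-spectral measure *)

Section Semispectral.
Variables (R : realType) (H : hilbert R).

Lemma step_compression (K : hilbert R) (V : H -> K) F (E : set (circle R) -> H -> H)
    (I : finType) (D : I -> set (circle R)) (c : I -> R[i]) :
  spectral_dilation E V F -> borel_partition D ->
  compression V (step F D c) (step E D c).
Proof.
move=> [isoV spF cE] [bD _ _]; apply: compression_sum => // i _.
by apply: compressionZ => //; exact: cE.
Qed.

Definition finely_approx (f : circle R -> R[i]) : Prop := forall e : R, 0 < e ->
  exists n (D : 'I_n -> set (circle R)) (c : 'I_n -> R[i]),
    borel_partition D /\ forall i z, D i z -> rnorm (f z - c i) <= e.

Definition fine_partitions (E : set (circle R) -> H -> H) : Prop := forall d : R, 0 < d ->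
  exists n (D : 'I_n -> set (circle R)) (w : 'I_n -> circle R),
    borel_partition D /\ forall i z, D i z -> rnorm (val z - val (w i)) <= d.

Variables (E : set (circle R) -> H -> H) (K : hilbert R) (V : H -> K)
  (F : set (circle R) -> K -> K).
Hypothesis dil : spectral_dilation E V F.

Let isoV : isometric_embedding V. Proof. by case: dil. Qed.
Let spF : spectral F. Proof. by case: dil. Qed.

Lemma estep_linear (I : finType) (D : I -> set (circle R)) (c : I -> R[i]) :
  borel_partition D -> linear (step E D c).
Proof.
by move=> pD; exact: compression_linear (step_linear spF c pD) (step_compression c dil pD).
Qed.

Lemma estep_opb (I : finType) (D : I -> set (circle R)) (c : I -> R[i]) (M : R) :
  borel_partition D -> (forall i z, D i z -> rnorm (c i) <= M) -> 0 <= M ->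
  opb (step E D c) M.
Proof.
move=> pD h M0; apply: (compression_opb isoV (step_compression c dil pD)).
exact: step_opb.
Qed.

Lemma estep_diff (I J : finType) (D : I -> set (circle R)) (D' : J -> set (circle R))
   (c : I -> R[i]) (c' : J -> R[i]) (f : circle R -> R[i]) (e e' : R) :
  0 <= e -> 0 <= e' -> borel_partition D -> borel_partition D' ->
  (forall i z, D i z -> rnorm (f z - c i) <= e) ->
  (forall j z, D' j z -> rnorm (f z - c' j) <= e') ->
  opb (step E D c - step E D' c') (e + e').
Proof.
move=> e0 e'0 pD pD' h h'; apply: (compression_opb isoV (B := step F D c - step F D' c')).
  by apply: compressionB => //; exact: step_compression.
by apply (step_diff spF e0 e'0 pD pD' h h').
Qed.

(** The dilation chosen by [xget] may differ from the given one. Both integrals are close to finite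
    sums of values of the same [E], and [estep_diff] compares such sums for any two partitions. *)
Lemma semispectral_intE f (B : K -> K) (A : H -> H) :
  is_spectral_int F f B -> compression V B A -> semispectral_int E f = A.
Proof.
move=> hB cA; rewrite /semispectral_int; case: xgetP => [A' _|/(_ A)]; last first.
  by case; exists K, V, F, B.
move=> [K' [V' [F' [B' [dil' hB' cA']]]]].
have [isoV' spF' _] := dil'.
apply: opb0_eq => e e0; have d0 : 0 < e / 4 by rewrite divr_gt0.
have d1 := ltW d0.
have [lB /(_ _ d0)[n [c [D [bD tD cD hc hS]]]]] := hB.
have [lB' /(_ _ d0)[n' [c' [D' [bD' tD' cD' hc' hS']]]]] := hB'.
have pD : borel_partition D by [].
have pD' : borel_partition D' by [].
have h1 : opb (A - step E D c) (e / 4).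
  apply: (compression_opb isoV (B := B - step F D c)).
    by apply: compressionB => //; exact: step_compression.
  apply/opnormP => //; apply: linear_subf; first by case: lB.
  exact: step_linear.
have h2 : opb (A' - step E D' c') (e / 4).
  apply: (compression_opb isoV' (B := B' - step F' D' c')).
    by apply: compressionB => //; exact: step_compression.
  apply/opnormP => //; apply: linear_subf; first by case: lB'.
  exact: step_linear.
have h3 := estep_diff d1 d1 pD pD' hc hc'.
have := opb_dist h2 (opb_dist (opb_sym h3) (opb_sym h1)).
by apply: opb_le; lra.
Qed.

(** The integrals of the same simple functions converge both on [K] and on [H], and compression
    survives the limit. Hence the choice made in [semispectral_int] succeeds, and every simple
    function close to [f] approximates its value. *)
Lemma semispectral_int_approx f : finely_approx f ->
  let A := semispectral_int E f in
  linear A /\ forall (I : finType) (D : I -> set (circle R)) c e, 0 <= e ->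
    borel_partition D -> (forall i z, D i z -> rnorm (f z - c i) <= e) ->
    opb (A - step E D c) e.
Proof.
move=> ff.
pose a (m : nat) : R := m.+1%:R^-1.
have a0 m : 0 < a m by rewrite invr_gt0.
have a1 m : 0 <= a m by exact: ltW.
have /choice[s hs] m : exists s : {n : nat & (('I_n -> set (circle R)) * ('I_n -> R[i]))%type},
    borel_partition (projT2 s).1 /\
    forall i z, (projT2 s).1 i z -> rnorm (f z - (projT2 s).2 i) <= a m.
  by have [n [D [c h]]] := ff _ (a0 m); exists (existT _ n (D, c)).
pose D m := (projT2 (s m)).1; pose c m := (projT2 (s m)).2.
have pD m : borel_partition (D m) by case: (hs m).
have hD m i z : D m i z -> rnorm (f z - c m i) <= a m by case: (hs m) => _; exact.
have as0 e : 0 < e -> exists N, forall n, (N <= n)%N -> a n <= e.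
  exact: invn_small.
have [B lB hB] : exists2 B : K -> K, linear B &
    forall m, opb (B - step F (D m) (c m)) (a m).
  apply: op_limit => // [|m|m m'].
  - exact: complete_scomplete.
  - exact: step_linear.
  - exact: step_diff (hD m) (hD m').
have [A lA hA] : exists2 A : H -> H, linear A &
    forall m, opb (A - step E (D m) (c m)) (a m).
  apply: op_limit => // [|m|m m'].
  - exact: complete_scomplete.
  - exact: estep_linear.
  - exact: estep_diff (hD m) (hD m').
have cA : compression V B A.
  apply/compressionE => // x y; apply/eqP; rewrite -subr_eq0; apply/eqP.
  apply: rnorm_small => e e0.
  have c0 : 0 < rnorm x * rnorm y + 1 by rewrite ltr_wpDl ?mulr_ge0.
  have [m /(_ m (leqnn _)) ame] := as0 _ (divr_gt0 e0 (mulr_gt0 (ltr0n R 2) c0)).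
  have /compressionE cS := step_compression (c m) dil (pD m).
  rewrite (_ : _ - _ = inner H ((A - step E (D m) (c m)) x) y -
     inner K ((B - step F (D m) (c m)) (V x)) (V y)); last first.
    by rewrite !fctE !innerBl cS//; ring.
  rewrite (le_trans (rnormBD _ _))//.
  rewrite (@le_trans _ _ (2 * a m * (rnorm x * rnorm y)))//.
    rewrite -mulrA mulr_natl mulr2n; apply: lerD; apply: (le_trans (cauchy_schwarz _ _)).
      by rewrite mulrA ler_wpM2r//; exact: hA.
    by rewrite (iso_norm isoV y) mulrA ler_wpM2r// -(iso_norm isoV x); exact: hB.
  rewrite (@le_trans _ _ (2 * (e / (2 * (rnorm x * rnorm y + 1))) * (rnorm x * rnorm y)))//.
    by rewrite ler_wpM2r ?mulr_ge0// ler_wpM2l.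
  rewrite (_ : 2 * _ = e / (rnorm x * rnorm y + 1)); last by field; rewrite gt_eqF.
  by rewrite mulrAC ler_pdivrMr// ler_pM2l// lerDl.
have intB : is_spectral_int F f B.
  split.
    apply/bounded_opP; split => //.
    pose M := \sum_i rnorm (c 0 i); have M0 : 0 <= M by apply: sumr_ge0.
    exists (a 0 + M); first by rewrite addr_ge0.
    have h : opb (step F (D 0) (c 0)) M.
      apply: step_opb => // i z _; rewrite /M (bigD1 i)//= lerDl; exact: sumr_ge0.
    by apply: opb_ext (opbD (hB 0) h) => x; rewrite !fctE subrK.
  move=> e e0; have [m /(_ m (leqnn _)) ame] := as0 _ e0.
  have [bD tD cD] := pD m.
  exists (projT1 (s m)), (c m), (D m); split => //.
    by move=> i z /hD h; exact: le_trans h ame.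
  apply/opnormP; [|exact: ltW|exact: opb_le ame (hB m)].
  by apply: linear_subf => //; exact: step_linear.
rewrite /= (semispectral_intE intB cA); split => // I D' c' e e0 pD' h x.
apply/ler_addgt0Pr => d d0.
have c0 : 0 < rnorm x + 1 by rewrite ltr_wpDl.
have [m /(_ m (leqnn _)) ame] := as0 _ (divr_gt0 d0 (mulr_gt0 (ltr0n R 2) c0)).
have := opb_dist (hA m) (estep_diff (a1 m) e0 (pD m) pD' (hD m) h) x.
move=> /le_trans; apply; rewrite addrA mulrDl addrC lerD2l -mulr2n -mulr_natr.
rewrite (@le_trans _ _ ((d / (2 * (rnorm x + 1))) * 2 * rnorm x))//.
  by rewrite ler_wpM2r// ler_wpM2r.
rewrite (_ : _ * 2 = d / (rnorm x + 1)); last by field; rewrite gt_eqF.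
by rewrite mulrAC ler_pdivrMr// ler_pM2l// lerDl.
Qed.

End Semispectral.

(** * Von Neumann's inequality and fine partitions of the circle *)

Section SemispectralMeasureOf.
Variables (R : realType) (H : hilbert R) (T : H -> H) (E : set (circle R) -> H -> H).
Hypothesis mE : semispectral_measure_of T E.

Lemma semispectral_measure_dilation : exists (K : hilbert R) (V : H -> K)
    (U : K -> K) (F : set (circle R) -> K -> K),
  [/\ spectral_dilation E V F, is_spectral_int F val U &
      forall n, compression V (iter n U) (iter n T)].
Proof.
case: mE => sE [K [V [U [F [[isoV uU cU] [spF hU] cE]]]]].
by exists K, V, U, F; split.
Qed.

Lemma horner_op_compression (K : hilbert R) (V : H -> K) (U : K -> K) (p : {poly R[i]}) :
  isometric_embedding V -> (forall n, compression V (iter n U) (iter n T)) ->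
  compression V (horner_op p U) (horner_op p T).
Proof.
move=> isoV cU.
have e (L : hilbert R) (S : L -> L) :
    horner_op p S = \sum_(i < size p) p`_i *: iter i S.
  by apply/funext => x; rewrite fct_sumE.
rewrite !e; apply: compression_sum => // i _; exact: compressionZ.
Qed.

(** [p(T)] is the compression of [p(U)] for a unitary dilation [U], and [p(U)] is the spectral
    integral of [p] over the circle. *)
Lemma von_neumann (p : {poly R[i]}) (M : R) : 0 <= M ->
  (forall z : circle R, rnorm p.[val z] <= M) ->
  opb (horner_op p T) M.
Proof.
move=> M0 pM; have [K [V [U [F [dil hU cU]]]]] := semispectral_measure_dilation.
have [isoV spF _] := dil.
apply: (compression_opb isoV (horner_op_compression p isoV cU)).
by apply (spint_opb spF (spint_poly spF p hU) M0 pM).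
Qed.

Lemma semispectral_int_poly (p : {poly R[i]}) :
  semispectral_int E (fun z => p.[val z]) = horner_op p T.
Proof.
have [K [V [U [F [dil hU cU]]]]] := semispectral_measure_dilation.
have [isoV spF _] := dil.
apply: (semispectral_intE dil (spint_poly spF p hU)).
exact: horner_op_compression.
Qed.

(** The cells come from a simple function close to the identity of the circle, as supplied by the
    spectral integral of the dilation. Its values may lie off the circle, so each is replaced by a
    point of its cell, which doubles the error; an empty cell gets the arbitrary point [cis 0]. *)
Lemma semispectral_measure_fine : fine_partitions E.
Proof.
have [K [V [U [F [dil hU cU]]]]] := semispectral_measure_dilation.
have [isoV spF _] := dil.
move=> d d0; have d2 : 0 < d / 2 by rewrite divr_gt0.
have [n [D [c [pD hD _]]]] := spint_fine spF hU d2.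
exists n, D, (fun i => if pselect (exists z, D i z) is left h then projT1 (cid h) else cis 0).
split => // i z Dz; case: pselect => [h|]; last by case; exists z.
case: cid => w /= Dw; rewrite (le_trans (rnorm_dist _ (c i) _))// [leRHS](splitr d) lerD//.
  exact: hD Dz.
by rewrite rnormB; exact: hD Dw.
Qed.

End SemispectralMeasureOf.

(** * The disk algebra *)

Section DiskAlgebra.
Variable R : realType.
Implicit Types f : R[i] -> R[i].

Lemma near_rnorm (V : normedModType R[i]) (x : V) (e : R) : 0 < e ->
  \forall y \near x, rnorm (x - y) <= e.
Proof.
by move=> e0; apply: (@cvg_rnormP R V V (nbhs x) _ id x).1 e0; exact: cvg_id.
Qed.

Lemma closed_disk_compact : compact (closed_disk R).
Proof.
pose h (u : R * R) : R[i] := u.1 +i* u.2.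
have ch : continuous h.
  move=> u; apply/cvg_rnormP => e e0.
  have e2 : 0 < e / 2 by rewrite divr_gt0.
  have c1 : \forall x \near u, `|u.1 - x.1| <= e / 2.
    by apply: (cvgrPdist_le (F := nbhs u) (fst : R * R -> R) u.1).1 e2; exact: cvg_fst.
  have c2 : \forall x \near u, `|u.2 - x.2| <= e / 2.
    by apply: (cvgrPdist_le (F := nbhs u) (snd : R * R -> R) u.2).1 e2; exact: cvg_snd.
  near=> x.
  rewrite (le_trans (rnorm_ReIm _))//= [leRHS]splitr lerD//.
    by near: x.
  by near: x.
have cK : compact (h @` ([set x : R | -1 <= x <= 1] `*` [set x : R | -1 <= x <= 1])).
  apply: continuous_compact; first by apply: continuous_subspaceT.
  have cI : compact [set x : R | -1 <= x <= 1].
    rewrite (_ : mkset _ = `[-1, 1]%classic); first exact: segment_compact.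
    by apply/seteqP; split => x /=; rewrite in_itv.
  exact: compact_setX.
apply: (subclosed_compact _ cK); last first.
  move=> z /closed_diskP z1; exists (complex.Re z, complex.Im z); last by case: z {z1}.
  by split => /=; rewrite -ler_norml (le_trans _ z1)// ?Re_le_rnorm ?Im_le_rnorm.
rewrite (_ : closed_disk R = (@rnorm R R[i]) @^-1` [set x | x <= 1]); last first.
  by apply/seteqP; split => z /closed_diskP.
apply: (@closed_comp _ _ (@rnorm R R[i])); last exact: closed_le.
move=> z _.
apply: (@cvgrPdist_le _ _ _ (nbhs z) (@nbhs_filter _ z) (@rnorm R R[i]) (rnorm z)).2 => e e0.
apply: (@filterS _ (nbhs z) _ _ _ _ (near_rnorm z e0)) => x zx.
rewrite ler_norml; apply/andP; split.
  rewrite lerBrDl lerBlDr (le_trans _ (lerD (lexx _) zx))// addrC -lerBlDr rnormB.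
  by rewrite lerBlDr (le_trans _ (rnormD _ _))// subrK.
by rewrite lerBlDr (le_trans _ (lerD zx (lexx _)))// (le_trans _ (rnormD _ _))// subrK.
Unshelve. all: by end_near.
Qed.

Lemma within_disk f : {within closed_disk R, continuous f} ->
  forall x, closed_disk R x -> forall e : R, 0 < e -> exists2 r : R, 0 < r &
    forall z, closed_disk R z -> rnorm (x - z) < r -> rnorm (f x - f z) <= e.
Proof.
move=> /subspace_continuousP cf x Dx e e0.
have /cvg_rnormP/(_ _ e0) := cf x Dx.
rewrite /prop_near1 /within/= => /nbhs_ballP[r /= r0 hr].
have [s s0 rs] := gt0_real_complex r0.
exists s => // z Dz xz; apply: hr => //.
by rewrite -ball_normE/= rs rnorm_lt.
Qed.

Lemma disk_algebra_bounded f : disk_algebra f ->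
  exists2 M : R, 0 <= M & forall z, closed_disk R z -> rnorm (f z) <= M.
Proof.
move=> [_ cf].
have /compact_near_coveringP/(_ _ (pinfty_nbhs R)
  (fun M z => closed_disk R z -> rnorm (f z) <= M) _) := closed_disk_compact.
case.
  move=> x Dx; have [r r0 hr] := within_disk cf Dx ltr01.
  exists ([set z | rnorm (x - z) < r], [set M | rnorm (f x) + 1 <= M]).
    split => /=.
      have r2 : 0 < r / 2 by rewrite divr_gt0.
      apply: filterS (near_rnorm x r2) => y /le_lt_trans; apply.
      by rewrite ltr_pdivrMr// ltr_pMr// ltr1n.
    apply: nbhs_pinfty_ge; exact: num_real.
  move=> [z M] [/= zr hM] Dz; rewrite (le_trans _ hM)// -lerBlDl.
  rewrite (le_trans _ (hr z Dz zr))// rnormB lerBlDr.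
  by rewrite (le_trans _ (rnormD _ _))// subrK.
move=> M [_ hM]; exists (Num.max 0 (M + 1)) => [|z Dz]; first by rewrite le_max lexx.
by rewrite le_max; apply/orP; right; apply: hM => //; rewrite ltrDl.
Qed.

(** Heine's theorem on the compact closed disk. Arbitrary members of the disk algebra must be
    treated, because the representation behind the chosen triple integral need not consist of
    polynomials. *)
Lemma disk_algebra_unif f : disk_algebra f -> forall e : R, 0 < e ->
  exists2 d : R, 0 < d & forall z w, closed_disk R z -> closed_disk R w ->
    rnorm (z - w) <= d -> rnorm (f z - f w) <= e.
Proof.
move=> [_ cf] e e0.
pose P (d : R) z := closed_disk R z -> forall w, closed_disk R w ->
  rnorm (z - w) <= d -> rnorm (f z - f w) <= e.
have hn : \forall d \near 0^'+, closed_disk R `<=` P d.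
  apply: (compact_near_coveringP (closed_disk R)).1 => //.
    exact: closed_disk_compact.
  move=> x Dx; have [r r0 hr] := within_disk cf Dx (divr_gt0 e0 (ltr0n R 2)).
  have r2 : 0 < r / 2 by rewrite divr_gt0.
  (* Half of the local radius bounds both the distance from [x] to [z] and the distance from [z] to
     [w], so that [w] stays within [r] of [x]. *)
  exists ([set z | rnorm (x - z) < r / 2], [set d | d < r / 2]).
    split => /=.
      have r4 : 0 < r / 2 / 2 by rewrite divr_gt0.
      apply: filterS (near_rnorm x r4) => y /le_lt_trans; apply.
      by rewrite ltr_pdivrMr// ltr_pMr// ltr1n.
    exact: nbhs_right_lt.
  move=> [z d] [/= zr hd] Dz w Dw zw.
  rewrite (le_trans (rnorm_dist _ (f x) _))// [leRHS]splitr lerD//.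
    rewrite rnormB; apply: hr => //; rewrite (lt_trans zr)//.
    by rewrite ltr_pdivrMr// ltr_pMr// ltr1n.
  apply: hr => //; rewrite (le_lt_trans (rnorm_dist _ z _))// [ltRHS]splitr.
  by rewrite ltrD// (le_lt_trans zw).
near (0 : R)^'+ => d.
exists d; first by near: d; exact: nbhs_right_gt.
move=> z w Dz Dw zw.
have hd : closed_disk R `<=` P d by near: d.
exact: hd zw.
Unshelve. all: by end_near.
Qed.

Definition sup_disk f : R := fine (disk_norm f).

Lemma closed_disk0 : closed_disk R 0.
Proof. by apply/closed_diskP; rewrite rnorm0. Qed.

Lemma circle_disk (z : circle R) : closed_disk R (val z).
Proof. by apply/closed_diskP; rewrite val_circle. Qed.

Lemma disk_normE f : disk_algebra f -> disk_norm f = (sup_disk f)%:E.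
Proof.
move=> /disk_algebra_bounded[M M0 hM]; rewrite /sup_disk fineK// ge0_fin_numE.
  apply: (@le_lt_trans _ _ M%:E); last exact: ltry.
  by apply: ge_ereal_sup => _ [z Dz <-]; rewrite lee_fin hM.
apply: (@le_trans _ _ (rnorm (f 0))%:E); first by rewrite lee_fin.
by apply: ereal_sup_ubound; exists 0 => //; exact: closed_disk0.
Qed.

Lemma sup_disk_ub f z : disk_algebra f -> closed_disk R z -> rnorm (f z) <= sup_disk f.
Proof.
by move=> af Dz; rewrite -lee_fin -disk_normE//; apply: ereal_sup_ubound; exists z.
Qed.

Lemma sup_disk_ge0 f : disk_algebra f -> 0 <= sup_disk f.
Proof. by move=> af; apply: le_trans (sup_disk_ub af closed_disk0). Qed.

Lemma sup_disk_le f M : disk_algebra f -> (forall z, closed_disk R z -> rnorm (f z) <= M) ->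
  sup_disk f <= M.
Proof.
move=> af h; rewrite -lee_fin -disk_normE//.
by apply: ge_ereal_sup => _ [z Dz <-]; rewrite lee_fin h.
Qed.

Lemma horner_near (p : {poly R[i]}) (z : R[i]) (e : R) : rnorm z <= 1 -> 0 < e ->
  \forall x \near z, rnorm (p.[z] - p.[x]) <= e.
Proof.
move=> z1 e0; set L := \sum_(i < size p) rnorm p`_i * 2 ^+ i.
have L0 : 0 <= L by apply: sumr_ge0 => i _; rewrite mulr_ge0.
have L1 : 0 < L + 1 by rewrite ltr_wpDl.
have d0 : 0 < Num.min 1 (e / (L + 1)) by rewrite lt_min ltr01 divr_gt0.
apply: (@filterS _ (nbhs z) _ _ _ _ (near_rnorm z d0)) => x.
rewrite le_min => /andP[zx1 zx2].
apply: le_trans (horner_diff p (rnorm_ge0 (z - x)) z1 _ (lexx _)) _.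
  by rewrite -[x](subrK z) (le_trans (rnormD _ _))// rnormB -[2]/(1 + 1) lerD.
rewrite -/L (le_trans (ler_wpM2l L0 zx2))// mulrA ler_pdivrMr// mulrC ler_pM2l//.
by rewrite lerDl.
Qed.

Lemma disk_algebra_poly (p : {poly R[i]}) : disk_algebra (horner p).
Proof.
split=> [z|].
  rewrite -[1]/(1%:C) rnorm_lt => /ltW z1.
  (* [q] is the difference quotient of [p] at [z], a polynomial by the factor theorem; its value at
     [z] is the derivative. *)
  have [q hq] : exists q : {poly R[i]}, p - p.[z]%:P = q * ('X - z%:P).
    by apply/factor_theorem; rewrite /root !hornerE subrr.
  have {}hq x : p.[x] - p.[z] = q.[x] * (x - z).
    by have := congr1 (horner^~ x) hq; rewrite !hornerE.
  apply/cvg_ex; exists q.[z].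
  apply: (@cvg_rnormP R R[i] R[i] (0^') _ _ q.[z]).2 => e e0.
  have /nbhs_ballP[r /= r0 hr] := horner_near q z1 e0.
  exists r => //= h; rewrite /ball_/= sub0r normrN => hlt h0.
  rewrite (_ : _ *: _ = q.[h + z]).
    by apply: hr; rewrite -ball_normE/= opprD addrCA subrr addr0 normrN.
  rewrite -[LHS]/(h^-1 * (p.[h * 1 + z] - p.[z])) mulr1 hq addrK mulrC mulfK//.
apply/subspace_continuousP => z /closed_diskP z1.
apply: (@cvg_rnormP R R[i] R[i] _ _ _ p.[z]).2 => e e0.
rewrite /prop_near1 /within/=.
by apply: (@filterS _ (nbhs z) _ _ _ _ (horner_near p z1 e0)) => x.
Qed.

End DiskAlgebra.

(** * Independence of the triple integral from the representation *)

Section Slim.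
Variables (R : realType) (V : normedModType R[i]).

Lemma slimD (u v : nat -> V) l m : slim u l -> slim v m ->
  slim (fun n => u n + v n) (l + m).
Proof.
move=> hu hv e e0; have e2 : 0 < e / 2 by rewrite divr_gt0.
have [N hN] := hu _ e2; have [N' hN'] := hv _ e2.
exists (maxn N N') => n; rewrite geq_max => /andP[/hN h1 /hN' h2].
by rewrite opprD addrACA (le_trans (rnormD _ _))// [leRHS]splitr lerD.
Qed.

Lemma slim_sum (I : Type) (r : seq I) (u : I -> nat -> V) (l : I -> V) :
  (forall i, slim (u i) (l i)) ->
  slim (fun n => \sum_(i <- r) u i n) (\sum_(i <- r) l i).
Proof.
move=> h; elim: r => [|i r IH].
  by rewrite big_nil; move=> e e0; exists 0 => n _; rewrite big_nil subrr rnorm0 ltW.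
rewrite big_cons => e e0; have [N hN] := slimD (h i) IH e0.
by exists N => n Nn; rewrite big_cons hN.
Qed.

Lemma slimZl (u : nat -> R[i]) (l : R[i]) (v : V) : slim u l ->
  slim (fun n => u n *: v) (l *: v).
Proof.
move=> h e e0; have c0 : 0 < rnorm v + 1 by rewrite ltr_wpDl.
have [N hN] := h _ (divr_gt0 e0 c0); exists N => n /hN hn.
rewrite -scalerBl rnormZ (le_trans (ler_wpM2r _ hn))//.
by rewrite mulrAC ler_pdivrMr// ler_pM2l// lerDl.
Qed.

End Slim.

Section Tri.
Variables (R : realType) (H : hilbert R) (Q : H -> H) (q : R).
Hypotheses (lQ : linear Q) (q0 : 0 <= q) (hQ : opb Q q).

Definition tri (A B C : H -> H) : H -> H := fun x => A (Q (B (Q (C x)))).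

Lemma tri_linear A B C : linear A -> linear B -> linear C -> linear (tri A B C).
Proof. by move=> lA lB lC a x y; rewrite /tri lC lQ lB lQ lA. Qed.

Lemma opb_at (A : H -> H) (a t : R) y : 0 <= a -> opb A a -> rnorm y <= t ->
  rnorm (A y) <= a * t.
Proof. by move=> a0 hA yt; rewrite (le_trans (hA _))// ler_wpM2l. Qed.

Lemma tri_opb A B C (a b c : R) : 0 <= a -> 0 <= b -> 0 <= c ->
  opb A a -> opb B b -> opb C c -> opb (tri A B C) (q ^+ 2 * (a * b * c)).
Proof.
move=> a0 b0 c0 hA hB hC x; rewrite /tri.
have -> : q ^+ 2 * (a * b * c) * rnorm x = a * (q * (b * (q * (c * rnorm x)))).
  by ring.
by do ![apply: opb_at => //].
Qed.

(** The factors are changed one at a time from left to right, so primed factors stand to the left of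
    each change and unprimed ones to its right. *)
Lemma tri_diff A B C A' B' C' (a b c d : R) : 0 <= a -> 0 <= b -> 0 <= c -> 0 <= d ->
  linear A' -> linear B' ->
  opb A' a -> opb B b -> opb B' b -> opb C c ->
  opb (A - A') d -> opb (B - B') d -> opb (C - C') d ->
  opb (tri A B C - tri A' B' C') (d * (q ^+ 2 * (b * c + a * c + a * b))).
Proof.
move=> a0 b0 c0 d0 lA' lB' hA' hB hB' hC dA dB dC x; rewrite !fctE /tri.
rewrite (_ : _ - _ = (A - A') (Q (B (Q (C x)))) + (A' (Q ((B - B') (Q (C x)))) +
    A' (Q (B' (Q ((C - C') x)))))); last first.
  rewrite !fctE !(linfunB _ _ lQ, linfunB _ _ lA', linfunB _ _ lB').
  by rewrite !addrA !subrK.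
have -> : d * (q ^+ 2 * (b * c + a * c + a * b)) * rnorm x =
  d * (q * (b * (q * (c * rnorm x)))) + (a * (q * (d * (q * (c * rnorm x)))) +
   a * (q * (b * (q * (d * rnorm x))))) by ring.
rewrite (le_trans (rnormD _ _))// lerD//; first by do ![apply: opb_at => //].
by rewrite (le_trans (rnormD _ _))// lerD//; do ![apply: opb_at => //].
Qed.

End Tri.

Section TripleUnique.
Variables (R : realType) (H : hilbert R) (E : set (circle R) -> H -> H).
Variables (K : hilbert R) (V : H -> K) (F : set (circle R) -> K -> K).
Hypothesis dil : spectral_dilation E V F.
Hypothesis fineE : fine_partitions E.
Variables (Q : H -> H) (q : R).
Hypotheses (lQ : linear Q) (q0 : 0 <= q) (hQ : opb Q q).

Lemma disk_algebra_approx f : disk_algebra f -> finely_approx (f \o val : circle R -> R[i]).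
Proof.
move=> af e e0; have [d d0 hd] := disk_algebra_unif af e0.
have [n [D [w [pD hD]]]] := fineE d0; exists n, D, (fun i => f (val (w i))).
split => // i z Dz; apply: hd; [exact: circle_disk|exact: circle_disk|exact: hD].
Qed.

Let I f := semispectral_int E (f \o val : circle R -> R[i]).

Lemma semispectral_int_linear f : disk_algebra f -> linear (I f).
Proof. by move=> /disk_algebra_approx/(semispectral_int_approx dil)[]. Qed.

Let smp (f : R[i] -> R[i]) n (w : 'I_n -> circle R) i := f (val (w i)).

Lemma semispectral_int_step f : disk_algebra f -> forall e : R, 0 < e -> exists2 d : R, 0 < d &
  forall n (D : 'I_n -> set (circle R)) w, borel_partition D ->
    (forall i z, D i z -> rnorm (val z - val (w i)) <= d) ->
    opb (I f - step E D (smp f w)) e.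
Proof.
move=> af e e0; have [d d0 hd] := disk_algebra_unif af e0; exists d => // n D w pD hD.
have [_ h] := semispectral_int_approx dil (disk_algebra_approx af).
apply: h => //; first exact: ltW.
by move=> i z Dz; apply: hd; [exact: circle_disk|exact: circle_disk|exact: hD].
Qed.

Lemma step_sup_disk f n (D : 'I_n -> set (circle R)) w : disk_algebra f -> borel_partition D ->
  opb (step E D (smp f w)) (sup_disk f).
Proof.
move=> af pD; apply: (estep_opb dil) => // [i z _|]; last exact: sup_disk_ge0.
by apply: sup_disk_ub => //; exact: circle_disk.
Qed.

Lemma semispectral_int_sup_disk f : disk_algebra f -> opb (I f) (sup_disk f).
Proof.
move=> af x; apply/ler_addgt0Pr => e e0; have c0 : 0 < rnorm x + 1 by rewrite ltr_wpDl.
have [d d0 hd] := semispectral_int_step af (divr_gt0 e0 c0).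
have [n [D [w [pD hD]]]] := fineE d0.
have := opbD (hd n D w pD hD) (step_sup_disk w af pD) x.
rewrite !fctE subrK => /le_trans; apply; rewrite mulrDl addrC lerD2l.
by rewrite mulrAC ler_pdivrMr// ler_pM2l// lerDl.
Qed.

(* The step-function version of the triple integral only involves the values of Phi;
   every representation of Phi is approximated by it, hence defines the same integral. *)
Definition tri_sample (Phi : circle R -> circle R -> circle R -> R[i]) n
    (D : 'I_n -> set (circle R)) (w : 'I_n -> circle R) : H -> H :=
  fun x => \sum_i \sum_j \sum_k
    Phi (w i) (w j) (w k) *: tri Q (E (D i)) (E (D j)) (E (D k)) x.

Lemma tri_step n (D : 'I_n -> set (circle R)) (w : 'I_n -> circle R) f g h x :
  borel_partition D ->
  tri Q (step E D (smp f w)) (step E D (smp g w)) (step E D (smp h w)) x =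
  tri_sample (fun a b c => f (val a) * g (val b) * h (val c)) D w x.
Proof.
(* [E (D i)] is the sum over the partition with indicator coefficients, so its linearity is a case
   of [estep_linear]. *)
move=> pD; have lE i : linear (E (D i)).
  have := estep_linear dil (fun j => (j == i)%:R) pD.
  rewrite (_ : step _ _ _ = E (D i))//; apply/funext => y.
  rewrite /step fct_sumE (bigD1 i)//= big1 ?addr0 ?fctE ?eqxx ?scale1r//.
  by move=> j /negbTE ji; rewrite fctE ji scale0r.
rewrite /tri /tri_sample /step fct_sumE.
apply: eq_bigr => i _; rewrite fctE.
rewrite fct_sumE (linfun_sum _ _ _ lQ) (linfun_sum _ _ _ (lE i)) scaler_sumr.
apply: eq_bigr => j _.
rewrite fctE fct_sumE (linfun_sum _ _ _ lQ) (linfun_sum _ _ _ (lE j)) scaler_sumr.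
rewrite (linfun_sum _ _ _ lQ) (linfun_sum _ _ _ (lE i)) scaler_sumr.
apply: eq_bigr => k _; rewrite fctE /smp.
rewrite !(linfunZ _ _ lQ, linfunZ _ _ (lE i), linfunZ _ _ (lE j)) !scalerA.
by rewrite mulrA.
Qed.

Lemma tri_sample_sum (P : nat -> circle R -> circle R -> circle R -> R[i]) M n
    (D : 'I_n -> set (circle R)) w x :
  \sum_(0 <= k < M) tri_sample (P k) D w x =
  tri_sample (fun a b c => \sum_(0 <= k < M) P k a b c) D w x.
Proof.
rewrite /tri_sample exchange_big; apply: eq_bigr => i _.
rewrite exchange_big; apply: eq_bigr => j _.
rewrite exchange_big; apply: eq_bigr => k _.
by rewrite scaler_suml.
Qed.

Let term (f g h : nat -> R[i] -> R[i]) n := tri Q (I (f n)) (I (g n)) (I (h n)).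

Let term_step (f g h : nat -> R[i] -> R[i]) m (D : 'I_m -> set (circle R))
    (w : 'I_m -> circle R) n :=
  tri Q (step E D (smp (f n) w)) (step E D (smp (g n) w)) (step E D (smp (h n) w)).

Lemma term_step_close f g h n :
  [/\ disk_algebra (f n), disk_algebra (g n) & disk_algebra (h n)] ->
  forall e : R, 0 < e -> exists2 d : R, 0 < d &
  forall m (D : 'I_m -> set (circle R)) w, borel_partition D ->
    (forall i z, D i z -> rnorm (val z - val (w i)) <= d) ->
    opb (term f g h n - term_step f g h D w n) e.
Proof.
move=> [af ag ah] e e0.
set a := sup_disk (f n); set b := sup_disk (g n); set c := sup_disk (h n).
have a0 : 0 <= a by exact: sup_disk_ge0.
have b0 : 0 <= b by exact: sup_disk_ge0.
have c0 : 0 <= c by exact: sup_disk_ge0.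
set M := q ^+ 2 * (b * c + a * c + a * b).
have M0 : 0 <= M by rewrite mulr_ge0 ?exprn_ge0// !addr_ge0// mulr_ge0.
have M1 : 0 < M + 1 by rewrite ltr_wpDl.
have t0 := divr_gt0 e0 M1.
have [d1 d10 h1] := semispectral_int_step af t0.
have [d2 d20 h2] := semispectral_int_step ag t0.
have [d3 d30 h3] := semispectral_int_step ah t0.
exists (Num.min d1 (Num.min d2 d3)); first by rewrite !lt_min d10 d20 d30.
move=> m D w pD hD.
have hD1 i z : D i z -> rnorm (val z - val (w i)) <= d1.
  by move/hD; rewrite !le_min => /and3P[].
have hD2 i z : D i z -> rnorm (val z - val (w i)) <= d2.
  by move/hD; rewrite !le_min => /and3P[].
have hD3 i z : D i z -> rnorm (val z - val (w i)) <= d3.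
  by move/hD; rewrite !le_min => /and3P[].
apply: opb_le (tri_diff lQ q0 hQ a0 b0 c0 (ltW t0) (estep_linear dil _ pD)
  (estep_linear dil _ pD) (step_sup_disk w af pD) (semispectral_int_sup_disk ag)
  (step_sup_disk w ag pD) (semispectral_int_sup_disk ah) (h1 m D w pD hD1)
  (h2 m D w pD hD2) (h3 m D w pD hD3)).
by rewrite -/M mulrAC ler_pdivrMr// ler_pM2l// lerDl.
Qed.

Lemma terms_step_close f g h N :
  (forall n, [/\ disk_algebra (f n), disk_algebra (g n) & disk_algebra (h n)]) ->
  forall e : R, 0 < e -> exists2 d : R, 0 < d &
  forall m (D : 'I_m -> set (circle R)) w, borel_partition D ->
    (forall i z, D i z -> rnorm (val z - val (w i)) <= d) ->
    opb (\sum_(0 <= n < N) term f g h n - \sum_(0 <= n < N) term_step f g h D w n) e.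
Proof.
move=> ad; elim: N => [|N IH] e e0.
  exists 1 => // m D w _ _ x; rewrite !big_geq// !fctE subrr rnorm0 mulr_ge0//.
  exact: ltW.
have e2 : 0 < e / 2 by rewrite divr_gt0.
have [d1 d10 h1] := IH _ e2; have [d2 d20 h2] := term_step_close (ad N) e2.
exists (Num.min d1 d2); first by rewrite lt_min d10 d20.
move=> m D w pD hD.
have hD1 i z : D i z -> rnorm (val z - val (w i)) <= d1.
  by move/hD; rewrite !le_min => /andP[].
have hD2 i z : D i z -> rnorm (val z - val (w i)) <= d2.
  by move/hD; rewrite !le_min => /andP[].
rewrite [e]splitr; apply: opb_ext (opbD (h1 m D w pD hD1) (h2 m D w pD hD2)) => x.
by rewrite !big_nat_recr//= !fctE opprD addrACA.
Qed.

Lemma nneseries_summ (b : nat -> R) : (forall n, 0 <= b n) ->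
  (\sum_(0 <= n <oo) (b n)%:E < +oo)%E -> summ b.
Proof.
move=> b0 h; split => //; exists (fine (\sum_(0 <= n <oo) (b n)%:E)) => n.
have s0 : (0 <= \sum_(0 <= n <oo) (b n)%:E)%E by apply: nneseries_ge0 => k _; rewrite lee_fin.
rewrite -lee_fin fineK ?ge0_fin_numE// -sumEFin.
by apply: nneseries_lim_ge => k _; rewrite lee_fin.
Qed.

Lemma tensor_rep_summ Phi f g h : tensor_rep Phi f g h ->
  @summ R (fun n => sup_disk (f n) * sup_disk (g n) * sup_disk (h n)).
Proof.
move=> [ad sfin _]; apply: nneseries_summ => [n|].
  by have [? ? ?] := ad n; rewrite !mulr_ge0// sup_disk_ge0.
apply: le_lt_trans sfin; rewrite le_eqVlt; apply/orP; left; apply/eqP.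
by apply: eq_eseriesr => n _; have [? ? ?] := ad n; rewrite !disk_normE.
Qed.

(** Three errors of [e / 3]: cutting the operator series at [N], replacing the remaining integrals
    by sums over cells, and restoring the tail of the sampled series. The last one is uniform in the
    partition because each sampled factor is bounded by [sup_disk]; this allows [N] to be fixed
    before [d]. *)
Lemma triple_sample_close Phi J : is_triple_int Phi E Q E Q E J ->
  forall e : R, 0 < e -> exists2 d : R, 0 < d &
  forall m (D : 'I_m -> set (circle R)) w, borel_partition D ->
    (forall i z, D i z -> rnorm (val z - val (w i)) <= d) ->
    opb (J - tri_sample Phi D w) e.
Proof.
move=> [[lJ _] [f [g [h [rep cJ]]]]] e e0.
have sb := tensor_rep_summ rep; have [ad _ cPhi] := rep.
have cI n : [/\ linear (I (f n)), linear (I (g n)) & linear (I (h n))].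
  by have [? ? ?] := ad n; split; exact: semispectral_int_linear.
have e3 : 0 < e / 3 by rewrite divr_gt0.
pose b n := sup_disk (f n) * sup_disk (g n) * sup_disk (h n).
have sq := summZ (exprn_ge0 2 q0) sb; rewrite -/(b _) in sq.
have [N1 hN1] := summ_tail sq e3.
have [N2 hN2] : exists N, forall n, (N <= n)%N -> opb (J - \sum_(0 <= k < n) term f g h k) (e / 3).
  have lJN : forall N, linear (J - \sum_(n < N) term f g h n).
    move=> N; apply: linear_subf => //; apply: linear_sum_fct => i _.
    by have [? ? ?] := cI i; exact: tri_linear.
  have [N _ hN] := (cvg_opnormP (F := \oo) lJN).1 cJ _ e3.
  by exists N => n /hN; rewrite big_mkord.
pose N := maxn N1 N2.
have [d d0 hd] := terms_step_close N ad e3; exists d => // m D w pD hD.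
have h1 := hN2 N (leq_maxr _ _); have h2 := hd m D w pD hD.
have h3 : opb (\sum_(0 <= n < N) term_step f g h D w n - tri_sample Phi D w) (e / 3).
  apply: opb_sym => x; rewrite !fctE fct_sumE.
  have sl : slim (fun M => \sum_(0 <= n < M) term_step f g h D w n x) (tri_sample Phi D w x).
    have slPhi a a' a'' : slim (fun M => \sum_(0 <= n < M)
        (f n (val a) * g n (val a') * h n (val a''))) (Phi a a' a'').
      by apply/slimP; exact: cPhi.
    have : slim (fun M => tri_sample (fun a a' a'' => \sum_(0 <= n < M)
        (f n (val a) * g n (val a') * h n (val a''))) D w x) (tri_sample Phi D w x).
      do 3![apply: slim_sum => ?]; apply: slimZl; exact: slPhi.
    move=> H' e' e'0; have [N' hN'] := H' e' e'0; exists N' => n /hN'.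
    rewrite -tri_sample_sum; under eq_bigr do rewrite -tri_step//.
    by [].
  apply/ler_addgt0Pr => t t0; have [N3 hN3] := sl t t0.
  rewrite (le_trans (rnorm_dist _ (\sum_(0 <= n < maxn N N3) term_step f g h D w n x) _))//.
  rewrite addrC lerD//; last by apply: hN3; exact: leq_maxr.
  rewrite (big_cat_nat (n := N))//= ?leq_maxl// addrAC subrr add0r.
  rewrite (le_trans (rnorm_sum _ _ _))//.
  apply: le_trans (_ : \sum_(N <= n < maxn N N3) (q ^+ 2 * b n) * rnorm x <= _).
    apply: ler_sum => n _; have [af ag ah] := ad n.
    apply: (tri_opb q0 hQ (sup_disk_ge0 af) (sup_disk_ge0 ag) (sup_disk_ge0 ah)).
    - exact: step_sup_disk.
    - exact: step_sup_disk.
    - exact: step_sup_disk.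
  rewrite -mulr_suml ler_wpM2r//; apply: hN1; exact: leq_maxl.
apply: opb_le (opb_dist h1 (opb_dist h2 h3)); lra.
Qed.

Lemma triple_int_unique Phi J J' : is_triple_int Phi E Q E Q E J ->
  is_triple_int Phi E Q E Q E J' -> J = J'.
Proof.
move=> hJ hJ'; apply: opb0_eq => e e0; have e2 : 0 < e / 2 by rewrite divr_gt0.
have [d d0 hd] := triple_sample_close hJ e2; have [d' d0' hd'] := triple_sample_close hJ' e2.
have m0 : 0 < Num.min d d' by rewrite lt_min d0 d0'.
have [n [D [w [pD hD]]]] := fineE m0.
rewrite [e]splitr; apply: opb_dist (hd n D w pD _) (opb_sym (hd' n D w pD _)).
  by move=> i z /hD; rewrite le_min => /andP[].
by move=> i z /hD; rewrite le_min => /andP[].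
Qed.

End TripleUnique.

(** * Polynomials on the circle *)

Section RootsOfUnity.
Variable R : realType.
Local Notation C := R[i].

Lemma prim_root_exists n : (0 < n)%N -> exists z : C, n.-primitive_root z.
Proof.
move=> n_gt0; pose p : {poly C} := 'X^n - 1.
have [r Dp] := closed_field_poly_normal p.
rewrite (monicP _) ?monicXnsubC // scale1r in Dp.
have rn1 : all n.-unity_root r by apply/allP=> z; rewrite -root_prod_XsubC -Dp.
have sz_r : (n < (size r).+1)%N.
  by rewrite -(size_prod_XsubC r id) -Dp size_XnsubC.
have [|z] := hasP (has_prim_root n_gt0 rn1 _ sz_r); last by exists z.
by rewrite -separable_prod_XsubC -Dp separable_Xn_sub_1 // pnatr_eq0 -lt0n.
Qed.

Lemma prim_root_norm n (z : C) : (0 < n)%N -> n.-primitive_root z -> rnorm z = 1.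
Proof.
move=> n0 /prim_expr_order zn; apply/eqP.
by rewrite -(pexpr_eq1 n0 (rnorm_ge0 z)) -rnormX zn rnorm1.
Qed.

(** Orthogonality of the characters of a cyclic group: for distinct exponents below [n], the ratio
    [y] is an [n]-th root of unity other than 1, whose geometric sum vanishes. *)
Lemma prim_root_sum n (z : C) a b : n.-primitive_root z -> (a < n)%N -> (b < n)%N ->
  \sum_(m < n) (z ^+ m) ^+ a * ((z ^+ m)^-1) ^+ b = if a == b then n%:R else 0.
Proof.
move=> pz an bn; have n0 : (0 < n)%N := prim_order_gt0 pz.
have z0 := rnorm1_neq0 (prim_root_norm n0 pz).
have e (m : nat) : (z ^+ m) ^+ a * ((z ^+ m)^-1) ^+ b = (z ^+ a / z ^+ b) ^+ m.
  by rewrite exprMn !exprVn -!exprM ![(m * _)%N]mulnC.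
under eq_bigr do rewrite e.
case: eqVneq => [->|ab].
  by rewrite divff ?expf_neq0//; under eq_bigr do rewrite expr1n; rewrite sumr_const card_ord.
set y := _ / _; have yn : y ^+ n = 1.
  by rewrite exprMn exprVn -!exprM ![(_ * n)%N]mulnC !exprM (prim_expr_order pz) !expr1n divr1.
have y1 : y != 1.
  apply: contra ab => /eqP/divr1_eq/eqP; rewrite (eq_prim_root_expr pz).
  by rewrite !modn_small.
apply/eqP; have := subrX1 y n; rewrite yn subrr => /esym/eqP.
by rewrite mulf_eq0 subr_eq0 (negbTE y1).
Qed.

Variables (p : {poly C}) (M : R).
Hypothesis pM : forall z : C, rnorm z = 1 -> rnorm p.[z] <= M.

Lemma circle_bound_ge0 : 0 <= M.
Proof. exact: le_trans (rnorm_ge0 _) (pM (rnorm1 R)). Qed.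

(** Discrete Cauchy formula: the coefficient is the mean of p(z) z^(-k) over the [n]-th roots of
    unity, exact as soon as [n] exceeds [k] and the degree of [p]. *)
Lemma coef_bound k : rnorm p`_k <= M.
Proof.
pose n := (maxn (size p) k.+1); have n0 : (0 < n)%N by rewrite leq_max orbT.
have [z pz] := prim_root_exists n0; have z1 := prim_root_norm n0 pz.
have kn : (k < n)%N by rewrite leq_max leqnn orbT.
have e : \sum_(m < n) p.[z ^+ m] * ((z ^+ m)^-1) ^+ k = p`_k * n%:R.
  under eq_bigr do rewrite (horner_coef_wide _ (leq_maxl _ k.+1)) mulr_suml.
  rewrite exchange_big/=.
  under eq_bigr do under eq_bigr do rewrite -mulrA.
  under eq_bigr do rewrite -mulr_sumr prim_root_sum ?ltn_ord//.
  rewrite (bigD1 (Ordinal kn))//= eqxx big1 ?addr0// => i ik.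
  by rewrite ifN ?mulr0//; apply: contra ik => /eqP ik; apply/eqP/val_inj.
have n1 : 0 < n%:R :> R by rewrite ltr0n.
rewrite -(ler_pM2r n1) -{1}(rnorm_nat R n) -rnormM -e.
rewrite (le_trans (rnorm_sum _ _ _))//.
rewrite (@le_trans _ _ (\sum_(m < n) M))//; last by rewrite sumr_const card_ord mulr_natr.
apply: ler_sum => m _; rewrite rnormM rnormX rnormV rnormX z1 expr1n invr1 expr1n mulr1.
by apply: pM; rewrite rnormX z1 expr1n.
Qed.

End RootsOfUnity.

(** * Maximum principle for polynomials *)

Section MaxPrinciple.
Variable R : realType.

(** An exponential rate is insensitive to a linear factor. If [x] exceeded [M], the square of
    Bernoulli's inequality would make (x / M)^(2k) at least quadratic in [k], against a linear upper
    bound. *)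
Lemma pow_growth (x M d : R) : 0 <= x -> 0 <= M -> 0 <= d ->
  (forall k : nat, x ^+ k <= (d * k%:R + 1) * M ^+ k) -> x <= M.
Proof.
move=> x0 M0 d0 h; rewrite leNgt; apply/negP => Mx.
have [Mz|Mn] := eqVneq M 0.
  by have := h 1%N; rewrite Mz expr0n/= mulr0 expr1 leNgt -Mz Mx.
have {Mn}M1 : 0 < M by rewrite lt0r Mn.
pose t := x / M - 1; have t0 : 0 < t by rewrite subr_gt0 ltr_pdivlMr// mul1r.
have ht k : (1 + t) ^+ k <= d * k%:R + 1.
  rewrite /t addrCA subrr addr0 exprMn exprVn ler_pdivrMr ?exprn_gt0//.
have bern k : 1 + k%:R * t <= (1 + t) ^+ k.
  elim: k => [|k IH]; first by rewrite mul0r addr0 expr0.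
  rewrite exprS (le_trans _ (ler_wpM2l _ IH))//; last by rewrite addr_ge0// ltW.
  rewrite -natr1; have : 0 <= k%:R * t ^+ 2 by rewrite mulr_ge0// sqr_ge0.
  by rewrite expr2; lra.
have hk k : (k%:R * t) ^+ 2 <= d * (2 * k%:R) + 1.
  have h1 := ht (2 * k)%N; have := bern k.
  move: h1; rewrite mulnC exprM natrM => h1 h2.
  have p1 : 0 <= k%:R * t by rewrite mulr_ge0// ltW.
  have p2 : 0 <= (1 + t) ^+ k by rewrite exprn_ge0// addr_ge0// ltW.
  apply: (le_trans (y := ((1 + t) ^+ k) ^+ 2)); last by rewrite [2 * _]mulrC.
  by rewrite ler_pXn2r ?nnegrE//; lra.
have D0 : 0 < 2 * d + 1 + 1 by lra.
(* With [K = N.+1] this gives [K * t ^+ 2 >= 2 * d + 2], so that [(K * t) ^+ 2] exceeds the upper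
   bound [2 * d * K + 1]. *)
have [N /(_ N (leqnn _)) hN] := invn_small (divr_gt0 (exprn_gt0 2 t0) D0).
have := hk N.+1; set K : R := N.+1%:R.
have K0 : 0 < K by rewrite ltr0n.
have K1 : 1 <= K by rewrite ler1n.
move: hN; rewrite -/K ler_pdivlMr// mulrC ler_pdivrMr// => hN.
rewrite exprMn => hh.
have : K * (2 * d + 1 + 1) <= d * (2 * K) + 1.
  by apply: le_trans hh; rewrite [K ^+ 2]expr2 -mulrA ler_pM2l//; lra.
by lra.
Qed.

(* Tensor power trick: apply the coefficient bound to the powers of p. *)
Lemma max_principle (p : {poly R[i]}) (M : R) :
  (forall z : R[i], rnorm z = 1 -> rnorm p.[z] <= M) ->
  forall z : R[i], rnorm z <= 1 -> rnorm p.[z] <= M.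
Proof.
move=> pM z z1; have M0 := circle_bound_ge0 pM.
apply: (@pow_growth _ _ (size p).-1%:R) => // k.
rewrite -rnormX -horner_exp horner_coef (le_trans (rnorm_sum _ _ _))//.
apply: (@le_trans _ _ (\sum_(i < size (p ^+ k)) M ^+ k)).
  apply: ler_sum => i _; rewrite rnormM rnormX.
  have : rnorm (p ^+ k)`_i <= M ^+ k.
    apply: coef_bound => w w1; rewrite horner_exp rnormX.
    by apply: lerXn2r; rewrite ?nnegrE//; exact: pM.
  move=> h; rewrite -[leRHS]mulr1 ler_pM ?exprn_ge0//.
  by rewrite exprn_ile1.
rewrite sumr_const card_ord -[leLHS]mulr_natl ler_wpM2r ?exprn_ge0//.
rewrite -natrM natr1 ler_nat; exact: size_poly_exp_leq.
Qed.

End MaxPrinciple.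

(** * Fejer multipliers and smooth truncation *)

Section Hat.
Variable R : realType.
Local Notation C := R[i].

(* hat_count w n c / w is the value at n of the hat of half-width w centered at c,
   since it counts the representations n - c = s - t with 0 <= s, t < w. *)
Definition hat_count (w n c : nat) : nat :=
  (\sum_(s < w) \sum_(t < w) (n + t == c + s :> nat))%N.

Lemma conj_inv_circle (z : C) : rnorm z = 1 -> Num.conj z = z^-1.
Proof.
move=> z1; have z0 := rnorm1_neq0 z1.
by apply: (mulfI z0); rewrite mul_conj z1 expr1n divff.
Qed.

Variables (p : {poly C}) (M : R).
Hypothesis pM : forall z : C, rnorm z = 1 -> rnorm p.[z] <= M.

(* The multiplier is a translated Fejer kernel: it is nonnegative, with mean 1 over
   the roots of unity. *)
Lemma hat_multiplier_bound (w c : nat) (x : C) : (0 < w)%N -> rnorm x = 1 ->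
  rnorm (\sum_(n < size p) (hat_count w n c)%:R * (p`_n * x ^+ n)) <= w%:R * M.
Proof.
move=> w0 x1.
pose N := (maxn (size p) c + w)%N; have N0 : (0 < N)%N by rewrite addn_gt0 w0 orbT.
have [z pz] := prim_root_exists R N0; have z1 := prim_root_norm N0 pz.
have zm1 (m : nat) : rnorm (z ^+ m) = 1 by rewrite rnormX z1 expr1n.
have wN : (w <= N)%N by rewrite leq_addl.
pose D (y : C) := \sum_(s < w) y ^+ s.
have N1 : 0 < N%:R :> R by rewrite ltr0n.
have e : N%:R * (\sum_(n < size p) (hat_count w n c)%:R * (p`_n * x ^+ n)) =
    \sum_(m < N) p.[x / z ^+ m] * (z ^+ m) ^+ c * (D (z ^+ m) * D ((z ^+ m)^-1)).
  have e1 (m : 'I_N) : p.[x / z ^+ m] * (z ^+ m) ^+ c * (D (z ^+ m) * D ((z ^+ m)^-1)) =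
      \sum_(n < size p) \sum_(s < w) \sum_(t < w)
       (p`_n * x ^+ n) * ((z ^+ m) ^+ (c + s) * ((z ^+ m)^-1) ^+ (n + t)).
    rewrite horner_coef -!mulrA mulr_suml; apply: eq_bigr => n _.
    rewrite [D (z ^+ m) * _]mulr_suml !mulr_sumr; apply: eq_bigr => s _.
    rewrite !mulr_sumr; apply: eq_bigr => t _.
    by rewrite exprMn !exprD; ring.
  under [RHS]eq_bigr do rewrite e1.
  rewrite exchange_big/= mulr_sumr; apply: eq_bigr => n _.
  rewrite exchange_big/= natr_sum mulr_suml mulr_sumr; apply: eq_bigr => s _.
  rewrite exchange_big/= natr_sum mulr_suml mulr_sumr; apply: eq_bigr => t _.
  rewrite -mulr_sumr (prim_root_sum pz); last 2 first.
  - by rewrite -addnS leq_add ?ltn_ord// leq_maxr.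
  - by rewrite -addnS leq_add ?ltn_ord// ltnW// (leq_trans (ltn_ord n))// leq_maxl.
  by rewrite eq_sym; case: eqVneq => _; rewrite ?mul1r ?mul0r ?mulr0// mulrC.
have DD : \sum_(m < N) rnorm (D (z ^+ m)) * rnorm (D ((z ^+ m)^-1)) = N%:R * w%:R :> R.
  have cD (m : nat) : D ((z ^+ m)^-1) = Num.conj (D (z ^+ m)).
    rewrite /D rmorph_sum; apply: eq_bigr => s _.
    by rewrite rmorphXn /= conj_inv_circle.
  apply: complexI; rewrite rmorph_sum/=.
  transitivity (\sum_(m < N) D (z ^+ m) * D ((z ^+ m)^-1)).
    apply: eq_bigr => m _; rewrite cD mul_conj; congr (_%:C).
    by rewrite -[Num.conj _]/((D (z ^+ m))^*) rnorm_conj expr2.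
  have e1 (m : 'I_N) : D (z ^+ m) * D ((z ^+ m)^-1) =
      \sum_(s < w) \sum_(t < w) (z ^+ m) ^+ s * ((z ^+ m)^-1) ^+ t.
    by rewrite mulr_suml; apply: eq_bigr => s _; rewrite mulr_sumr.
  under eq_bigr do rewrite e1.
  rewrite exchange_big/=.
  transitivity (\sum_(s < w) (N%:R : C)); last first.
    rewrite (rmorphM (real_complex R)) !(rmorph_nat (real_complex R)).
    by rewrite sumr_const card_ord mulr_natr.
  apply: eq_bigr => s _; rewrite exchange_big/= (bigD1 s)//= [X in _ + X]big1 ?addr0.
    by rewrite (prim_root_sum pz) ?eqxx// (leq_trans (ltn_ord s)).
  move=> t ts; rewrite (prim_root_sum pz) ?(leq_trans (ltn_ord _))//.
  by rewrite ifN//; apply: contra ts => /eqP st; apply/eqP/val_inj.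
rewrite -(ler_pM2l N1) -{1}(rnorm_nat R N) -rnormM e (le_trans (rnorm_sum _ _ _))//.
rewrite mulrA -DD mulr_suml; apply: ler_sum => m _.
rewrite !rnormM mulrC ler_wpM2l ?mulr_ge0//.
rewrite (rnormX _ c) zm1 expr1n mulr1; apply: pM.
by rewrite rnormM rnormV zm1 x1 invr1 mulr1.
Qed.

End Hat.

Section HatPartition.
Variables (R : realType).

(* The hats centered at w, 2w, ..., 16w, evaluated at l + 1: their sum increases from 1/w
   to 1 on 0 <= l < w and is 1 up to l + 1 = 16w. *)
Definition hat_sum (w l : nat) : nat := (\sum_(1 <= r < 17) hat_count w l.+1 (r * w))%N.

(** After exchanging the sums, [r] and [s] are the quotient and the remainder of [l.+1 + t] by [w];
    each [t] counts once, exactly when the quotient lies between 1 and 16. *)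
Lemma hat_sumE w l : (0 < w)%N ->
  hat_sum w l = (\sum_(t < w) (w <= l.+1 + t < 17 * w)%N)%N.
Proof.
move=> w0; rewrite /hat_sum /hat_count.
under eq_bigr do rewrite exchange_big.
rewrite exchange_big/=; apply: eq_bigr => t _; set a := (l.+1 + t)%N.
have e r : (\sum_(s < w) (a == r * w + s))%N = (r == (a %/ w)%N).
  have am : (a %% w < w)%N by rewrite ltn_mod.
  rewrite (bigD1 (Ordinal am))//= big1 ?addn0 => [|s sa].
    congr nat_of_bool; apply/eqP/eqP => /= [h|->]; last exact: divn_eq.
    by apply/esym; rewrite {1}h divnMDl// divn_small ?addn0.
  apply/eqP; rewrite eqb0; apply: contra sa => /eqP as'; apply/eqP/val_inj => /=.
  by rewrite as' modnMDl modn_small.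
under eq_bigr do rewrite e.
have [h|h] := boolP (w <= a < 17 * w)%N.
  have h1 : (1 <= a %/ w < 17)%N.
    by case/andP: h => h1 h2; rewrite divn_gt0// h1 ltn_divLR.
  rewrite (bigD1_seq (a %/ w)%N)//= ?mem_index_iota// ?iota_uniq// eqxx big1 ?addn0//.
  by move=> r /negbTE ->.
rewrite big1_seq// => r; rewrite mem_index_iota => /andP[_ rr]; apply/eqP; rewrite eqb0.
apply: contra h => /eqP rw; move: rr; rewrite rw divn_gt0// ltn_divLR//.
Qed.

Lemma hat_sum_le w l : (0 < w)%N -> (hat_sum w l <= w)%N.
Proof.
move=> w0; rewrite hat_sumE// -[leqRHS]card_ord -sum1_card.
by apply: leq_sum => t _; case: (_ && _).
Qed.

Lemma hat_sum_eq w l : (0 < w)%N -> (w <= l.+1 <= 16 * w)%N -> hat_sum w l = w.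
Proof.
move=> w0 /andP[h1 h2]; rewrite hat_sumE//.
rewrite -[RHS]card_ord -sum1_card; apply: eq_bigr => t _.
by have := ltn_ord t; lia.
Qed.

Definition hat_part (w l : nat) : R[i] := (hat_sum w l)%:R / w%:R.

Variables (p : {poly R[i]}) (M : R) (w : nat).
Hypothesis pM : forall z : R[i], rnorm z = 1 -> rnorm p.[z] <= M.
Hypothesis w0 : (0 < w)%N.

(** In a term of D^2, [m] is the sum of the exponents of the two other variables; the shift by 2
    comes from the second divided difference. *)
Definition hat_poly (m : nat) : {poly R[i]} :=
  \poly_(l < size p) (hat_part w l * p`_(m + l.+2)).

Lemma hat_poly_coef m l : (hat_poly m)`_l = hat_part w l * p`_(m + l.+2).
Proof.
rewrite coef_poly; case: ltnP => // h; rewrite nth_default ?mulr0//.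
by rewrite (leq_trans h)// -addSnnS -addSnnS leq_addl.
Qed.

(** Up to the factor [w * z ^+ m.+2], of modulus [w] on the circle, this is the sum of 16 hat
    multipliers of [p], centered at [m.+1 + r * w] and each bounded by [w * M]. The maximum
    principle extends the bound to the disk. *)
Lemma hat_poly_bound m z : rnorm z <= 1 -> rnorm (hat_poly m).[z] <= 16 * M.
Proof.
apply: max_principle => {}z z1.
have wn : (w%:R : R) != 0 by rewrite pnatr_eq0 -lt0n.
have wp : 0 < (w%:R : R) by rewrite ltr0n.
have e : w%:R * z ^+ m.+2 * (hat_poly m).[z] = \sum_(1 <= r < 17)
    \sum_(n < size p) (hat_count w n (m.+1 + r * w))%:R * (p`_n * z ^+ n).
  rewrite exchange_big/=.
  pose G n := (\sum_(1 <= r < 17) hat_count w n (m.+1 + r * w))%N.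
  (* The lowest hat, centered at [m.+1 + w] with half-width [w], vanishes up to index [m.+1]; the
     multiplied polynomial is thus divisible by z^(m+2). *)
  have G0 n : (n < m.+2)%N -> G n = 0%N.
    move=> nm; apply: big1_seq => r; rewrite mem_index_iota => /andP[_ /andP[r1 _]].
    apply: big1 => s _; apply: big1 => t _; apply/eqP; rewrite eqb0; apply/eqP => h.
    have := ltn_ord t; have : (w <= r * w)%N by rewrite leq_pmull.
    by lia.
  have GS l : G (m + l.+2)%N = hat_sum w l.
    apply: eq_bigr => r _; apply: eq_bigr => s _; apply: eq_bigr => t _.
    by congr nat_of_bool; apply/eqP/eqP; lia.
  transitivity (\sum_(0 <= n < size p + m.+2) (G n)%:R * (p`_n * z ^+ n)); last first.
    rewrite (big_cat_nat (n := size p))//= ?leq_addr// [X in _ + X]big1_seq ?addr0.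
      by rewrite big_mkord; apply: eq_bigr => n _; rewrite natr_sum mulr_suml.
    move=> n; rewrite mem_index_iota => /andP[_ /andP[pn _]].
    by rewrite nth_default// mul0r mulr0.
  rewrite (big_cat_nat (n := m.+2))//= ?leq_addl// big1_seq ?add0r; last first.
    by move=> n; rewrite mem_index_iota => /andP[_ /andP[_ nm]]; rewrite G0// mul0r.
  rewrite -{2}[m.+2]add0n big_addn addnK big_mkord horner_poly mulr_sumr.
  apply: eq_bigr => l _; rewrite [(l + _)%N]addnC.
  have -> : (m.+2 + l = m + l.+2)%N by lia.
  rewrite GS /hat_part exprD -[l.+2]addn2 -[m.+2]addn2 !exprD.
  have wC : (w%:R : R[i]) != 0 by rewrite pnatr_eq0 -lt0n.
  by field.
rewrite -(ler_pM2l wp) -{1}(rnorm_nat R w).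
have -> : rnorm (w%:R : R[i]) * rnorm (hat_poly m).[z] =
    rnorm (w%:R * z ^+ m.+2 * (hat_poly m).[z]).
  by rewrite [in RHS]rnormM (rnormM w%:R) rnormX z1 expr1n mulr1.
rewrite e (le_trans (rnorm_sum _ _ _))// mulrCA.
rewrite (@le_trans _ _ (\sum_(1 <= r < 17) (w%:R * M)))//.
  by apply: ler_sum => r _; exact: hat_multiplier_bound.
by rewrite sumr_const_nat [leRHS]mulr_natl.
Qed.

Lemma hat_part_bound l : rnorm (1 - hat_part w l) <= 1.
Proof.
have wp : 0 < (w%:R : R) by rewrite ltr0n.
rewrite /hat_part -(rmorph_nat (real_complex R)) -(rmorph_nat (real_complex R) w).
rewrite -fmorphV -rmorphM -[1]/(1%:C) -rmorphB /= rnorm_real ger0_norm.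
  by rewrite gerBl divr_ge0.
by rewrite subr_ge0 ler_pdivrMr// mul1r ler_nat hat_sum_le.
Qed.

End HatPartition.

(** * Tensor representation of one block *)

Section BlockTensor.
Variable R : realType.
Local Notation C := R[i].

Definition ctriple : Type := ({poly C} * {poly C} * {poly C})%type.
Definition tnorm (x : ctriple) : R :=
  sup_disk (horner x.1.1) * sup_disk (horner x.1.2) * sup_disk (horner x.2).

Lemma sup_disk_poly_ge0 (p : {poly C}) : 0 <= sup_disk (horner p).
Proof. by apply: sup_disk_ge0; exact: disk_algebra_poly. Qed.

Lemma tnorm_ge0 x : 0 <= tnorm x.
Proof. by rewrite !mulr_ge0// sup_disk_poly_ge0. Qed.

Lemma sup_disk_poly_le (p : {poly C}) M :
  (forall z, rnorm z <= 1 -> rnorm p.[z] <= M) -> sup_disk (horner p) <= M.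
Proof.
move=> h; apply: sup_disk_le; first exact: disk_algebra_poly.
by move=> z /closed_diskP; exact: h.
Qed.

Lemma sup_disk_X n : sup_disk (horner ('X^n : {poly C})) <= 1.
Proof.
by apply: sup_disk_poly_le => z z1; rewrite hornerXn rnormX exprn_ile1.
Qed.

Lemma tnorm_le x a b c : sup_disk (horner x.1.1) <= a -> sup_disk (horner x.1.2) <= b ->
  sup_disk (horner x.2) <= c -> tnorm x <= a * b * c.
Proof. by move=> ha hb hc; rewrite !ler_pM ?mulr_ge0 ?sup_disk_poly_ge0. Qed.

Lemma sum_delta_coef (V : nmodType) (N a b : nat) (G : nat -> nat -> V) :
  (forall i j, (N <= i)%N || (N <= j)%N -> G i j = 0) ->
  \sum_(i <- iota 0 N) \sum_(j <- iota 0 N) (if (a == i) && (b == j) then G i j else 0) = G a b.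
Proof.
move=> h; have [aN|Na] := ltnP a N; last first.
  rewrite (h a b) ?Na//; rewrite big1_seq// => i; rewrite mem_iota add0n leq0n /= => iN.
  rewrite big1// => j _; case: eqP => // ai; by move: Na; rewrite ai leqNgt iN.
have [bN|Nb] := ltnP b N; last first.
  rewrite (h a b) ?Nb ?orbT//; rewrite big1// => i _.
  rewrite big1_seq// => j; rewrite mem_iota add0n leq0n /= => jN.
  by case: eqP => //= _; case: eqP => // bj; move: Nb; rewrite bj leqNgt jN.
rewrite (bigD1_seq a) ?iota_uniq ?mem_iota//= (bigD1_seq b) ?iota_uniq ?mem_iota//= !eqxx.
rewrite !big1 ?addr0// => [i|j] /negbTE ni; last by rewrite eq_sym ni andbF.
by rewrite big1// => j _; rewrite eq_sym ni.
Qed.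

(* With u = hat_part, split 1 = u_l + (1 - u_l) u_j + (1 - u_l) (1 - u_j) u_i: the remainder
   (1 - u_i) (1 - u_j) (1 - u_l) lives on indices i + j + l + 2 <= 2 ^ n.-1, where p has no
   coefficients. In each part, the polynomial in the variable carrying the factor u is
   a smooth truncation of p, so that its norm is at most 16 M. *)
Lemma block_tensor (n : nat) (p : {poly C}) (M : R) :
  (size p <= 2 ^ n.+1)%N -> (forall k, (0 < n)%N -> (k <= 2 ^ n.-1)%N -> p`_k = 0) ->
  (forall z : C, rnorm z = 1 -> rnorm p.[z] <= M) ->
  exists L : seq ctriple, [/\ L != [::],
    forall i j l, \sum_(x <- L) x.1.1`_i * x.1.2`_j * x.2`_l = p`_(i + j + l.+2),
    forall x, x \in L -> [/\ (size x.1.1 <= 2 ^ n.+1)%N, (size x.1.2 <= 2 ^ n.+1)%N &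
      (size x.2 <= 2 ^ n.+1)%N] &
    \sum_(x <- L) tnorm x <= 192 * 4 ^+ n * M].
Proof.
(* With this width the 16 hats cover all indices below [N], and three indices with successors below
   [w] give a coefficient of index below 4 w = 2^(n-1), where [p] vanishes. For n <= 3 the
   subtraction makes [w] equal to 1, and there are no such indices. *)
move=> sp low pM; pose N := (2 ^ n.+1)%N; pose w := (2 ^ (n - 3))%N.
have M0 := circle_bound_ge0 pM.
have w0 : (0 < w)%N by rewrite expn_gt0.
have N0 : (0 < N)%N by rewrite expn_gt0.
have Nw : (N <= 16 * w)%N.
  rewrite /N /w; case: n {sp low N w w0 N0} => [|[|[|n]]]//.
  by rewrite subSS subSS subSS subn0 -[16%N]/(2 ^ 4)%N -expnD leq_exp2l//; lia.
pose u l : C := hat_part R w l.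
pose h m := hat_poly p w m.
have hc m l : (h m)`_l = u l * p`_(m + l.+2) by exact: hat_poly_coef.
have hb m z : rnorm z <= 1 -> rnorm (h m).[z] <= 16 * M by exact: hat_poly_bound.
have ub l : rnorm (1 - u l) <= 1 by exact: hat_part_bound.
pose L1 := [seq (('X^i, 'X^j, h (i + j)%N) : ctriple) | i <- iota 0 N, j <- iota 0 N].
pose L2 := [seq (('X^i, (1 - u l) *: h (i + l)%N, 'X^l) : ctriple) | i <- iota 0 N, l <- iota 0 N].
pose L3 := [seq ((((1 - u l) * (1 - u j)) *: h (j + l)%N, 'X^j, 'X^l) : ctriple) |
  j <- iota 0 N, l <- iota 0 N].
have pz k : (N <= k)%N -> p`_k = 0 by move=> Nk; rewrite nth_default// (leq_trans sp).
have res i j l : (1 - u i) * (1 - u j) * (1 - u l) * p`_(i + j + l.+2) = 0.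
  have [pk|/pz ->] := ltnP (i + j + l.+2) N; last by rewrite mulr0.
  have u1 m : (w <= m.+1)%N -> (m < N)%N -> 1 - u m = 0.
    move=> wm mN; rewrite /u /hat_part hat_sum_eq//; last by rewrite wm (leq_trans mN).
    by rewrite divff ?subrr// pnatr_eq0 -lt0n.
  have [wi|iw] := leqP w i.+1; first by rewrite u1 ?mul0r//; lia.
  have [wj|jw] := leqP w j.+1; first by rewrite (u1 j) ?mulr0 ?mul0r//; lia.
  have [wl|lw] := leqP w l.+1; first by rewrite (u1 l) ?mulr0 ?mul0r//; lia.
  have n0 : (0 < n)%N by move: iw; rewrite /w; case: (n).
  have wn : (w * 4 <= 2 ^ n.-1)%N.
    move: iw; rewrite /w; case: (n) => [|[|[|m]]]// _.
    by rewrite subSS subSS subSS subn0 -[4%N]/(2 ^ 2)%N -expnD leq_exp2l//; lia.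
  by rewrite low ?mulr0//; lia.
have sumL f : \sum_(x <- L1 ++ L2 ++ L3) f x =
    \sum_(x <- L1) f x + (\sum_(x <- L2) f x + \sum_(x <- L3) f x) :> R.
  by rewrite !big_cat.
exists (L1 ++ L2 ++ L3); split.
- apply/eqP => /(congr1 size); rewrite !size_cat size_allpairs size_iota/=.
  by move/eqP; rewrite addn_eq0 muln_eq0 !eqn0Ngt N0.
- move=> i j l; rewrite !big_cat/= !big_allpairs_dep/=.
  rewrite (eq_bigr (fun i' => \sum_(j' <- iota 0 N) (if (i == i') && (j == j')
    then u l * p`_(i' + j' + l.+2) else 0))); last first.
    move=> i' _; apply: eq_bigr => j' _; rewrite !coefXn hc.
    by case: eqP => _; case: eqP => _ /=; rewrite ?mul1r ?mul0r ?mulr0 ?mulr1// mul0r.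
  rewrite sum_delta_coef; last by move=> i' j' ij; rewrite pz ?mulr0//; lia.
  rewrite (eq_bigr (fun i' => \sum_(l' <- iota 0 N) (if (i == i') && (l == l')
    then (1 - u l') * (u j * p`_(i' + l' + j.+2)) else 0))); last first.
    move=> i' _; apply: eq_bigr => j' _; rewrite !coefXn coefZ hc.
    by case: eqP => _; case: eqP => _ /=; rewrite ?mul1r ?mul0r ?mulr0 ?mulr1// mul0r.
  rewrite sum_delta_coef; last by move=> i' j' ij; rewrite pz ?mulr0//; lia.
  rewrite (eq_bigr (fun j' => \sum_(l' <- iota 0 N) (if (j == j') && (l == l')
    then (1 - u l') * (1 - u j') * (u i * p`_(j' + l' + i.+2)) else 0))); last first.
    move=> i' _; apply: eq_bigr => j' _; rewrite !coefXn coefZ hc.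
    by case: eqP => _; case: eqP => _ /=; rewrite ?mul1r ?mul0r ?mulr0 ?mulr1// mul0r.
  rewrite sum_delta_coef; last by move=> i' j' ij; rewrite pz ?mulr0//; lia.
  have -> : (i + l + j.+2 = i + j + l.+2)%N by lia.
  have -> : (j + l + i.+2 = i + j + l.+2)%N by lia.
  apply/esym/eqP; rewrite -subr_eq0; apply/eqP; rewrite -[RHS](res i j l); ring.
- have Xs i : i \in iota 0 N -> (size ('X^i : {poly C}) <= N)%N.
    by rewrite mem_iota size_polyXn.
  have hsz m : (size (h m) <= N)%N by rewrite (leq_trans (size_poly _ _)).
  have hsz1 (c : C) m : (size (c *: h m) <= N)%N by rewrite (leq_trans (size_scale_leq _ _)).
  by move=> x; rewrite !mem_cat => /or3P[] /allpairsP[[i j] [/= /Xs hi /Xs hj ->]]; split => /=.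
have NN (f : nat -> nat -> ctriple) (a : R) : (forall i j, tnorm (f i j) <= a) ->
    \sum_(x <- [seq f i j | i <- iota 0 N, j <- iota 0 N]) tnorm x <= 4 * 4 ^+ n * a.
  move=> fa; rewrite big_allpairs_dep/=.
  rewrite (@le_trans _ _ (\sum_(i <- iota 0 N) \sum_(j <- iota 0 N) a))//.
    by apply: ler_sum => i _; apply: ler_sum => j _.
  rewrite !big_const_seq !count_predT !size_iota !iter_addr !addr0 -mulrnA -[leLHS]mulr_natl.
  by rewrite /N -expnMn -[(2 * 2)%N]/4%N natrX exprS.
have X1 := sup_disk_X.
have hs m : sup_disk (horner (h m)) <= 16 * M by apply: sup_disk_poly_le; exact: hb.
have hs1 m (c : C) : rnorm c <= 1 -> sup_disk (horner (c *: h m)) <= 16 * M.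
  move=> c1; apply: sup_disk_poly_le => z /hb hz; rewrite hornerZ rnormM.
  by rewrite -[leRHS]mul1r ler_pM.
(* Each of the three families has [N ^ 2 = 4 * 4 ^ n] triples, of norm at most [16 * M]. *)
rewrite sumL; have -> : 192 * 4 ^+ n * M = 4 * 4 ^+ n * (16 * M) +
  (4 * 4 ^+ n * (16 * M) + 4 * 4 ^+ n * (16 * M)) by ring.
apply: lerD; [|apply: lerD]; apply: NN => i j.
- apply: (@le_trans _ _ (1 * 1 * (16 * M))); last by rewrite !mul1r.
  by apply: tnorm_le; [exact: X1|exact: X1|exact: hs].
- apply: (@le_trans _ _ (1 * (16 * M) * 1)); last by rewrite mul1r mulr1.
  by apply: tnorm_le; [exact: X1|apply: hs1; exact: ub|exact: X1].
- apply: (@le_trans _ _ (16 * M * 1 * 1)); last by rewrite !mulr1.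
  apply: tnorm_le; [apply: hs1|exact: X1|exact: X1].
  by rewrite rnormM mulr_ile1// ub.
Qed.

End BlockTensor.

(** * Littlewood-Paley blocks of a Besov function *)

Section CircleIntegral.
Variable R : realType.
Implicit Types (g : R -> R[i]) (c : R[i]).

Let intZ (u : R -> R) (r : R) : (haar R).-integrable setT (EFin \o u) ->
  (haar R).-integrable setT (EFin \o (fun x => r * u x)).
Proof.
by move=> h; apply: eq_integrable (integrableZl measurableT r h) => // x _; rewrite /= EFinM.
Qed.

Let intD (u v : R -> R) : (haar R).-integrable setT (EFin \o u) ->
  (haar R).-integrable setT (EFin \o v) ->
  (haar R).-integrable setT (EFin \o (fun x => u x + v x)).
Proof.
by move=> h k; apply: eq_integrable (integrableD measurableT h k) => // x _; rewrite /= EFinD.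
Qed.

Let intB (u v : R -> R) : (haar R).-integrable setT (EFin \o u) ->
  (haar R).-integrable setT (EFin \o v) ->
  (haar R).-integrable setT (EFin \o (fun x => u x - v x)).
Proof.
by move=> h k; apply: eq_integrable (integrableB measurableT h k) => // x _; rewrite /= EFinB.
Qed.

Lemma ReM (a b : R[i]) :
  complex.Re (a * b) = complex.Re a * complex.Re b - complex.Im a * complex.Im b.
Proof. by case: a b => [? ?] [? ?]. Qed.

Lemma ImM (a b : R[i]) :
  complex.Im (a * b) = complex.Re a * complex.Im b + complex.Im a * complex.Re b.
Proof. by case: a b => [? ?] [? ?]. Qed.

Lemma circle_integrableZ c g : circle_integrable g -> circle_integrable (fun x => c * g x).
Proof.
move=> [h k]; split; rewrite /comp.
  under eq_fun do rewrite ReM; exact: (intB (intZ _ h) (intZ _ k)).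
under eq_fun do rewrite ImM; exact: (intD (intZ _ k) (intZ _ h)).
Qed.

Lemma circle_intZ c g : circle_integrable g ->
  circle_int (fun x => c * g x) = c * circle_int g.
Proof.
move=> [h k]; rewrite /circle_int; apply/eqP; rewrite eq_complex ReM ImM /=.
apply/andP; split; apply/eqP.
  under eq_Rintegral do rewrite ReM.
  by rewrite RintegralB//; [rewrite !RintegralZl|exact: intZ|exact: intZ].
under eq_Rintegral do rewrite ImM.
by rewrite RintegralD//; [rewrite !RintegralZl|exact: intZ|exact: intZ].
Qed.

Lemma circle_integrableD g g' : circle_integrable g -> circle_integrable g' ->
  circle_integrable (fun x => g x + g' x).
Proof.
move=> [h k] [h' k']; split.
  by under eq_fun do rewrite raddfD/=; exact: intD.
by under eq_fun do rewrite raddfD/=; exact: intD.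
Qed.

Lemma circle_intD g g' : circle_integrable g -> circle_integrable g' ->
  circle_int (fun x => g x + g' x) = circle_int g + circle_int g'.
Proof.
move=> [h k] [h' k']; rewrite /circle_int; apply/eqP; rewrite eq_complex /=.
apply/andP; split; apply/eqP.
  by under eq_Rintegral do rewrite raddfD/=; rewrite RintegralD.
by under eq_Rintegral do rewrite raddfD/=; rewrite RintegralD.
Qed.

Lemma circle_integrable0 : circle_integrable (fun _ : R => 0).
Proof. by split; exact: integrable0. Qed.

Lemma circle_int0 : circle_int (fun _ : R => 0) = 0.
Proof. by rewrite /circle_int /Rintegral /= integral0. Qed.

Lemma circle_int_sum (I : Type) (r : seq I) (G : I -> R -> R[i]) :
  (forall i, circle_integrable (G i)) ->
  circle_integrable (fun x => \sum_(i <- r) G i x) /\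
  circle_int (fun x => \sum_(i <- r) G i x) = \sum_(i <- r) circle_int (G i).
Proof.
move=> h; elim: r => [|i r [IH1 IH2]].
  rewrite big_nil; under eq_fun do rewrite big_nil.
  by split; [exact: circle_integrable0|exact: circle_int0].
under eq_fun do rewrite big_cons; split; first exact: circle_integrableD.
by rewrite big_cons circle_intD// IH2.
Qed.

Lemma integrable_bounded (u v : R -> R) : (haar R).-integrable setT (EFin \o u) ->
  continuous v -> (forall x, `|v x| <= 1) ->
  (haar R).-integrable setT (EFin \o (fun x => u x * v x)).
Proof.
move=> h cv bv.
have mv : measurable_fun setT v by exact: measurable_realfun.continuous_measurable_fun.
have b : [bounded v x | x in setT].
  exists 1; split; first exact: num_real.
  by move=> M M1 x _ /=; rewrite (le_trans (bv x))// ltW.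
by apply: eq_integrable (integrableMl measurableT h mv b) => // x _; rewrite /= EFinM.
Qed.

Lemma circle_integrableM (g e : R -> R[i]) : circle_integrable g ->
  continuous (fun x => complex.Re (e x)) -> continuous (fun x => complex.Im (e x)) ->
  (forall x, rnorm (e x) <= 1) ->
  circle_integrable (fun x => g x * e x).
Proof.
move=> [h k] ce1 ce2 be.
have b1 x : `|complex.Re (e x)| <= 1 by rewrite (le_trans (Re_le_rnorm _)).
have b2 x : `|complex.Im (e x)| <= 1 by rewrite (le_trans (Im_le_rnorm _)).
split.
  under eq_fun do rewrite ReM.
  by apply: intB; exact: integrable_bounded.
under eq_fun do rewrite ImM.
by apply: intD; exact: integrable_bounded.
Qed.

Lemma circle_integrable_pow g k : circle_integrable g ->
  circle_integrable (fun x => g x * (val (cis x))^-1 ^+ k).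
Proof.
elim: k g => [|k IH] g hg; first by under eq_fun do rewrite expr0 mulr1.
under eq_fun do rewrite exprS mulrA.
apply: (IH (fun x => g x * (val (cis x))^-1)).
have e x : (val (cis x))^-1 = (cos x -i* sin x).
  by rewrite -conj_inv_circle ?val_circle.
apply: circle_integrableM => //.
- by under eq_fun do rewrite e/=; exact: continuous_cos.
- by under eq_fun do rewrite e/=; move=> x; apply: continuousN; exact: continuous_sin.
- by move=> x; rewrite rnormV val_circle invr1.
Qed.

End CircleIntegral.

(** * Littlewood-Paley blocks as polynomials *)

Section Blocks.
Variables (R : realType) (phi : circle R -> R[i]).
Local Notation a k := (fourier phi k%:Z).

(** This is the convolution of [phi] with [W n] when the Fourier coefficient of index -1 vanishes:
    the conjugate term of [W 0] then leaves no trace in block 0. *)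
Definition block (n : nat) : {poly R[i]} :=
  if n is 0 then (a 0%N)%:P + (a 1%N) *: 'X
  else \poly_(k < 2 ^ n.+1) ((hat (k%:R / 2 ^+ n))%:C * a k).

Lemma block_size n : (size (block n) <= 2 ^ n.+1)%N.
Proof.
case: n => [|n]; last exact: size_poly.
rewrite (leq_trans (size_polyD _ _))// geq_max (leq_trans (size_polyC_leq1 _))//=.
by rewrite (leq_trans (size_scale_leq _ _))// size_polyX.
Qed.

Lemma hat_le_half (x : R) : x <= 2^-1 -> hat x = 0.
Proof.
move=> h; rewrite /hat ifT; last by lra.
by rewrite max_l//; lra.
Qed.

Lemma block_low n k : (0 < n)%N -> (k <= 2 ^ n.-1)%N -> (block n)`_k = 0.
Proof.
case: n => [//|n] _ /= k2; rewrite coef_poly ifT; last first.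
  by rewrite (leq_ltn_trans k2)// ltn_exp2l//; lia.
rewrite hat_le_half ?mul0r// ler_pdivrMr ?exprn_gt0// exprS mulrA mulVf ?mul1r ?pnatr_eq0//.
by rewrite -natrX ler_nat.
Qed.

(** The hats form a partition of unity: for 2^m <= k < 2^(m+1) with m >= 1, only blocks m and m+1
    contribute, with weights 2 - y and y - 1 where y = k / 2^m. Indices 0 and 1 belong to block
    0. *)
Lemma block_coef_sum k K : (k < K)%N -> \sum_(0 <= n < K) (block n)`_k = a k.
Proof.
move=> kK; have [k1|k2] := leqP k 1.
  case: K kK => // K kK; rewrite big_nat_recl//= big1_seq ?addr0.
    rewrite coefD coefC coefZ coefX.
    by case: k k1 kK => [|[|k]]//= _ _; rewrite ?mulr0 ?mulr1 ?addr0 ?add0r.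
  by move=> n _; rewrite -/(block n.+1) block_low//= (leq_trans k1)// expn_gt0.
pose m := trunc_log 2 k.
have /andP[mk km] : (2 ^ m <= k < 2 ^ m.+1)%N by apply: trunc_log_bounds => //; lia.
have m0 : (0 < m)%N by rewrite trunc_log_gt0.
have mm : (m < 2 ^ m)%N by rewrite ltn_expl.
have mK : (m.+1 < K)%N by lia.
have z n : n != m -> n != m.+1 -> (block n)`_k = 0.
  move=> nm nm1; have [nlt|mn] := ltnP n m.
    rewrite nth_default// (leq_trans (block_size n))// (leq_trans _ mk)//.
    by rewrite leq_exp2l.
  rewrite block_low//; first by lia.
  by rewrite (leq_trans (ltnW km))// leq_exp2l//; lia.
rewrite (big_cat_nat (n := m))//=; last by lia.
rewrite big1_seq ?add0r; last first.
  by move=> n; rewrite mem_index_iota => /andP[_ nm]; apply: z; lia.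
rewrite big_ltn; last by lia.
rewrite big_ltn// [X in _ + (_ + X)]big1_seq ?addr0; last first.
  by move=> n; rewrite mem_index_iota => /andP[_ nm]; apply: z; lia.
move: mk km m0 {z mm mK}; case: m => // m mk km _.
rewrite !coef_poly km ifT; last by rewrite (leq_trans km)// leq_exp2l.
have t0 : 0 < 2 ^+ m :> R by rewrite exprn_gt0.
have h1 : hat (k%:R / 2 ^+ m.+1) = 2 - k%:R / 2 ^+ m.+1 :> R.
  have x1 : 1 <= k%:R / 2 ^+ m.+1 :> R.
    by rewrite ler_pdivlMr ?exprn_gt0// mul1r -natrX ler_nat.
  have x2 : k%:R / 2 ^+ m.+1 <= 2 :> R.
    by rewrite ler_pdivrMr ?exprn_gt0// -exprS -natrX ler_nat ltnW.
  by rewrite /hat; case: ifP => h; rewrite max_r//; lra.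
have h2 : hat (k%:R / 2 ^+ m.+2) = k%:R / 2 ^+ m.+1 - 1 :> R.
  have -> : k%:R / 2 ^+ m.+2 = (k%:R / 2 ^+ m.+1) / 2 :> R.
    by rewrite exprSr invfM mulrA mulrAC.
  have x1 : 1 <= k%:R / 2 ^+ m.+1 :> R.
    by rewrite ler_pdivlMr ?exprn_gt0// mul1r -natrX ler_nat.
  have x2 : k%:R / 2 ^+ m.+1 <= 2 :> R.
    by rewrite ler_pdivrMr ?exprn_gt0// -exprS -natrX ler_nat ltnW.
  by rewrite /hat ifT ?max_r//; lra.
rewrite h1 h2; set y := _ / _; rewrite -mulrDl -rmorphD/=.
have -> : 2 - y + (y - 1) = 1 by ring.
by rewrite mul1r.
Qed.

Hypothesis intphi : circle_integrable (fun x => phi (cis x)).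
Hypothesis neg1 : fourier phi (- 1) = 0.

Lemma fourierE k : a k = circle_int (fun x => phi (cis x) * (val (cis x))^-1 ^+ k).
Proof. by rewrite /fourier; under eq_fun do rewrite -exprnN -exprVn. Qed.

Lemma conv_block (n : nat) (z : R[i]) : Defs.conv phi (@W R n) z = (block n).[z].
Proof.
have term (c : R[i]) k : circle_integrable (fun x => c * (phi (cis x) * (val (cis x))^-1 ^+ k)) /\
    circle_int (fun x => c * (phi (cis x) * (val (cis x))^-1 ^+ k)) = c * a k.
  have h := circle_integrable_pow k intphi.
  by rewrite circle_intZ// fourierE; split => //; exact: circle_integrableZ.
have cj x : Num.conj (val (cis x)) = (val (cis x))^-1 :> R[i].
  by apply: conj_inv_circle; rewrite val_circle.
case: n => [|n]; rewrite /Defs.conv /W.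
  have [i0 e0] := term 1 0; have [i1 e1] := term z 1%N.
  have im : circle_integrable (fun x => phi (cis x) * val (cis x)).
    apply: circle_integrableM => //.
    - exact: continuous_cos.
    - exact: continuous_sin.
    - by move=> x; rewrite val_circle.
  have em : circle_int (fun x => phi (cis x) * val (cis x)) = 0.
    by rewrite -[RHS]neg1 /fourier; congr circle_int; apply/funext => x; rewrite opprK expr1z.
  transitivity (circle_int (fun x => Num.conj z * (phi (cis x) * val (cis x)) +
    (1 * (phi (cis x) * (val (cis x))^-1 ^+ 0) + z * (phi (cis x) * (val (cis x))^-1 ^+ 1)))).
    congr circle_int; apply/funext => x; rewrite !cj; have := cj x.
    set v := val (cis x) => cv; rewrite rmorphM /= -{1}cv conjCK expr0 expr1; ring.
  rewrite circle_intD; [|exact: circle_integrableZ|exact: circle_integrableD].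
  rewrite circle_intD// (circle_intZ _ im) em mulr0 add0r e0 e1 /block !hornerE.
  by rewrite [z * _]mulrC.
have := @circle_int_sum R _ (index_iota 0 (2 ^ n.+2)) (fun k x =>
   ((hat (k%:R / 2 ^+ n.+1))%:C * z ^+ k) * (phi (cis x) * (val (cis x))^-1 ^+ k))
   (fun k => (term _ k).1).
move=> [_ e]; rewrite horner_poly.
rewrite -(big_mkord xpredT (fun k => (hat (k%:R / 2 ^+ n.+1))%:C * a k * z ^+ k)).
rewrite [RHS](_ : _ = \sum_(0 <= k < 2 ^ n.+2) circle_int (fun x =>
  ((hat (k%:R / 2 ^+ n.+1))%:C * z ^+ k) * (phi (cis x) * (val (cis x))^-1 ^+ k))).
  rewrite -e; congr circle_int; apply/funext => x; rewrite mulr_sumr; apply: eq_bigr => k _.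
  by rewrite cj exprMn; ring.
by apply: eq_bigr => k _; rewrite (term _ k).2; ring.
Qed.

End Blocks.

(** * Sup norms of the blocks and the Besov condition *)

Section Sup.
Variable R : realType.

Lemma haar_itv (c d : R) : 0 <= c -> c < d -> d <= 2 * pi ->
  (haar R `[c, d]%classic = ((2 * pi)^-1 * (d - c))%:E)%E.
Proof.
move=> c0 cd d2; rewrite /haar /= /uniform_prob.
rewrite (eq_integral (fun=> (2 * pi)^-1%:E)); last first.
  move=> x; rewrite inE/= in_itv/= => /andP[cx xd].
  rewrite /uniform_pdf ifT ?subr0//.
  by rewrite (le_trans c0 cx) (le_trans xd d2).
by rewrite integral_cst//= lebesgue_measure_itv/= lte_fin cd -EFinD -EFinM.
Qed.

Lemma circle_surj (z : R[i]) : rnorm z = 1 -> exists2 y, 0 <= y <= 2 * pi & z = val (cis y).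
Proof.
case: z => a b z1.
have ab : a ^+ 2 + b ^+ 2 = 1.
  have := congr1 (fun t => t ^+ 2) z1; rewrite /rnorm normc_def/= expr1n sqr_sqrtr//.
  by rewrite addr_ge0// sqr_ge0.
have a1 : -1 <= a <= 1.
  by rewrite -ler_norml -(expr_le1 (n := 2))// real_normK ?num_real// -ab lerDl sqr_ge0.
have an1 : -1 <= - a <= 1 by rewrite lerNl opprK lerNl andbC.
have sq : Num.sqrt (1 - a ^+ 2) = `|b| by rewrite -ab addrAC subrr add0r sqrtr_sqr.
have [b0|b0] := leP 0 b.
  exists (acos a).
    by rewrite acos_ge0//= (le_trans (acos_lepi a1))// ler_peMl ?pi_ge0// ler1n.
  have ca : cos (acos a) = a by apply: acosK; rewrite in_itv.
  by rewrite -[val _]/(cos (acos a) +i* sin (acos a)) ca sin_acos// sq ger0_norm.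
exists (acos (- a) + pi).
  by rewrite addr_ge0 ?acos_ge0 ?pi_ge0//= mulr_natl mulr2n lerD2r acos_lepi.
have ca : cos (acos (- a)) = - a by apply: acosK; rewrite in_itv.
rewrite -[val _]/(cos (acos (- a) + pi) +i* sin (acos (- a) + pi)).
by rewrite cosDpi sinDpi ca sin_acos// sqrrN sq ltr0_norm// !opprK.
Qed.

(** If [g y] exceeded the essential supremum, [g] would exceed an intermediate [r] on an interval
    around [y] contained in a null set, although its Haar measure is positive. *)
Lemma ess_sup_continuous (g : R -> R) y : 0 <= y <= 2 * pi ->
  (forall e : R, 0 < e -> \forall x \near y, `|g y - g x| <= e) ->
  ((g y)%:E <= ess_sup (haar R) (abse \o (fun x => (g x)%:E)))%E.
Proof.
move=> /andP[y0 y2] cg; rewrite leNgt; apply/negP => h.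
set L := ess_sup _ _ in h.
have [r Lr rg] : exists2 r : R, (L <= r%:E)%E & r < g y.
  move: h; case: L => [r| |]//; last by exists (g y - 1); rewrite ?leNye// gtrBl.
  by rewrite lte_fin => h; exists r.
have [A [mA A0 NA]] := ess_sup_ge (haar R) (abse \o (fun x => (g x)%:E)).
have e0 : 0 < (g y - r) / 2 by rewrite divr_gt0// subr_gt0.
have /nbhs_ballP[d /= d0 hd] := cg _ e0.
have Ad x : `|y - x| < d -> A x.
  move=> yx; apply: NA => /= hx.
  have := hd x yx; rewrite ler_norml => /andP[_ h1].
  have : ((g x)%:E <= r%:E)%E.
    by apply: le_trans Lr; apply: le_trans hx; rewrite lee_fin ler_norm.
  by rewrite lee_fin; move: rg h1; lra.
have pi0 := pi_gt0 R.
pose s := Num.min (d / 2) (pi / 2).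
have s0 : 0 < s by rewrite lt_min !divr_gt0.
have sd : s < d by rewrite gt_min ltr_pdivrMr// ltr_pMr// ltr1n.
have sp : s <= pi / 2 by rewrite ge_min lexx orbT.
(* The interval is clipped to the range of angles from 0 to 2 pi that carries the measure;
   [s <= pi / 2] keeps it nondegenerate even when [y] is an endpoint. *)
pose c := Num.max 0 (y - s); pose t := Num.min (2 * pi) (y + s).
have c0 : 0 <= c by rewrite le_max lexx.
have t2 : t <= 2 * pi by rewrite ge_min lexx.
have ct : c < t by rewrite gt_max !lt_min; apply/andP; split; apply/andP; split; lra.
have cA : `[c, t]%classic `<=` A.
  move=> x /=; rewrite in_itv/= ge_max le_min => /andP[/andP[_ h1] /andP[_ h2]].
  apply: Ad; apply: le_lt_trans sd; rewrite ler_norml; apply/andP; split; lra.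
have : (haar R `[c, t]%classic <= haar R A)%E by apply: le_measure; rewrite ?inE.
rewrite A0 haar_itv// lee_fin leNgt mulr_gt0 ?subr_gt0 ?invr_gt0//.
by rewrite mulr_gt0.
Qed.

Lemma poly_cis_continuous (p : {poly R[i]}) y (e : R) : 0 < e ->
  \forall x \near y, `|rnorm p.[val (cis y)] - rnorm p.[val (cis x)]| <= e.
Proof.
move=> e0; set L := \sum_(i < size p) rnorm p`_i * 2 ^+ i.
have L0 : 0 <= L by apply: sumr_ge0 => i _; rewrite mulr_ge0.
have L1 : 0 < 2 * (L + 1) by rewrite mulr_gt0// ltr_wpDl.
have t0 := divr_gt0 e0 L1; set t := e / _ in t0.
have c1 : \forall x \near y, `|cos y - cos x| <= t.
  by apply: (cvgrPdist_le (F := nbhs y) cos (cos y)).1 t0; exact: continuous_cos.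
have c2 : \forall x \near y, `|sin y - sin x| <= t.
  by apply: (cvgrPdist_le (F := nbhs y) sin (sin y)).1 t0; exact: continuous_sin.
near=> x.
have h : rnorm (val (cis y) - val (cis x)) <= t + t.
  rewrite (le_trans (rnorm_ReIm _))//= lerD//.
    by near: x.
  by near: x.
have : rnorm (p.[val (cis y)] - p.[val (cis x)]) <= e.
  apply: le_trans (horner_diff p _ _ _ h) _; rewrite ?val_circle ?ler1n//.
    by rewrite addr_ge0// ltW.
  rewrite -/L (@le_trans _ _ ((L + 1) * (t + t)))//.
    by rewrite ler_wpM2r ?addr_ge0 ?(ltW t0)// lerDl.
  by rewrite /t le_eqVlt; apply/orP; left; apply/eqP; field; rewrite gt_eqF// ltr_wpDl.
move=> h2; rewrite ler_norml; apply/andP; split.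
  rewrite lerNl opprB lerBlDl (le_trans _ (lerD (lexx _) h2))//.
  rewrite rnormB -lerBlDl -[leLHS]opprB lerNl.
  by have := rnorm_dist p.[val (cis x)] p.[val (cis y)] 0; rewrite !subr0 rnormB; lra.
by have := rnorm_dist p.[val (cis y)] p.[val (cis x)] 0; rewrite !subr0; lra.
Unshelve. all: by end_near.
Qed.

Variable phi : circle R -> R[i].
Hypothesis bphi : besov_plus 2 +oo%E 1%E phi.

(** The Besov condition controls an essential supremum; since the block is a polynomial, continuity
    in the angle turns it into a bound at every point of the circle. *)
Lemma besov_sup_bound n z : rnorm z = 1 ->
  ((rnorm (block phi n).[z])%:E <= Lp +oo (Defs.conv phi (@W R n)))%E.
Proof.
case: bphi => -[ii _ _] neg /circle_surj[y y2 ->].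
rewrite /Lp unlock /Lnorm ifT; last first.
  by rewrite [X in (_ < X)%E](_ : _ = 1%E) ?lte01//; exact: (probability_setT (haar R)).
have e : (fun x => (rnorm (Defs.conv phi (@W R n) (val (cis x))))%:E) =
   (fun x => (rnorm (block phi n).[val (cis x)])%:E).
  by apply/funext => x; rewrite conv_block// neg.
rewrite e; apply: (ess_sup_continuous (g := fun x => rnorm (block phi n).[val (cis x)])) => //.
by move=> e' e'0; exact: poly_cis_continuous.
Qed.

Definition block_sup n : R := fine (Lp +oo (Defs.conv phi (@W R n))).

Lemma Lp_conv_ge0 n : (0 <= Lp +oo (Defs.conv phi (@W R n)))%E.
Proof. exact: Lnorm_ge0. Qed.

Let besov_series : (\sum_(0 <= n <oo)
  (4 ^+ n)%:E * Lp +oo (Defs.conv phi (@W R n)) < +oo)%E.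
Proof.
case: bphi => -[_ + _] _; rewrite /ellq Lnorm1 ge0_integral_count//.
apply: le_lt_trans; rewrite le_eqVlt; apply/orP; left; apply/eqP.
apply: eq_eseriesr => n _; rewrite gee0_abs ?mule_ge0 ?Lp_conv_ge0 ?lee_fin ?powR_ge0//.
rewrite -natrM powR_mulrn//; congr (_%:E * _)%E.
by rewrite mulnC exprM (_ : 2 ^+ 2 = 4 :> R)//; ring.
Qed.

Lemma block_supE n : Lp +oo (Defs.conv phi (@W R n)) = (block_sup n)%:E.
Proof.
have p0 : 0 < 4 ^+ n :> R by rewrite exprn_gt0.
pose t n := ((4 ^+ n)%:E * Lp +oo (Defs.conv phi (@W R n)))%E.
have t0 k : (0 <= t k)%E by rewrite mule_ge0 ?Lp_conv_ge0// lee_fin exprn_ge0.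
rewrite /block_sup fineK// ge0_fin_numE ?Lp_conv_ge0// ltNge leye_eq; apply/negP => /eqP tn.
have : (t n < +oo)%E.
  apply: le_lt_trans besov_series.
  apply: le_trans (nneseries_lim_ge n.+1 _); last by move=> k *; exact: t0.
  by rewrite big_nat_recr//= leeDr//; apply: sume_ge0 => k _; exact: t0.
  by rewrite -[t n]/((4 ^+ n)%:E * Lp +oo (Defs.conv phi (@W R n)))%E tn gt0_muley ?ltxx// lte_fin.
Qed.

Lemma block_sup_summ : summ (fun n => 4 ^+ n * block_sup n).
Proof.
apply: (nneseries_summ (b := fun n => 4 ^+ n * block_sup n)).
  by move=> n; rewrite mulr_ge0 ?exprn_ge0// -lee_fin -block_supE Lp_conv_ge0.
apply: le_lt_trans besov_series; rewrite le_eqVlt; apply/orP; left; apply/eqP.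
by apply: eq_eseriesr => n _; rewrite block_supE EFinM.
Qed.

Lemma block_sup_bound n z : rnorm z = 1 -> rnorm (block phi n).[z] <= block_sup n.
Proof. by move=> z1; rewrite -lee_fin -block_supE; exact: besov_sup_bound. Qed.

Lemma block_sup_summ1 : summ block_sup.
Proof.
apply: summ_le block_sup_summ => n; have := block_sup_summ.1 n.
have p0 : 0 < 4 ^+ n :> R by rewrite exprn_gt0.
rewrite pmulr_rge0// => b0; rewrite b0/= ler_peMl//.
by rewrite exprn_ege1// ler1n.
Qed.

(** By [block_coef_sum], the partial sums at [K] of the block series and of the power series
    defining [disk_ext] differ by block coefficients of index at least [K]. Blocks with 2^(n+1) <= K
    have none; each other one has at most 2^(n+1), of size at most [block_sup n], so the difference
    is bounded by a tail of the summable [2 * (4 ^+ n * block_sup n)]. *)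
Lemma block_series z : rnorm z <= 1 ->
  slim (fun N => \sum_(0 <= n < N) (block phi n).[z]) (disk_ext phi z).
Proof.
move=> z1; have bnd n w : rnorm w <= 1 -> rnorm (block phi n).[w] <= block_sup n.
  by apply: max_principle => ?; exact: block_sup_bound.
have cf n k : rnorm (block phi n)`_k <= block_sup n.
  by apply: coef_bound => ?; exact: block_sup_bound.
have [l sl _] := vseries (@scomplete_C R) (fun n => bnd n z z1) block_sup_summ1.
suff h : slim (series (fun k : nat => fourier phi k%:Z * z ^+ k)) l.
  by rewrite /disk_ext (cvg_lim _ ((slimP _ _).1 h))//; exact: norm_hausdorff.
have b0 := block_sup_summ1.1.
move=> e e0; have e2 : 0 < e / 2 by rewrite divr_gt0.
have [N1 hN1] := sl _ e2; have [n0 hn0] := summ_tail (summZ (ler0n R 2) block_sup_summ) e2.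
exists (maxn N1 (2 ^ n0)) => K; rewrite geq_max => /andP[NK nK].
rewrite (le_trans (rnorm_dist _ (\sum_(0 <= n < K) (block phi n).[z]) _))//.
rewrite [leRHS]splitr lerD ?hN1//.
have -> : \sum_(0 <= n < K) (block phi n).[z] -
      series (fun k : nat => fourier phi k%:Z * z ^+ k) K =
    \sum_(0 <= n < K) \sum_(K <= k < 2 ^ n.+1) (block phi n)`_k * z ^+ k.
  have -> : series (fun k : nat => fourier phi k%:Z * z ^+ k) K =
      \sum_(0 <= n < K) \sum_(0 <= k < K) (block phi n)`_k * z ^+ k.
    rewrite exchange_big; apply: eq_big_nat => k /andP[_ kK].
    by rewrite -mulr_suml block_coef_sum.
  rewrite -sumrB; apply: eq_bigr => n _.
  rewrite (horner_coef_wide z (block_size phi n)).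
  rewrite -(big_mkord xpredT (fun k => (block phi n)`_k * z ^+ k)).
  have [Kn|nK'] := leqP K (2 ^ n.+1).
    by rewrite (big_cat_nat (n := K))//= addrAC subrr add0r.
  have nK2 := ltnW nK'; rewrite [RHS]big_geq; last exact: nK2.
  apply/eqP; rewrite subr_eq0; apply/eqP.
  rewrite [RHS](big_cat_nat (leq0n _) nK2)/=.
  rewrite [X in _ + X]big1_seq; first by rewrite addr0.
  move=> k; rewrite mem_index_iota => /andP[_ /andP[nk _]].
  by rewrite nth_default ?mul0r//; exact: leq_trans (block_size phi n) nk.
rewrite (le_trans (rnorm_sum _ _ _))//.
have n0K : (n0 <= K)%N by rewrite (leq_trans _ nK)// ltnW// ltn_expl.
rewrite (big_cat_nat (n := n0))//= big1_seq ?add0r; last first.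
  move=> n; rewrite mem_index_iota => /andP[_ /andP[_ nn0]].
  by rewrite big_geq ?rnorm0// (leq_trans _ nK)// leq_exp2l.
apply: le_trans (hn0 n0 K (leqnn _)); apply: ler_sum => n _.
rewrite (le_trans (rnorm_sum _ _ _))//.
apply: (@le_trans _ _ (\sum_(K <= k < 2 ^ n.+1) block_sup n)).
  apply: ler_sum => k _; rewrite rnormM rnormX -[leRHS]mulr1 ler_pM ?exprn_ge0//.
  by rewrite exprn_ile1.
rewrite sumr_const_nat -[leLHS]mulr_natl mulrA ler_wpM2r ?b0//.
rewrite -natrX -natrM ler_nat (leq_trans (leq_subr _ _))//.
by rewrite expnS leq_mul2l/= -[4%N]/(2 ^ 2)%N -expnM leq_exp2l// leq_pmull.
Qed.

End Sup.

(** * Difference identities *)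

Section Antidiagonal.

(** [k] stands for [j + l + 1]. The vanishing of [Y] beyond [B] turns the triangle of pairs into the
    full square, so that all later sums run over a fixed box of indices. *)
Lemma sum_antidiag (V : nmodType) (Y : nat -> nat -> V) (B : nat) :
  (forall j l, (B <= j + l.+1)%N -> Y j l = 0) ->
  \sum_(0 <= k < B) \sum_(0 <= j < k) Y j (k.-1 - j)%N =
  \sum_(0 <= j < B) \sum_(0 <= l < B) Y j l.
Proof.
move=> Y0.
have e k : (k < B)%N -> \sum_(0 <= j < k) Y j (k.-1 - j)%N =
    \sum_(0 <= j < B) (if (j < k)%N then Y j (k.-1 - j)%N else 0).
  move=> kB; rewrite [RHS](big_cat_nat (n := k))//= ?(ltnW kB)//.
  rewrite [X in _ = _ + X]big1_seq ?addr0; last first.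
    by move=> j; rewrite mem_index_iota => /andP[_ /andP[kj _]]; rewrite ltnNge kj.
  by apply: eq_big_nat => j /andP[_ ->].
rewrite (eq_big_nat _ _ (F2 := fun k => \sum_(0 <= j < B)
  (if (j < k)%N then Y j (k.-1 - j)%N else 0))); last first.
  by move=> k /andP[_ /e].
rewrite exchange_big/=; apply: eq_big_nat => j /andP[_ jB].
rewrite (big_cat_nat (n := j.+1))//= big1_seq ?add0r; last first.
  by move=> k; rewrite mem_index_iota => /andP[_ /andP[_ kj]]; rewrite ltnNge -ltnS kj.
rewrite -{1}[j.+1]add0n big_addn [RHS](big_cat_nat (n := (B - j.+1)%N))//= ?leq_subr//.
rewrite [X in _ = _ + X]big1_seq ?addr0; last first.
  by move=> l; rewrite mem_index_iota => /andP[_ /andP[Bl _]]; apply: Y0; lia.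
apply: eq_bigr => l _; rewrite ifT; last by lia.
by congr Y; lia.
Qed.

Lemma pow_diff (F : comNzRingType) (a b : F) k :
  a ^+ k - b ^+ k = (a - b) * \sum_(0 <= j < k) a ^+ j * b ^+ (k.-1 - j).
Proof.
rewrite -opprB subrXX -mulNr opprB big_mkord; congr (_ * _).
by apply: eq_bigr => i _; rewrite mulrC.
Qed.

End Antidiagonal.

Section ScalarDifferences.
Variable R : realType.
Local Notation C := R[i].
Implicit Types (p : {poly C}) (a b c : C).

Lemma horner_wide p a B : (size p <= B)%N -> p.[a] = \sum_(0 <= k < B) p`_k * a ^+ k.
Proof. by move=> pB; rewrite (horner_coef_wide a pB) big_mkord. Qed.

Lemma ddiff1_poly p a b B : (size p <= B)%N -> a != b ->
  ddiff1 (horner p) a b = \sum_(0 <= i < B) \sum_(0 <= j < B) p`_(i + j.+1) * (a ^+ i * b ^+ j).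
Proof.
move=> pB ab; have ab0 : a - b != 0 by rewrite subr_eq0.
rewrite -sum_antidiag => [|i j h]; last by rewrite nth_default ?mul0r// (leq_trans pB).
apply: (mulIf ab0); rewrite /ddiff1 divfK// !(horner_wide _ pB) -sumrB mulr_suml.
apply: eq_big_nat => k /andP[_ kB]; rewrite -mulrBr pow_diff !mulr_sumr mulr_suml.
apply: eq_big_nat => j /andP[_ jk].
rewrite (_ : (j + (k.-1 - j).+1)%N = k); last by lia.
by ring.
Qed.

Lemma ddiff2_poly p a b c B : (size p <= B)%N -> a != b -> a != c -> b != c ->
  ddiff2 (horner p) a b c =
  \sum_(0 <= i < B) \sum_(0 <= j < B) \sum_(0 <= l < B)
    p`_(i + j + l.+2) * (a ^+ i * b ^+ j * c ^+ l).
Proof.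
move=> pB ab ac bc; have bc0 : b - c != 0 by rewrite subr_eq0.
apply: (mulIf bc0); rewrite /ddiff2 divfK// !(ddiff1_poly pB)// -sumrB mulr_suml.
apply: eq_big_nat => i _; rewrite -sumrB.
transitivity ((\sum_(0 <= j < B) \sum_(0 <= l < B)
  p`_(i + (j + l.+1).+1) * (a ^+ i * b ^+ j * c ^+ l)) * (b - c)); last first.
  congr (_ * _); apply: eq_bigr => j _; apply: eq_bigr => l _.
  by congr (p`_ _ * _); lia.
rewrite -sum_antidiag => [|j l h]; last by rewrite nth_default ?mul0r// (leq_trans pB)//; lia.
rewrite mulr_suml; apply: eq_big_nat => k /andP[_ kB].
rewrite -mulrBr -mulrBr pow_diff mulr_sumr !mulr_sumr mulr_suml; apply: eq_big_nat => j /andP[_ jk].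
rewrite (_ : (i + (j + (k.-1 - j).+1).+1)%N = (i + k.+1)%N); last by lia.
by ring.
Qed.

End ScalarDifferences.

(** * Divided differences with operator arguments *)

Section OperatorDifferences.
Variables (R : realType) (H : hilbert R).

Lemma horner_op_wide (T : H -> H) (p : {poly R[i]}) x B : (size p <= B)%N ->
  horner_op p T x = \sum_(0 <= k < B) p`_k *: iter k T x.
Proof.
move=> pB; rewrite /horner_op -(big_mkord xpredT (fun k => p`_k *: iter k T x)).
rewrite [RHS](big_cat_nat (n := size p))//= [X in _ = _ + X]big1_seq ?addr0//.
by move=> k; rewrite mem_index_iota => /andP[_ /andP[pk _]]; rewrite nth_default ?scale0r.
Qed.

Variable Q : H -> H.
Hypothesis lQ : linear Q.

Lemma iter_difference (A A' : H -> H) (s : R[i]) k y : linear A ->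
  (forall z, A z - A' z = s *: Q z) ->
  iter k A y - iter k A' y = s *: \sum_(0 <= j < k) iter j A (Q (iter (k.-1 - j) A' y)).
Proof.
move=> lA hA; elim: k => [|k IH]; first by rewrite big_geq// subrr scaler0.
rewrite !iterS -(subrK (A (iter k A' y)) (A (iter k A y))) -addrA hA.
rewrite -(linfunB _ _ lA) IH (linfunZ _ _ lA) (linfun_sum _ _ _ lA) -scalerDr addrC.
rewrite big_nat_recl//= subn0; congr (_ *: (_ + _)).
by apply: eq_big_nat => j /andP[_ jk]; congr (A (iter _ _ (Q (iter _ _ _)))); lia.
Qed.

Variables (p : {poly R[i]}) (B : nat).
Hypothesis pB : (size p <= B)%N.

(** The first divided difference of [p] with operators for the two points and [Q] between them;
    [op_diff2] is the analogue for three points. The order of the arguments matters, since nothing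
    commutes. *)
Definition op_diff1 (A A' : H -> H) (y : H) : H :=
  \sum_(0 <= i < B) \sum_(0 <= j < B) p`_(i + j.+1) *: iter i A (Q (iter j A' y)).

Definition op_diff2 (A A' A'' : H -> H) (y : H) : H :=
  \sum_(0 <= i < B) \sum_(0 <= j < B) \sum_(0 <= l < B)
    p`_(i + j + l.+2) *: tri Q (iter i A) (iter j A') (iter l A'') y.

Lemma horner_op_difference (A A' : H -> H) (s : R[i]) y : linear A ->
  (forall z, A z - A' z = s *: Q z) ->
  horner_op p A y - horner_op p A' y = s *: op_diff1 A A' y.
Proof.
move=> lA hA.
rewrite !(horner_op_wide _ _ pB) -sumrB /op_diff1 -sum_antidiag => [|i j h]; last first.
  by rewrite nth_default ?scale0r// (leq_trans pB).
rewrite scaler_sumr; apply: eq_big_nat => k /andP[_ kB].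
rewrite -scalerBr (iter_difference k y lA hA) scalerA mulrC -scalerA scaler_sumr; congr (_ *: _).
apply: eq_big_nat => j /andP[_ jk]; congr (p`_ _ *: _); lia.
Qed.

(** Here and in [op_diff1_difference_l], moving one argument of [op_diff1] by a multiple of [Q]
    yields [op_diff2] with the new and the old value side by side. Differentiating [op_diff1 A A]
    takes both moves, whence the factor 2 in the second derivative. *)
Lemma op_diff1_difference_r (A A' A'' : H -> H) (s : R[i]) y : linear A -> linear A' ->
  (forall z, A' z - A'' z = s *: Q z) ->
  op_diff1 A A' y - op_diff1 A A'' y = s *: op_diff2 A A' A'' y.
Proof.
move=> lA lA' hA; rewrite /op_diff1 -sumrB /op_diff2 scaler_sumr; apply: eq_bigr => i _.
have li := linear_iter i lA.
transitivity (s *: \sum_(0 <= j < B) \sum_(0 <= l < B)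
    p`_(i + (j + l.+1).+1) *: tri Q (iter i A) (iter j A') (iter l A'') y); last first.
  congr (_ *: _); apply: eq_bigr => j _; apply: eq_bigr => l _.
  by congr (p`_ _ *: _); lia.
rewrite -sum_antidiag => [|j l h]; last by rewrite nth_default ?scale0r// (leq_trans pB)//; lia.
rewrite -sumrB scaler_sumr; apply: eq_big_nat => k /andP[_ kB].
rewrite -scalerBr -(linfunB _ _ li) -(linfunB _ _ lQ) (iter_difference k y lA' hA).
rewrite (linfunZ _ _ lQ) (linfunZ _ _ li) scalerA mulrC -scalerA; congr (_ *: _).
rewrite (linfun_sum _ _ _ lQ) (linfun_sum _ _ _ li) scaler_sumr.
by apply: eq_big_nat => j /andP[_ jk]; congr (p`_ _ *: _); lia.
Qed.

Lemma op_diff1_difference_l (A A' A'' : H -> H) (s : R[i]) y : linear A ->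
  (forall z, A z - A' z = s *: Q z) ->
  op_diff1 A A'' y - op_diff1 A' A'' y = s *: op_diff2 A A' A'' y.
Proof.
move=> lA hA; rewrite /op_diff1 exchange_big/= [X in _ - X]exchange_big/= -sumrB.
transitivity (s *: \sum_(0 <= l < B) \sum_(0 <= i < B) \sum_(0 <= j < B)
    p`_(i + j.+1 + l.+1) *: tri Q (iter i A) (iter j A') (iter l A'') y); last first.
  congr (_ *: _); rewrite exchange_big/=; apply: eq_bigr => i _.
  rewrite exchange_big/=; apply: eq_bigr => j _; apply: eq_bigr => l _.
  by congr (p`_ _ *: _); lia.
rewrite scaler_sumr; apply: eq_bigr => l _.
rewrite -sum_antidiag => [|j k h]; last by rewrite nth_default ?scale0r// (leq_trans pB)//; lia.
rewrite -sumrB scaler_sumr; apply: eq_big_nat => k /andP[_ kB].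
rewrite -scalerBr (iter_difference k _ lA hA).
rewrite scalerA mulrC -scalerA; congr (_ *: _); rewrite scaler_sumr.
by apply: eq_big_nat => j /andP[_ jk]; congr (p`_ _ *: _); lia.
Qed.

End OperatorDifferences.

(** * Tensor representation of the second divided difference *)

Section TensorExpansion.
Variable R : realType.
Local Notation C := R[i].
Variables (p : {poly C}) (B : nat) (L : seq (ctriple R)).
Hypothesis sL : forall x, x \in L ->
  [/\ (size x.1.1 <= B)%N, (size x.1.2 <= B)%N & (size x.2 <= B)%N].
Hypothesis cL : forall i j l, \sum_(x <- L) x.1.1`_i * x.1.2`_j * x.2`_l = p`_(i + j + l.+2).

(** The coefficient identity holds for any values attached to the monomials: scalar monomials give
    the kernel, operator monomials with [Q] inserted give [op_diff2]. *)
Lemma tensor_expand (V : lmodType C) (W : nat -> nat -> nat -> V) :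
  \sum_(x <- L) \sum_(0 <= i < B) \sum_(0 <= j < B) \sum_(0 <= l < B)
    (x.1.1`_i * x.1.2`_j * x.2`_l) *: W i j l =
  \sum_(0 <= i < B) \sum_(0 <= j < B) \sum_(0 <= l < B) p`_(i + j + l.+2) *: W i j l.
Proof.
do 3![rewrite exchange_big/=; apply: eq_bigr => ? _].
by rewrite -scaler_suml cL.
Qed.

Lemma tensor_horner a b c : \sum_(x <- L) x.1.1.[a] * x.1.2.[b] * x.2.[c] =
  \sum_(0 <= i < B) \sum_(0 <= j < B) \sum_(0 <= l < B)
    p`_(i + j + l.+2) * (a ^+ i * b ^+ j * c ^+ l).
Proof.
rewrite -[RHS](tensor_expand (V := C^o) (fun i j l => a ^+ i * b ^+ j * c ^+ l)).
rewrite !big_seq; apply: eq_bigr => x /sL[h1 h2 h3].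
rewrite (horner_wide a h1) (horner_wide b h2) (horner_wide c h3).
rewrite -mulrA mulr_suml; apply: eq_bigr => i _.
rewrite mulr_suml mulr_sumr; apply: eq_bigr => j _.
rewrite !mulr_sumr; apply: eq_bigr => l _.
by rewrite -[_ *: _]/(_ * _); ring.
Qed.

Lemma tensor_op (H : hilbert R) (Q A A' A'' : H -> H) y : linear Q -> linear A -> linear A' ->
  \sum_(x <- L) tri Q (horner_op x.1.1 A) (horner_op x.1.2 A') (horner_op x.2 A'') y =
  op_diff2 Q p B A A' A'' y.
Proof.
move=> lQ lA lA'; rewrite /op_diff2 -tensor_expand !big_seq; apply: eq_bigr => x /sL[h1 h2 h3].
rewrite /tri (horner_op_wide _ _ h1); apply: eq_bigr => i _; have li := linear_iter i lA.
rewrite (horner_op_wide _ _ h2) (linfun_sum _ _ _ lQ) (linfun_sum _ _ _ li) scaler_sumr.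
apply: eq_bigr => j _.
have lj := linear_iter j lA'.
rewrite (horner_op_wide _ _ h3) (linfun_sum _ _ _ lQ) (linfunZ _ _ lQ) (linfunZ _ _ li).
rewrite (linfun_sum _ _ _ lj) (linfun_sum _ _ _ lQ) (linfun_sum _ _ _ li).
rewrite !scaler_sumr; apply: eq_bigr => l _.
by rewrite !(linfunZ _ _ lQ, linfunZ _ _ li, linfunZ _ _ lj) !scalerA mulrA.
Qed.

End TensorExpansion.

(** * From a sequence of finite lists to a single sequence *)

Section Flatten.
Variables (T : eqType) (d : T) (L : nat -> seq T).
Hypothesis L0 : forall n, L n != [::].

Let S N := flatten (mkseq L N).

(** As no list is empty, the first [m.+1] lists hold more than [m] entries together, so the default
    [d] is never reached. *)
Definition flat_seq m := nth d (S m.+1) m.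

Let S_rec N : S N.+1 = S N ++ L N.
Proof. by rewrite /S /mkseq -addn1 iotaD map_cat flatten_cat /= cats0. Qed.

Lemma size_flat_ge N : (N <= size (S N))%N.
Proof.
elim: N => // N IH; rewrite S_rec size_cat.
have : (0 < size (L N))%N by rewrite lt0n size_eq0 L0.
by lia.
Qed.

Let S_prefix N k : exists s, S (N + k) = S N ++ s.
Proof.
elim: k => [|k [s IH]]; first by exists [::]; rewrite addn0 cats0.
by exists (s ++ L (N + k)%N); rewrite addnS S_rec IH catA.
Qed.

Let flatE N m : (m < size (S N))%N -> flat_seq m = nth d (S N) m.
Proof.
move=> mN; rewrite /flat_seq; have m1 := size_flat_ge m.+1.
have [h|h] := leqP N m.+1.
  have [s] := S_prefix N (m.+1 - N); rewrite subnKC// => ->.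
  by rewrite nth_cat mN.
have [s] := S_prefix m.+1 (N - m.+1); rewrite subnKC; last exact: ltnW.
by move=> ->; rewrite nth_cat m1.
Qed.

Lemma flat_seq_sum (V : nmodType) (g : T -> V) N :
  \sum_(0 <= m < size (S N)) g (flat_seq m) = \sum_(0 <= n < N) \sum_(x <- L n) g x.
Proof.
transitivity (\sum_(x <- S N) g x).
  rewrite [RHS](big_nth d); apply: eq_big_nat => m /andP[_ mN].
  by rewrite (flatE mN).
elim: N => [|N IH]; first by rewrite big_nil big_geq.
by rewrite S_rec big_cat/= IH big_nat_recr.
Qed.

Variables (R : realType) (V : normedModType R[i]) (w : T -> R).
Hypotheses (w0 : forall x, 0 <= w x) (sw : summ (fun n => \sum_(x <- L n) w x)).

Lemma flat_seq_summ : summ (fun m => w (flat_seq m)).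
Proof.
split=> [m|]; first exact: w0.
have [_ [M hM]] := sw; exists M => m; apply: le_trans (hM m).
rewrite -flat_seq_sum (big_cat_nat (n := m) (p := size (S m)))//= ?size_flat_ge//.
by rewrite lerDl sumr_ge0.
Qed.

(** The sums over whole lists are a subsequence of the flattened partial sums, which converge by
    domination; the two limits therefore agree. *)
Lemma flat_seq_slim (g : T -> V) (K : R) l : scomplete V -> 0 <= K ->
  (forall x, rnorm (g x) <= K * w x) ->
  slim (fun N => \sum_(0 <= n < N) \sum_(x <- L n) g x) l ->
  slim (fun m => \sum_(0 <= k < m) g (flat_seq k)) l.
Proof.
move=> cV K0 gw hl.
have [l' hl' _] := vseries cV (fun m => gw (flat_seq m)) (summZ K0 flat_seq_summ).
suff -> : l = l' by [].
apply: slim_unique hl _ => e e0; have [N hN] := hl' e e0; exists N => n Nn.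
by rewrite -flat_seq_sum; apply: hN; rewrite (leq_trans Nn)// size_flat_ge.
Qed.

End Flatten.

(** * Triples of distinct points of the circle *)

Section CircleTopology.
Variable R : realType.
Implicit Types (a b c z w : circle R).

Lemma near_circle a (d : R) : 0 < d -> \forall z \near a, rnorm (val a - val z) <= d.
Proof.
move=> d0.
by apply: (@initial_continuous (circle R) R[i] set_val a _ (near_rnorm (val a) d0)).
Qed.

Lemma nbhs_circle a (P : set (circle R)) : nbhs a P ->
  exists2 r : R, 0 < r & forall z, rnorm (val a - val z) < r -> P z.
Proof.
move=> [_ [/= [W oW <-] Wa] WP].
have /nbhs_ballP[r /= r0 hr] : nbhs (val a) W by exact: open_nbhs_nbhs.
have [s s0 rs] := gt0_real_complex r0.
exists s => // z az; apply: WP; apply: hr.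
by rewrite -ball_normE/= rs rnorm_lt.
Qed.

Lemma cis_near1 (r : R) : 0 < r -> exists2 d : R, 0 < d &
  forall x : R, `|x| < d -> rnorm (1 - val (cis x) : R[i]) < r.
Proof.
move=> r0; have r3 : 0 < r / 3 by rewrite divr_gt0.
have c1 : \forall x \near (0 : R), `|cos 0 - cos x| <= r / 3.
  by apply: (cvgrPdist_le (F := nbhs (0 : R)) cos (cos 0)).1 r3; exact: continuous_cos.
have c2 : \forall x \near (0 : R), `|sin 0 - sin x| <= r / 3.
  by apply: (cvgrPdist_le (F := nbhs (0 : R)) sin (sin 0)).1 r3; exact: continuous_sin.
have c3 : nbhs (0 : R) (fun x => `|cos 0 - cos x| <= r / 3 /\ `|sin 0 - sin x| <= r / 3).
  exact: filterI c1 c2.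
have /nbhs_ballP[d /= d0 hd] := c3; exists d => // x xd.
have [] := hd x; first by rewrite -ball_normE/= sub0r normrN.
rewrite cos0 sin0 => h1 h2; apply: le_lt_trans (rnorm_ReIm _) _ => /=.
by apply: le_lt_trans (lerD h1 h2) _; lra.
Qed.

(** Equal points are separated by every nonzero angle below pi, whose sine does not vanish;
    different points by continuity of the rotation at angle 0. *)
Lemma cis_avoid z w : exists2 d : R, 0 < d &
  forall x : R, x != 0 -> `|x| < d -> val z <> val w * val (cis x).
Proof.
have w1 : rnorm (val w) = 1 := val_circle w.
have w0 := rnorm1_neq0 w1.
have [zw|zw] := eqVneq (val z) (val w).
  exists pi; first exact: pi_gt0.
  move=> x x0 xpi; rewrite zw -{1}[val w]mulr1 => /(mulfI w0) e.
  have /eqP : sin x = 0 by rewrite -[LHS]/(complex.Im (val (cis x))) -e.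
  have := xpi; case: (ltrgtP x 0) x0 => // xs _ h.
    rewrite -oppr_eq0 -sinN gt_eqF// sin_gt0_pi// oppr_gt0 xs/=.
    by rewrite -ltr0_norm.
  by rewrite gt_eqF// sin_gt0_pi// xs/= -[x]gtr0_norm.
have r0 : 0 < rnorm (val w - val z).
  rewrite lt0r rnorm_ge0 andbT; apply: contra zw => /eqP/rnorm_eq0/eqP.
  by rewrite subr_eq0 eq_sym.
have [d d0 hd] := cis_near1 r0; exists d => // x _ /hd h e; move: h.
by rewrite e -{1}[val w]mulr1 -mulrBr rnormM w1 mul1r ltxx.
Qed.

Lemma rot_circle z x : circle R (val z * val (cis x)).
Proof. by apply/circleP; rewrite rnormM !val_circle mulr1. Qed.

Definition rot z x : circle R := exist _ (val z * val (cis x)) (mem_set (rot_circle z x)).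

(** The limit defining [D2] is determined only along a proper filter. Near (a, b, c), coincidences
    included, rotating b by x and c by 2 x gives distinct points for small x > 0. *)
Lemma distinct_triples_proper a b c :
  ProperFilter (within (@distinct_triples R) (nbhs (a, b, c))).
Proof.
apply: Build_ProperFilter_ex => P; rewrite /within/=.
move=> -[[P1 P2] /= [[[P3 P4] /= [n3 n4] s1] n2] s2].
have [r3 r30 h3] := nbhs_circle n3; have [r4 r40 h4] := nbhs_circle n4.
have [r2 r20 h2] := nbhs_circle n2.
have [d4 d40 k4] := cis_near1 r40; have [d2 d20 k2] := cis_near1 r20.
have [e1 e10 m1] := cis_avoid a b; have [e2 e20 m2] := cis_avoid a c.
have [e3 e30 m3] := cis_avoid b c.
pose m := Num.min d4 (Num.min d2 (Num.min e1 (Num.min e2 e3))).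
have m0 : 0 < m by rewrite !lt_min d40 d20 e10 e20 e30.
have mle : [/\ m <= d4, m <= d2, m <= e1, m <= e2 & m <= e3].
  by split; rewrite !ge_min lexx ?orbT.
case: mle => l1 l2 l3 l4 l5.
(* Dividing by 3 puts both angles [x] and [2 * x] below [m]. *)
pose x := m / 3; have x0 : 0 < x by rewrite divr_gt0.
have x1 : `|x| < m by rewrite gtr0_norm// /x; lra.
have x2 : `|2 * x| < m by rewrite gtr0_norm ?mulr_gt0// /x; lra.
have xn : x != 0 by rewrite gt_eqF.
have x2n : 2 * x != 0 by rewrite gt_eqF// mulr_gt0.
have nr z y : rnorm (val z - val (rot z y)) = rnorm (1 - val (cis y) : R[i]).
  by rewrite -{1}[val z]mulr1 -mulrBr rnormM val_circle mul1r.
have cD : val (cis (2 * x)) = val (cis x) * val (cis x) :> R[i].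
  rewrite mulr_natl mulr2n -[LHS]/(cos (x + x) +i* sin (x + x)) cosD sinD.
  by apply/eqP; rewrite eq_complex/= eqxx/= addrC mulrC.
have c0 := rnorm1_neq0 (val_circle (cis x)).
exists (a, rot b x, rot c (2 * x)); apply: s2 => /=.
  split.
    apply: s1; split; first by apply: h3; rewrite subrr rnorm0.
    by apply: h4; rewrite nr; apply: k4; exact: lt_le_trans x1 l1.
  by apply: h2; rewrite nr; apply: k2; exact: lt_le_trans x2 l2.
split => /=; apply/eqP => /(congr1 val) /=.
- by apply: m1 => //; exact: lt_le_trans x1 l3.
- by apply: m2 => //; exact: lt_le_trans x2 l4.
- rewrite -[LHS]/(val b * val (cis x)) -[RHS]/(val c * val (cis (2 * x))) cD mulrA.
  by move/(mulIf c0); apply: m3 => //; exact: lt_le_trans x1 l5.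
Qed.

Lemma near_triple a b c (d : R) : 0 < d ->
  \forall u \near (a, b, c), [/\ rnorm (val a - val u.1.1) <= d,
    rnorm (val b - val u.1.2) <= d & rnorm (val c - val u.2) <= d].
Proof.
move=> d0.
exists ([set u | rnorm (val a - val u.1) <= d /\ rnorm (val b - val u.2) <= d],
        [set z | rnorm (val c - val z) <= d]).
  split => /=; last exact: near_circle.
  exists ([set z | rnorm (val a - val z) <= d], [set z | rnorm (val b - val z) <= d]) => //.
  by split; exact: near_circle.
by move=> [[u1 u2] u3] /= [[h1 h2] h3].
Qed.

End CircleTopology.

Section D2Limit.
Variable R : realType.
Local Notation C := R[i].

Definition triple_lipschitz (G : C -> C -> C -> C) : Prop :=
  exists2 K : R, 0 <= K & forall a b c a' b' c' (d : R),
    rnorm a = 1 -> rnorm b = 1 -> rnorm c = 1 ->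
    rnorm a' = 1 -> rnorm b' = 1 -> rnorm c' = 1 ->
    rnorm (a - a') <= d -> rnorm (b - b') <= d -> rnorm (c - c') <= d ->
    rnorm (G a b c - G a' b' c') <= K * d.

Lemma tensor_lipschitz (x : ctriple R) :
  triple_lipschitz (fun a b c => x.1.1.[a] * x.1.2.[b] * x.2.[c]).
Proof.
pose L (p : {poly C}) : R := \sum_(i < size p) rnorm p`_i * 2 ^+ i.
have L0 p : 0 <= L p by apply: sumr_ge0 => i _; rewrite mulr_ge0.
have lip (p : {poly C}) (z w : C) (d : R) : rnorm z = 1 -> rnorm w = 1 -> rnorm (z - w) <= d ->
    rnorm (p.[z] - p.[w]) <= L p * d.
  move=> z1 w1 zw; have d0 := le_trans (rnorm_ge0 _) zw.
  by apply: horner_diff => //; rewrite ?z1 ?w1 ?ler1n.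
have bd (p : {poly C}) (z : C) : rnorm z = 1 -> rnorm p.[z] <= L p.
  move=> z1; rewrite horner_coef (le_trans (rnorm_sum _ _ _))// ler_sum// => i _.
  by rewrite rnormM rnormX z1 expr1n ler_wpM2l// exprn_ege1// ler1n.
exists (3 * (L x.1.1 * L x.1.2 * L x.2)); first by rewrite !mulr_ge0.
move=> a b c a' b' c' d a1 b1 c1 a1' b1' c1' da db dc.
have d0 := le_trans (rnorm_ge0 _) da.
rewrite (_ : _ - _ = (x.1.1.[a] - x.1.1.[a']) * x.1.2.[b] * x.2.[c] +
   (x.1.1.[a'] * (x.1.2.[b] - x.1.2.[b']) * x.2.[c] +
    x.1.1.[a'] * x.1.2.[b'] * (x.2.[c] - x.2.[c']))); last by ring.
have -> : 3 * (L x.1.1 * L x.1.2 * L x.2) * d = (L x.1.1 * d) * L x.1.2 * L x.2 +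
   (L x.1.1 * (L x.1.2 * d) * L x.2 + L x.1.1 * L x.1.2 * (L x.2 * d)) by ring.
rewrite (le_trans (rnormD _ _))// lerD//.
  by rewrite !rnormM !ler_pM ?mulr_ge0// ?lip// bd.
rewrite (le_trans (rnormD _ _))// lerD//.
  by rewrite !rnormM !ler_pM ?mulr_ge0// ?lip// bd.
by rewrite !rnormM !ler_pM ?mulr_ge0// ?lip// bd.
Qed.

Lemma lipschitz_sum (I : Type) (r : seq I) (G : I -> C -> C -> C -> C) :
  (forall i, triple_lipschitz (G i)) ->
  triple_lipschitz (fun a b c => \sum_(i <- r) G i a b c).
Proof.
move=> h; elim: r => [|i r [K K0 IH]].
  exists 0 => // *; rewrite !big_nil subrr rnorm0 mul0r//.
have [K' K'0 h'] := h i; exists (K' + K); first by rewrite addr_ge0.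
move=> a b c a' b' c' d *; rewrite !big_cons opprD addrACA mulrDl.
by rewrite (le_trans (rnormD _ _))// lerD// ?h'// IH.
Qed.

(** A uniform limit of Lipschitz kernels is continuous. As [Psi] agrees with the divided difference
    on distinct triples, it is the extension by continuity that [D2] takes, diagonals included. *)
Lemma D2_eq (f : C -> C) (Psi : circle R -> circle R -> circle R -> C)
   (G : nat -> C -> C -> C -> C) :
  (forall N, triple_lipschitz (G N)) ->
  (forall e : R, 0 < e -> exists N, forall a b c,
     rnorm (Psi a b c - G N (val a) (val b) (val c)) <= e) ->
  (forall a b c : circle R, val a != val b -> val a != val c -> val b != val c ->
     ddiff2 f (val a) (val b) (val c) = Psi a b c) ->
  forall a b c, D2 f a b c = Psi a b c.
Proof.
move=> lipG apG fPsi a b c; rewrite /D2.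
have FF := distinct_triples_proper a b c.
apply: (cvg_lim (@norm_hausdorff _ R[i])).
apply/cvg_rnormP => e e0.
have e3 : 0 < e / 3 by rewrite divr_gt0.
have [N hN] := apG _ e3; have [K K0 hK] := lipG N.
have d0 : 0 < (e / 3) / (K + 1) by rewrite divr_gt0// ltr_wpDl.
have := near_triple a b c d0; rewrite /prop_near1 /within/=.
apply: (@filterS _ (nbhs (a, b, c))) => -[[u v] w] /= [h1 h2 h3] [/= uv uw vw].
rewrite fPsi; last 3 first.
- by apply: contra uv => /eqP h; apply/eqP/val_inj.
- by apply: contra uw => /eqP h; apply/eqP/val_inj.
- by apply: contra vw => /eqP h; apply/eqP/val_inj.
rewrite (le_trans (rnorm_dist _ (G N (val a) (val b) (val c)) _))//.
have k1 := hN a b c; have k2 := hN u v w.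
have k3 := hK _ _ _ _ _ _ _ (val_circle a) (val_circle b) (val_circle c)
  (val_circle u) (val_circle v) (val_circle w) h1 h2 h3.
have k4 := rnorm_dist (G N (val a) (val b) (val c)) (G N (val u) (val v) (val w)) (Psi u v w).
have k5 : K * (e / 3 / (K + 1)) <= e / 3.
  by rewrite mulrA ler_pdivrMr ?ltr_wpDl// mulrC ler_pM2l// lerDl.
rewrite rnormB in k2; have -> : e = e / 3 + (e / 3 + e / 3) by field.
apply: lerD => //; apply: (le_trans k4); apply: lerD => //.
exact: le_trans k3 k5.
Qed.

End D2Limit.

Section D2Tensor.
Variable R : realType.
Local Notation C := R[i].
Variables (f : C -> C) (p : nat -> {poly C}) (B : nat -> nat) (L : nat -> seq (ctriple R)).
Hypothesis hf : forall z, rnorm z <= 1 -> slim (fun N => \sum_(0 <= n < N) (p n).[z]) (f z).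
Hypothesis pB : forall n, (size (p n) <= B n)%N.
Hypothesis L0 : forall n, L n != [::].
Hypothesis sL : forall n x, x \in L n ->
  [/\ (size x.1.1 <= B n)%N, (size x.1.2 <= B n)%N & (size x.2 <= B n)%N].
Hypothesis cL : forall n i j l,
  \sum_(x <- L n) x.1.1`_i * x.1.2`_j * x.2`_l = (p n)`_(i + j + l.+2).
Hypothesis sw : summ (fun n => \sum_(x <- L n) tnorm x).

Definition flat_tensor : nat -> ctriple R := flat_seq (0, 0, 0) L.

Lemma ddiff2_series a b c : rnorm a <= 1 -> rnorm b <= 1 -> rnorm c <= 1 ->
  a != b -> a != c -> b != c ->
  slim (fun N => \sum_(0 <= n < N) ddiff2 (horner (p n)) a b c) (ddiff2 f a b c).
Proof.
move=> a1 b1 c1 ab ac bc.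
have slimM (u : nat -> C) l k : slim u l -> slim (fun n => u n * k) (l * k).
  by move=> h; exact: (slimZl (V := C^o) k h).
have slimN (u : nat -> C) l : slim u l -> slim (fun n => - u n) (- l).
  by move=> h e e0; have [N hN] := h e e0; exists N => n /hN; rewrite -opprD rnormN.
have dd1 x y : rnorm x <= 1 -> rnorm y <= 1 ->
    slim (fun N => \sum_(0 <= n < N) ddiff1 (horner (p n)) x y) (ddiff1 f x y).
  move=> x1 y1 e e0.
  have [N hN] := slimM _ _ (x - y)^-1 (slimD (hf x1) (slimN _ _ (hf y1))) e e0.
  by exists N => n /hN; rewrite -sumrB mulr_suml.
move=> e e0.
have [N hN] := slimM _ _ (b - c)^-1 (slimD (dd1 _ _ a1 b1) (slimN _ _ (dd1 _ _ a1 c1))) e e0.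
by exists N => n /hN; rewrite -sumrB mulr_suml.
Qed.

Lemma tensor_term_bound (x : ctriple R) a b c : rnorm a <= 1 -> rnorm b <= 1 -> rnorm c <= 1 ->
  rnorm (x.1.1.[a] * x.1.2.[b] * x.2.[c]) <= tnorm x.
Proof.
move=> a1 b1 c1; rewrite !rnormM.
have h (q : {poly C}) z : rnorm z <= 1 -> rnorm q.[z] <= sup_disk (horner q).
  by move=> z1; apply: sup_disk_ub; [exact: disk_algebra_poly|apply/closed_diskP].
by rewrite !ler_pM ?mulr_ge0// h.
Qed.

(** The flattened sum [Psi] is the uniform limit of its partial sums, the error being a tail of
    [tnorm]; on distinct triples it is identified block by block with the divided difference. *)
Lemma D2_series a b c :
  slim (fun m => \sum_(0 <= k < m) ((flat_tensor k).1.1.[val a] *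
     (flat_tensor k).1.2.[val b] * (flat_tensor k).2.[val c])) (D2 f a b c).
Proof.
have v1 (z : circle R) : rnorm (val z) <= 1 by rewrite val_circle.
pose g (a b c : circle R) (x : ctriple R) := x.1.1.[val a] * x.1.2.[val b] * x.2.[val c].
have gw a' b' c' x : rnorm (g a' b' c' x) <= tnorm x by exact: tensor_term_bound.
have fs := flat_seq_summ (0, 0, 0) L0 (@tnorm_ge0 R) sw; rewrite -/flat_tensor in fs.
have ex (u : circle R * circle R * circle R) : exists l,
    slim (fun m => \sum_(0 <= k < m) g u.1.1 u.1.2 u.2 (flat_tensor k)) l /\
    forall n e, (forall m, \sum_(n <= k < m) tnorm (flat_tensor k) <= e) ->
      rnorm (l - \sum_(0 <= k < n) g u.1.1 u.1.2 u.2 (flat_tensor k)) <= e.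
  have [l h1 h2] := vseries (@scomplete_C R) (fun m => gw u.1.1 u.1.2 u.2 (flat_tensor m)) fs.
  by exists l.
have [Psi hPsi] := choice ex.
rewrite (@D2_eq R f (fun a b c => Psi (a, b, c)) (fun N a b c =>
  \sum_(0 <= k < N) ((flat_tensor k).1.1.[a] *
     (flat_tensor k).1.2.[b] * (flat_tensor k).2.[c]))).
- exact: (hPsi (a, b, c)).1.
- by move=> N; apply: lipschitz_sum => k; exact: tensor_lipschitz.
- move=> e e0; have [N hN] := summ_tail fs e0; exists N => a' b' c'.
  by apply: (hPsi (a', b', c')).2 => m; exact: hN.
move=> a' b' c' ab ac bc.
apply: slim_unique (hPsi (a', b', c')).1.
apply: (@flat_seq_slim _ (0, 0, 0) L L0 R _ (@tnorm R) (@tnorm_ge0 R) sw (g a' b' c') 1) => //.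
- exact: scomplete_C.
- by move=> x; rewrite mul1r.
move=> e e0; have [N hN] := ddiff2_series (v1 a') (v1 b') (v1 c') ab ac bc e0.
exists N => n /hN; under eq_bigr do
  rewrite (ddiff2_poly (pB _) ab ac bc) -(tensor_horner (sL (n := _)) (cL _)).
by [].
Qed.

End D2Tensor.

(** * Differentiation of series of operators *)

Section DerivativeSeries.
Variables (R : realType) (H : hilbert R).

(** For [s] different from [t] the difference quotient is exactly the sum of the [u n s]. The tails
    are small uniformly in [s], and only finitely many terms then need continuity at [t], so the
    Lipschitz constants may depend on [n] in any way. *)
Lemma derivative_series (F : R -> H -> H) (t : R) (u : nat -> R -> H -> H) (b : nat -> R) :
  0 <= t <= 1 -> summ b -> (forall s, linear (F s)) ->
  (forall n s, 0 <= s <= 1 -> linear (u n s) /\ opb (u n s) (b n)) ->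
  (forall n, exists2 K : R, 0 <= K & forall s, 0 <= s <= 1 ->
     opb (u n s - u n t) (K * `|s - t|)) ->
  (forall s y, 0 <= s <= 1 ->
     slim (fun N => \sum_(0 <= n < N) (s - t)%:C *: u n s y) (F s y - F t y)) ->
  op_derivative F t (osum (fun n => u n t)).
Proof.
move=> t01 sb lF hu lip hF; set L := osum _.
have cH : scomplete (H : normedModType R[i]) by exact: complete_scomplete.
have os s : 0 <= s <= 1 -> _ := fun s01 => osumP cH (fun n => (hu n s s01).2) sb.
have lL : linear L.
  apply: slim_linear (os t t01).1 => N a x y.
  by rewrite scaler_sumr -big_split/=; apply: eq_bigr => n _; rewrite (hu n t t01).1.
split.
  apply/bounded_opP; split => //; have [b0 [M hM]] := sb.
  exists M; first by have := hM 0; rewrite big_geq.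
  have := (os t t01).2 0 M hM; apply: opb_ext => x.
  by rewrite !fctE big_geq// subr0.
apply: (cvg_opnormP (F := within `[0, 1] (t^')) _).2.
  by move=> s; apply: linear_subf => //; apply: linear_scalef; exact: linear_subf.
move=> e e0; have e3 : 0 < e / 3 by rewrite divr_gt0.
have [N hN] := summ_tail sb e3.
have [K K0 hK] : exists2 K : R, 0 <= K & forall s, 0 <= s <= 1 ->
    opb (\sum_(0 <= n < N) u n s - \sum_(0 <= n < N) u n t) (K * `|s - t|).
  elim: N {hN} => [|N [K K0 hK]].
    exists 0 => // s s01 x; rewrite !big_geq// !fctE subrr rnorm0 mul0r mul0r//.
  have [K' K'0 hK'] := lip N; exists (K + K'); first by rewrite addr_ge0.
  move=> s s01; rewrite mulrDl; apply: opb_ext (opbD (hK s s01) (hK' s s01)) => x.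
  by rewrite !big_nat_recr//= !fctE opprD addrACA.
have d0 : 0 < (e / 3) / (K + 1) by rewrite divr_gt0// ltr_wpDl.
exists ((e / 3) / (K + 1)) => //= s; rewrite /ball_/= distrC => st snt; rewrite in_itv/= => s01.
have Ls : (s - t)^-1%:C *: (F s - F t) = osum (fun n => u n s).
  apply/funext => y; symmetry; apply: osum_slim; rewrite fctE.
  have sn : (s - t)%:C != 0 :> R[i].
    by apply: contra snt => /eqP h; rewrite -subr_eq0; apply/eqP/complexI.
  have := hF s y s01 => h e' e'0.
  have r0 : 0 < rnorm ((s - t)%:C : R[i]).
    by rewrite lt0r rnorm_ge0 andbT; apply: contra sn => /eqP/rnorm_eq0 ->.
  have [N' hN'] := h _ (mulr_gt0 r0 e'0); exists N' => n /hN'.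
  rewrite -scaler_sumr -{1}[F s y - F t y](scalerKV sn) -scalerBr rnormZ.
  by rewrite ler_pM2l// fmorphV.
rewrite Ls.
have h1 := (os s s01).2 N (e / 3) (fun m => hN N m (leqnn _)).
have h2 := (os t t01).2 N (e / 3) (fun m => hN N m (leqnn _)).
have h3 : opb (\sum_(0 <= n < N) u n s - \sum_(0 <= n < N) u n t) (e / 3).
  apply: opb_le (hK s s01); rewrite (le_trans (ler_wpM2l K0 (ltW st)))//.
  by rewrite mulrA ler_pdivrMr ?ltr_wpDl// mulrC ler_pM2l// lerDl.
have -> : e = e / 3 + (e / 3 + e / 3) by field.
exact: opb_dist h1 (opb_dist h3 (opb_sym h2)).
Qed.

Lemma horner_opD (T : H -> H) (p r : {poly R[i]}) :
  horner_op (p + r) T = horner_op p T + horner_op r T.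
Proof.
apply/funext => x; rewrite fctE; pose B := maxn (size p) (size r).
rewrite (@horner_op_wide _ _ T p x B) ?leq_maxl// (@horner_op_wide _ _ T r x B) ?leq_maxr//.
rewrite (@horner_op_wide _ _ T (p + r) x B) ?size_polyD// -big_split/=.
by apply: eq_bigr => k _; rewrite coefD scalerDl.
Qed.

Lemma horner_opN (T : H -> H) (p : {poly R[i]}) : horner_op (- p) T = - horner_op p T.
Proof.
apply/funext => x; rewrite /horner_op fctE size_polyN -sumrN.
by apply: eq_bigr => k _; rewrite coefN scaleNr.
Qed.

Lemma horner_op_sum (T : H -> H) (p : nat -> {poly R[i]}) N :
  horner_op (\sum_(0 <= n < N) p n) T = \sum_(0 <= n < N) horner_op (p n) T.
Proof.
elim: N => [|N IH]; last by rewrite !big_nat_recr//= horner_opD IH.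
by rewrite !big_geq//; apply/funext => x; rewrite /horner_op size_poly0 big_ord0.
Qed.

End DerivativeSeries.

(** * Functional calculus of a series of polynomials *)

Section FunctionalCalculus.
Variables (R : realType) (H : hilbert R) (T : H -> H) (E : set (circle R) -> H -> H).
Hypotheses (mE : semispectral_measure_of T E) (lT : linear T).

(** The two approximating polynomials are close to [f], hence to each other, on the circle, and von
    Neumann's inequality carries this over to [T]. *)
Lemma is_fcalc_unique f A A' : is_fcalc f T A -> is_fcalc f T A' -> A = A'.
Proof.
move=> [bA hA] [bA' hA']; apply: opb0_eq => e e0; have e4 : 0 < e / 4 by rewrite divr_gt0.
have [p [p1 p2]] := hA _ e4; have [p' [p1' p2']] := hA' _ e4.
have lp r : linear (horner_op r T) by exact: horner_op_linear.
have h1 : opb (A - horner_op p T) (e / 4).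
  by apply/opnormP => //; [apply: linear_subf => //; case: bA|exact: ltW].
have h2 : opb (A' - horner_op p' T) (e / 4).
  by apply/opnormP => //; [apply: linear_subf => //; case: bA'|exact: ltW].
have h3 : opb (horner_op p T - horner_op p' T) (e / 4 + e / 4).
  rewrite -horner_opN -horner_opD; apply: (von_neumann mE).
    by rewrite addr_ge0// ltW.
  move=> z; rewrite hornerD hornerN.
  apply: le_trans (rnorm_dist _ (f (val z)) _) _; apply: lerD.
    by rewrite rnormB; apply: p1; exact: circle_disk.
  by apply: p1'; exact: circle_disk.
have := opb_dist h1 (opb_dist h3 (opb_sym h2)); apply: opb_le; lra.
Qed.

Lemma fcalc_series (f : R[i] -> R[i]) (p : nat -> {poly R[i]}) (M : nat -> R) :
  summ M -> (forall n z, rnorm z = 1 -> rnorm (p n).[z] <= M n) ->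
  (forall z, rnorm z <= 1 -> slim (fun N => \sum_(0 <= n < N) (p n).[z]) (f z)) ->
  fcalc f T = osum (fun n => horner_op (p n) T).
Proof.
move=> sM pM hf; set A := osum _.
have cH : scomplete (H : normedModType R[i]) by exact: complete_scomplete.
have op n : opb (horner_op (p n) T) (M n).
  by apply: (von_neumann mE) => [|z]; [case: sM|apply: pM; exact: val_circle].
have [os1 os2] := osumP cH op sM.
have lp r : linear (horner_op r T) by exact: horner_op_linear.
have lA : linear A.
  apply: slim_linear os1 => N a x y.
  by rewrite scaler_sumr -big_split/=; apply: eq_bigr => n _; rewrite lp.
suff fA : is_fcalc f T A.
  by rewrite /fcalc; case: xgetP => [A' _ h|/(_ A)//]; exact: is_fcalc_unique h fA.
split.
  apply/bounded_opP; split => //; have [M0 [m hm]] := sM.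
  exists m; first by have := hm 0; rewrite big_geq.
  by have := os2 0 m hm; apply: opb_ext => x; rewrite !fctE big_geq// subr0.
move=> e e0; have [N hN] := summ_tail sM e0.
exists (\sum_(0 <= n < N) p n); split.
  move=> z /closed_diskP z1; rewrite horner_sum.
  have bnd n : rnorm (p n).[z] <= M n by apply: max_principle z1 => w; exact: pM.
  have [l l1 l2] := vseries (@scomplete_C R) bnd sM.
  rewrite (slim_unique (hf z z1) l1); apply: l2 => m; exact: hN.
apply/opnormP; [exact: linear_subf|exact: ltW|rewrite horner_op_sum].
by apply: os2 => m; exact: hN.
Qed.

(** [derivative_series] asks for linearity at every real parameter, also where the segment may leave
    the contractions and the calculus may take its default value 0, which is linear too. *)
Lemma fcalc_linear f : linear (fcalc f T).
Proof.
rewrite /fcalc; case: xgetP => [A _ [[lA _] _]//|_].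
by move=> a x y; rewrite -[LHS]/(0 : H) -[RHS]/(a *: (0 : H) + 0) scaler0 addr0.
Qed.

End FunctionalCalculus.

Lemma opb_sum_nat (R : realType) (V W : normedModType R[i]) (A : nat -> V -> W)
    (c : nat -> R) (B : nat) : (forall i, (i < B)%N -> opb (A i) (c i)) ->
  opb (\sum_(0 <= i < B) A i) (\sum_(0 <= i < B) c i).
Proof. by move=> h; rewrite !big_mkord; apply: opb_sum => i _; exact: h. Qed.

Section OperatorDifferenceBounds.
Variables (R : realType) (H : hilbert R) (Q : H -> H) (q : R).
Hypotheses (lQ : linear Q) (q0 : 0 <= q) (hQ : opb Q q).
Variables (p : {poly R[i]}) (B : nat).

Lemma op_diff1_linear A A' : linear A -> linear A' -> linear (op_diff1 Q p B A A').
Proof.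
move=> lA lA'; rewrite (_ : op_diff1 _ _ _ _ _ =
  \sum_(0 <= i < B) \sum_(0 <= j < B) p`_(i + j.+1) *: (iter i A \o (Q \o iter j A'))).
  apply: linear_sum_fct => i _; apply: linear_sum_fct => j _; apply: linear_scalef.
  by apply: linear_comp; [exact: linear_iter|apply: linear_comp => //; exact: linear_iter].
by apply/funext => x; rewrite fct_sumE; apply: eq_bigr => i _; rewrite fct_sumE.
Qed.

Let op_diff2E A A' A'' : op_diff2 Q p B A A' A'' =
  \sum_(0 <= i < B) \sum_(0 <= j < B) \sum_(0 <= l < B)
    p`_(i + j + l.+2) *: tri Q (iter i A) (iter j A') (iter l A'').
Proof.
apply/funext => x; rewrite fct_sumE; apply: eq_bigr => i _.
by rewrite fct_sumE; apply: eq_bigr => j _; rewrite fct_sumE.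
Qed.

Lemma op_diff2_linear A A' A'' : linear A -> linear A' -> linear A'' ->
  linear (op_diff2 Q p B A A' A'').
Proof.
move=> lA lA' lA''; rewrite op_diff2E; do 3![apply: linear_sum_fct => ? _].
by apply: linear_scalef; apply: tri_linear => //; exact: linear_iter.
Qed.

(** Counting the [B ^ 2] terms is enough here: for a block this costs a multiple of [4 ^ n], which
    the Besov condition can sum. *)
Lemma op_diff1_opb A A' (M : R) : opb A 1 -> opb A' 1 -> (forall k, rnorm p`_k <= M) ->
  opb (op_diff1 Q p B A A') (B%:R ^+ 2 * (q * M)).
Proof.
move=> hA hA' pM; have M0 := le_trans (rnorm_ge0 _) (pM 0%N).
have -> : B%:R ^+ 2 * (q * M) = \sum_(0 <= i < B) \sum_(0 <= j < B) (M * (1 * (q * 1))).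
  by rewrite !sumr_const_nat !subn0 -mulrnA -[RHS]mulr_natl natrM; ring.
rewrite (_ : op_diff1 _ _ _ _ _ =
  \sum_(0 <= i < B) \sum_(0 <= j < B) p`_(i + j.+1) *: (iter i A \o (Q \o iter j A'))).
  apply: opb_sum => i _; apply: opb_sum => j _.
  have hi := iter_opb i ler01 hA; have hj := iter_opb j ler01 hA'.
  rewrite !expr1n in hi hj.
  apply: opb_le (opbZ _ (opb_comp ler01 hi (opb_comp q0 hQ hj))).
  by rewrite ler_wpM2r// mul1r mulr1.
by apply/funext => x; rewrite fct_sumE; apply: eq_bigr => i _; rewrite fct_sumE.
Qed.

(** The constant is crude and is not summed over the blocks: the estimate serves only the continuity
    of one term of a series at a time. *)
Lemma op_diff2_lipschitz A A' A'' D D' D'' (d : R) : 0 <= d ->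
  linear D -> linear D' ->
  opb A' 1 -> opb A'' 1 -> opb D 1 -> opb D' 1 ->
  (forall i, (i < B)%N -> [/\ opb (iter i A - iter i D) d, opb (iter i A' - iter i D') d &
     opb (iter i A'' - iter i D'') d]) ->
  opb (op_diff2 Q p B A A' A'' - op_diff2 Q p B D D' D'')
    ((\sum_(0 <= i < B) \sum_(0 <= j < B) \sum_(0 <= l < B) rnorm p`_(i + j + l.+2)) *
       (3 * q ^+ 2) * d).
Proof.
move=> d0 lD lD' hA' hA'' hD hD' h.
rewrite !op_diff2E -sumrB -mulrA mulr_suml; apply: opb_sum_nat => i iB.
rewrite -sumrB mulr_suml; apply: opb_sum_nat => j jB.
rewrite -sumrB mulr_suml; apply: opb_sum_nat => l lB.
rewrite -scalerBr; apply: opbZ.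
have [h1 _ _] := h i iB; have [_ h2 _] := h j jB; have [_ _ h3] := h l lB.
have k1 := iter_opb j ler01 hA'; have k2 := iter_opb l ler01 hA''.
have k3 := iter_opb i ler01 hD; have k4 := iter_opb j ler01 hD'.
rewrite !expr1n in k1 k2 k3 k4.
apply: opb_le (tri_diff lQ q0 hQ ler01 ler01 ler01 d0 (linear_iter i lD)
  (linear_iter j lD') k3 k1 k4 k2 h1 h2 h3).
by rewrite le_eqVlt; apply/orP; left; apply/eqP; ring.
Qed.

Lemma iter_difference_opb (A D : H -> H) (s : R[i]) (k : nat) : linear A ->
  opb A 1 -> opb D 1 -> (forall z, A z - D z = s *: Q z) ->
  opb (iter k A - iter k D) (k%:R * q * rnorm s).
Proof.
move=> lA hA hD hAD y; rewrite !fctE (iter_difference k y lA hAD) rnormZ.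
have -> : k%:R * q * rnorm s * rnorm y = rnorm s * (k%:R * (q * rnorm y)) by ring.
apply: ler_wpM2l => //.
rewrite (le_trans (rnorm_sum _ _ _))//.
rewrite (@le_trans _ _ (\sum_(0 <= j < k) (q * rnorm y)))//; last first.
  by rewrite sumr_const_nat subn0 mulr_natl.
apply: ler_sum => j _.
have hj := iter_opb j ler01 hA; have hk := iter_opb (k.-1 - j) ler01 hD.
rewrite !expr1n in hj hk.
by rewrite (le_trans (hj _))// mul1r (le_trans (hQ _))// ler_wpM2l// (le_trans (hk _))// mul1r.
Qed.

End OperatorDifferenceBounds.

(** * The triple integral as a series over blocks *)

Section TripleIntegral.
Variables (R : realType) (H : hilbert R) (T : H -> H) (E : set (circle R) -> H -> H).
Hypotheses (mE : semispectral_measure_of T E) (lT : linear T).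
Variables (Q : H -> H) (q : R).
Hypotheses (lQ : linear Q) (q0 : 0 <= q) (hQ : opb Q q).
Variables (f : R[i] -> R[i]) (p : nat -> {poly R[i]}) (B : nat -> nat) (L : nat -> seq (ctriple R)).
Hypothesis hf : forall z, rnorm z <= 1 -> slim (fun N => \sum_(0 <= n < N) (p n).[z]) (f z).
Hypothesis pB : forall n, (size (p n) <= B n)%N.
Hypothesis L0 : forall n, L n != [::].
Hypothesis sL : forall n x, x \in L n ->
  [/\ (size x.1.1 <= B n)%N, (size x.1.2 <= B n)%N & (size x.2 <= B n)%N].
Hypothesis cL : forall n i j l,
  \sum_(x <- L n) x.1.1`_i * x.1.2`_j * x.2`_l = (p n)`_(i + j + l.+2).
Hypothesis sw : summ (fun n => \sum_(x <- L n) tnorm x).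

Lemma summ_nneseries (b : nat -> R) : summ b -> (\sum_(0 <= n <oo) (b n)%:E < +oo)%E.
Proof.
move=> [b0 [M hM]]; apply: (@le_lt_trans _ _ M%:E); last exact: ltry.
apply: lime_le; first by apply: is_cvg_nneseries => n _; rewrite lee_fin.
by apply: nearW => n; rewrite sumEFin lee_fin.
Qed.

Let ft := flat_tensor L.

Lemma D2_tensor_rep : tensor_rep (D2 f) (fun m => horner (ft m).1.1)
  (fun m => horner (ft m).1.2) (fun m => horner (ft m).2).
Proof.
split=> [m||a b c].
- by split; exact: disk_algebra_poly.
- rewrite (eq_eseriesr (g := fun m => (tnorm (ft m))%:E)).
    by apply: summ_nneseries; exact: (flat_seq_summ (0, 0, 0) L0 (@tnorm_ge0 R) sw).
  by move=> m _; rewrite !disk_normE//; exact: disk_algebra_poly.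
- by apply/slimP; exact: (D2_series hf pB L0 sL cL sw a b c).
Qed.

Lemma tri_horner_opb (A A' A'' : H -> H) (x : ctriple R) :
  (forall r : {poly R[i]}, opb (horner_op r A) (sup_disk (horner r))) ->
  (forall r : {poly R[i]}, opb (horner_op r A') (sup_disk (horner r))) ->
  (forall r : {poly R[i]}, opb (horner_op r A'') (sup_disk (horner r))) ->
  opb (tri Q (horner_op x.1.1 A) (horner_op x.1.2 A') (horner_op x.2 A'')) (q ^+ 2 * tnorm x).
Proof.
move=> hA hA' hA''; exact: (tri_opb q0 hQ (sup_disk_poly_ge0 _) (sup_disk_poly_ge0 _)
  (sup_disk_poly_ge0 _) (hA _) (hA' _) (hA'' _)).
Qed.

Lemma von_neumann_sup_disk (r : {poly R[i]}) : opb (horner_op r T) (sup_disk (horner r)).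
Proof.
apply: (von_neumann mE) => [|z]; first exact: sup_disk_poly_ge0.
by apply: sup_disk_ub; [exact: disk_algebra_poly|exact: circle_disk].
Qed.

(** The flattened polynomial representation provides one candidate, because integrals of polynomials
    are polynomials in [T]. Regrouped by blocks, its sum is that of the [op_diff2]; uniqueness
    identifies it with the value chosen by [triple_int]. *)
Lemma triple_int_series :
  triple_int (D2 f) E Q E Q E = osum (fun n => op_diff2 Q (p n) (B n) T T T).
Proof.
have cH : scomplete (H : normedModType R[i]) by exact: complete_scomplete.
pose g (y : H) (x : ctriple R) := tri Q (horner_op x.1.1 T) (horner_op x.1.2 T) (horner_op x.2 T) y.
have vN := von_neumann_sup_disk.
have lh r : linear (horner_op r T) by exact: horner_op_linear.
have fs := flat_seq_summ (0, 0, 0) L0 (@tnorm_ge0 R) sw; rewrite -/(flat_tensor L) -/ft in fs.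
have bt m : opb (fun y => g y (ft m)) (q ^+ 2 * tnorm (ft m)) by exact: tri_horner_opb.
have sq := summZ (exprn_ge0 2 q0) fs.
have [os1 os2] := osumP cH bt sq.
have bo n : opb (op_diff2 Q (p n) (B n) T T T) (q ^+ 2 * \sum_(x <- L n) tnorm x).
  rewrite mulr_sumr; apply: opb_ext (opb_sum _ _) => [y|x _]; last first.
    exact: (tri_horner_opb x vN vN vN).
  by rewrite fct_sumE -(tensor_op (sL (n := n)) (cL n)).
have [os3 os4] := osumP cH bo (summZ (exprn_ge0 2 q0) sw).
have J_eq : osum (fun m y => g y (ft m)) = osum (fun n => op_diff2 Q (p n) (B n) T T T).
  apply/funext => y; apply: slim_unique (os1 y) _.
  apply: (@flat_seq_slim _ (0, 0, 0) L L0 R _ (@tnorm R) (@tnorm_ge0 R) sw (g y)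
    (q ^+ 2 * rnorm y)) => //.
  - by rewrite mulr_ge0// exprn_ge0.
  - by move=> x; rewrite mulrAC; exact: (tri_horner_opb x vN vN vN y).
  move=> e e0; have [N hN] := os3 y e e0; exists N => n /hN.
  have eg k : \sum_(x <- L k) g y x = op_diff2 Q (p k) (B k) T T T y.
    exact: (tensor_op (sL (n := k)) (cL k) T y lQ lT lT).
  by under [X in _ -> rnorm (_ - X) <= _]eq_bigr do rewrite eg.
rewrite -J_eq; set J := osum _.
have lt m : linear (fun y => g y (ft m)) by exact: (tri_linear lQ (lh _) (lh _) (lh _)).
have lJ : linear J.
  apply: slim_linear os1 => N a x y.
  by rewrite scaler_sumr -big_split/=; apply: eq_bigr => m _; rewrite lt.
have iJ : is_triple_int (D2 f) E Q E Q E J.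
  split.
    apply/bounded_opP; split => //; have [_ [M hM]] := sq.
    exists M; first by have := hM 0; rewrite big_geq.
    by have := os2 0 M hM; apply: opb_ext => y; rewrite !fctE big_geq// subr0.
  exists (fun m => horner (ft m).1.1), (fun m => horner (ft m).1.2), (fun m => horner (ft m).2).
  split; first exact: D2_tensor_rep.
  pose S (N : nat) : H -> H := \sum_(n < N) (fun y => g y (ft n)).
  have -> : (fun N => opnorm (J - \sum_(n < N)
      (semispectral_int E (horner (ft n).1.1 \o val) \o Q \o
      semispectral_int E (horner (ft n).1.2 \o val) \o Q \o
      semispectral_int E (horner (ft n).2 \o val)))%R) = (fun N => opnorm (J - S N)).
    apply/funext => N; congr (opnorm (J - _)); apply: eq_bigr => n _.
    by rewrite !(semispectral_int_poly mE).
  apply: (cvg_opnormP (F := \oo) _).2.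
    by move=> N; apply: linear_subf => //; exact: linear_sum_fct.
  move=> e e0; have [N hN] := summ_tail sq e0; exists N => // n /= Nn.
  by rewrite /S -(big_mkord xpredT (fun n y => g y (ft n))); apply: os2 => m; exact: hN.
have [K [V [U [F [dil _ _]]]]] := semispectral_measure_dilation mE.
have fE := semispectral_measure_fine mE.
rewrite /triple_int; case: xgetP => [J' _ iJ'|/(_ J)//].
exact: (triple_int_unique dil fE lQ q0 hQ iJ' iJ).
Qed.

End TripleIntegral.

(** * The segment between two contractions *)

Section Segment.
Variables (R : realType) (H : hilbert R) (T S : H -> H).
Hypotheses (cT : contraction_op T) (cS : contraction_op S).

Let lT : linear T. Proof. by case: cT. Qed.
Let lS : linear S. Proof. by case: cS. Qed.
Let hT : opb T 1. Proof. by apply/opnormP => //; case: cT. Qed.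
Let hS : opb S 1. Proof. by apply/opnormP => //; case: cS. Qed.

Lemma segment_linear s : linear (segment_op T S s).
Proof. by apply: linear_addf; exact: linear_scalef. Qed.

Lemma segment_opb s : 0 <= s <= 1 -> opb (segment_op T S s) 1.
Proof.
move=> /andP[s0 s1].
have h := opbD (opbZ (1 - s)%:C hT) (opbZ s%:C hS).
apply: opb_le h; rewrite !rnorm_real !mulr1 ger0_norm ?subr_ge0// ger0_norm//.
by rewrite subrK.
Qed.

Lemma segment_difference s t z :
  segment_op T S s z - segment_op T S t z = (s - t)%:C *: (S - T) z.
Proof.
rewrite /segment_op !fctE opprD addrACA -!scalerBl -!rmorphB/=.
rewrite scalerBr -scaleNr addrC; congr (_ + _ *: _).
by rewrite -rmorphN/= ; congr (_%:C); ring.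
Qed.

Lemma segment_direction_linear : linear (S - T). Proof. exact: linear_subf. Qed.
Lemma segment_direction_opb : opb (S - T) 2. Proof. exact: opbB. Qed.

End Segment.

Theorem theorem5p2 (R : realType) (H : hilbert R) (T S : H -> H)
    (E : R -> set (circle R) -> H -> H) (phi : circle R -> R[i]) :
  contraction_op T -> contraction_op S ->
  (forall t : R, 0 <= t <= 1 ->
     semispectral_measure_of (segment_op T S t) (E t)) ->
  besov_plus 2 +oo%E 1%E phi ->
  exists G : R -> H -> H,
    (forall t : R, 0 <= t <= 1 ->
       op_derivative (fun s => fcalc (disk_ext phi) (segment_op T S s))
         t (G t)) /\
    (forall t : R, 0 <= t <= 1 ->
       op_derivative G t
         (2 *: triple_int (D2 (disk_ext phi)) (E t) (S - T) (E t) (S - T)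
                 (E t))).
Proof.
move=> cT cS hE bphi.
have cH : scomplete (H : normedModType R[i]) by exact: complete_scomplete.
pose Q := S - T; have lQ : linear Q := segment_direction_linear cT cS.
have hQ : opb Q 2 := segment_direction_opb cT cS.
have q0 : 0 <= 2 :> R by [].
pose X s := segment_op T S s.
have lX s : linear (X s) := segment_linear cT cS s.
have oX s : 0 <= s <= 1 -> opb (X s) 1 := segment_opb cT cS (s := s).
have dX s t z : X s z - X t z = (s - t)%:C *: Q z := segment_difference T S s t z.
pose p := block phi; pose M := block_sup phi; pose B n := (2 ^ n.+1)%N.
have pM n z : rnorm z = 1 -> rnorm (p n).[z] <= M n by exact: block_sup_bound.
have sM : summ (fun n => 4 ^+ n * M n) by exact: block_sup_summ.
have sM1 : summ M by exact: block_sup_summ1.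
have pB n : (size (p n) <= B n)%N by exact: block_size.
have hf z : rnorm z <= 1 -> slim (fun N => \sum_(0 <= n < N) (p n).[z]) (disk_ext phi z).
  exact: block_series.
have /choice[L hL] n : exists L : seq (ctriple R), [/\ L != [::],
    forall i j l, \sum_(x <- L) x.1.1`_i * x.1.2`_j * x.2`_l = (p n)`_(i + j + l.+2),
    forall x, x \in L -> [/\ (size x.1.1 <= B n)%N, (size x.1.2 <= B n)%N & (size x.2 <= B n)%N] &
    \sum_(x <- L) tnorm x <= 192 * 4 ^+ n * M n].
  by apply: block_tensor => //; [move=> k; exact: block_low|exact: pM].
have L0 n : L n != [::] by case: (hL n).
have cL n i j l : \sum_(x <- L n) x.1.1`_i * x.1.2`_j * x.2`_l = (p n)`_(i + j + l.+2).
  by case: (hL n).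
have sL n x : x \in L n -> [/\ (size x.1.1 <= B n)%N, (size x.1.2 <= B n)%N & (size x.2 <= B n)%N].
  by case: (hL n) => _ _ + _; exact.
have sw : summ (fun n => \sum_(x <- L n) tnorm x).
  apply: summ_le (summZ (ler0n R 192) sM) => n; rewrite sumr_ge0/=.
    by rewrite mulrA; case: (hL n).
  by move=> x _; exact: tnorm_ge0.
have vN s : 0 <= s <= 1 -> forall r : {poly R[i]}, opb (horner_op r (X s)) (sup_disk (horner r)).
  by move=> s01 r; exact: von_neumann_sup_disk (hE s s01) r.
(* Majorant of the second-order terms at all points of the segment; [2 ^+ 2] is the square of the
   norm bound of [Q], which occurs twice in each product. *)
pose w n : R := 2 ^+ 2 * \sum_(x <- L n) tnorm x.
have hw n a b c : 0 <= a <= 1 -> 0 <= b <= 1 -> 0 <= c <= 1 ->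
    opb (op_diff2 Q (p n) (B n) (X a) (X b) (X c)) (w n).
  move=> a01 b01 c01; rewrite /w mulr_sumr.
  apply: opb_ext (opb_sum _ _) => [y|x _]; last first.
    exact: (tri_horner_opb q0 hQ x (vN a a01) (vN b b01) (vN c c01)).
  by rewrite fct_sumE; exact: (tensor_op (sL n) (cL n) (X c) y lQ (lX a) (lX b)).
have l2 n a b c : linear (op_diff2 Q (p n) (B n) (X a) (X b) (X c)) by exact: op_diff2_linear.
have sw2 : summ w by exact: summZ sw.
pose c1 n : R := (B n)%:R ^+ 2 * (2 * M n).
have h1 n a b : 0 <= a <= 1 -> 0 <= b <= 1 ->
    opb (op_diff1 Q (p n) (B n) (X a) (X b)) (c1 n).
  move=> a01 b01; apply: op_diff1_opb => //; [exact: oX|exact: oX|].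
  by move=> k; apply: coef_bound; exact: pM.
have l1 n a b : linear (op_diff1 Q (p n) (B n) (X a) (X b)) by exact: op_diff1_linear.
have sc1 : summ c1.
  (* The constant 8 combines [B n ^ 2 = 4 * 4 ^ n] with the norm bound 2 of [Q]. *)
  have -> : c1 = (fun n => 8 * (4 ^+ n * M n)).
    apply/funext => n; rewrite /c1 /B natrX -exprM mulnC exprM.
    have -> : (2 : R) ^+ 2 = 4 by ring.
    by rewrite exprS; ring.
  exact: summZ sM.
pose F s := fcalc (disk_ext phi) (X s).
have FE s : 0 <= s <= 1 -> F s = osum (fun n => horner_op (p n) (X s)).
  by move=> s01; exact: (fcalc_series (hE s s01) (lX s) sM1 pM hf).
pose G0 s := osum (fun n => op_diff1 Q (p n) (B n) (X s) (X s)).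
(* The series need not converge outside [0, 1]. *)
pose G s := if 0 <= s <= 1 then G0 s else 0.
have sumF s : 0 <= s <= 1 -> forall y,
    slim (fun N => \sum_(0 <= n < N) horner_op (p n) (X s) y) (F s y).
  move=> s01; rewrite (FE s s01); apply: (osumP cH _ sM1).1 => n.
  by apply: (von_neumann (hE s s01)) => [|z]; [case: sM1|apply: pM; exact: val_circle].
have sumG s : 0 <= s <= 1 -> forall y,
    slim (fun N => \sum_(0 <= n < N) op_diff1 Q (p n) (B n) (X s) (X s) y) (G s y).
  by move=> s01; rewrite /G s01; apply: (osumP cH _ sc1).1 => n; exact: h1.
have lG s : linear (G s).
  case s01 : (0 <= s <= 1); last first.
    by rewrite /G s01 => a x y; rewrite -[LHS]/(0 : H) -[RHS]/(a *: (0 : H) + 0) scaler0 addr0.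
  apply: slim_linear (sumG s s01) => N a x y.
  by rewrite scaler_sumr -big_split/=; apply: eq_bigr => n _; rewrite l1.
have slimB (u v : nat -> H) l m : slim u l -> slim v m -> slim (fun n => u n - v n) (l - m).
  move=> hu hv; apply: slimD => // e e0; have [N hN] := hv e e0; exists N => n /hN.
  by rewrite -opprD rnormN.
exists G; split=> t t01.
  have -> : G t = osum (fun n => op_diff1 Q (p n) (B n) (X t) (X t)) by rewrite /G t01.
  (* With [X t] kept on the right, [op_diff1] is the exact difference quotient of the block, and at
     [s = t] it becomes the term of [G t]. *)
  apply: (derivative_series (u := fun n s => op_diff1 Q (p n) (B n) (X s) (X t)) t01 sc1).
  - by move=> s; exact: fcalc_linear.
  - by move=> n s s01; split; [exact: l1|exact: h1].
  (* Moving the left argument from [X t] to [X s] produces [(s - t)] times [op_diff2], so its bound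
     [w n] is the Lipschitz constant. *)
  - move=> n; exists (w n) => [|s s01]; first by case: sw2.
    have := opbZ (s - t)%:C (hw n s t t s01 t01 t01); rewrite rnorm_real mulrC.
    apply: opb_ext => y.
    exact/esym/(op_diff1_difference_l (pB n) (X t) y (lX s) (dX s t)).
  - move=> s y s01 e e0; have [N hN] := slimB _ _ _ _ (sumF s s01 y) (sumF t t01 y) e e0.
    exists N => n /hN; rewrite -sumrB; under eq_bigr do
      rewrite (horner_op_difference (pB _) y (lX s) (dX s t)).
    by [].
(* The first summand moves the right argument of [op_diff1] from [X t] to [X s], the second one
   moves the left argument; at [s = t] they coincide, which produces the factor 2. *)
pose u n s := op_diff2 Q (p n) (B n) (X s) (X s) (X t) + op_diff2 Q (p n) (B n) (X s) (X t) (X t).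
have -> : 2 *: triple_int (D2 (disk_ext phi)) (E t) (S - T) (E t) (S - T) (E t) =
    osum (fun n => u n t).
  rewrite (triple_int_series (hE t t01) (lX t) lQ q0 hQ hf pB L0 sL cL sw).
  have h0 := (osumP cH (fun n => hw n t t t t01 t01 t01) sw2).1.
  apply/funext => y; symmetry; apply: osum_slim; rewrite fctE scaler_nat mulr2n => e e0.
  have [N hN] := slimD (h0 y) (h0 y) e0; exists N => n /hN.
  by rewrite -big_split.
apply: (derivative_series (u := u) t01 (summD sw2 sw2)) => //.
- move=> n s s01; split; first by apply: linear_addf; exact: l2.
  by apply: opbD; exact: hw.
- move=> n; set C := \sum_(0 <= i < B n) \sum_(0 <= j < B n) \sum_(0 <= l < B n)
    rnorm (p n)`_(i + j + l.+2).
  have C0 : 0 <= C by do 3![apply: sumr_ge0 => ? _].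
  pose K : R := C * (3 * 2 ^+ 2) * ((B n)%:R * 2).
  have K0 : 0 <= K by rewrite !mulr_ge0.
  exists (K + K) => [|s s01]; first by rewrite addr_ge0.
  have d0 : 0 <= (B n)%:R * 2 * `|s - t| by rewrite !mulr_ge0.
  (* Only powers below the degree bound occur, so [B n] can replace the exponent in the Lipschitz
     estimate for iterates. *)
  have it i : (i < B n)%N -> opb (iter i (X s) - iter i (X t)) ((B n)%:R * 2 * `|s - t|).
    move=> iB; have := iter_difference_opb q0 hQ i (lX s) (oX s s01) (oX t t01) (dX s t).
    by apply: opb_le; rewrite rnorm_real !ler_wpM2r// ler_nat ltnW.
  have zr i : opb (iter i (X t) - iter i (X t)) ((B n)%:R * 2 * `|s - t|).
    by move=> y; rewrite !fctE subrr rnorm0 mulr_ge0.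
  rewrite mulrDl /K.
  have k1 := op_diff2_lipschitz lQ q0 hQ (p n) d0 (lX t) (lX t) (oX s s01) (oX t t01)
    (oX t t01) (oX t t01) (fun i iB => And3 (it i iB) (it i iB) (zr i)).
  have k2 := op_diff2_lipschitz lQ q0 hQ (p n) d0 (lX t) (lX t) (oX t t01) (oX t t01)
    (oX t t01) (oX t t01) (fun i iB => And3 (it i iB) (zr i) (zr i)).
  rewrite -[_ * _ * `|s - t|]mulrA; apply: opb_ext (opbD k1 k2) => y.
  by rewrite /u !fctE opprD addrACA.
- move=> s y s01 e e0; have [N hN] := slimB _ _ _ _ (sumG s s01 y) (sumG t t01 y) e e0.
  exists N => n /hN; rewrite -sumrB.
  have eq k : op_diff1 Q (p k) (B k) (X s) (X s) y - op_diff1 Q (p k) (B k) (X t) (X t) y =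
      (s - t)%:C *: u k s y.
    rewrite -(subrK (op_diff1 Q (p k) (B k) (X s) (X t) y)
      (op_diff1 Q (p k) (B k) (X s) (X s) y)) -addrA.
    rewrite (op_diff1_difference_r lQ (pB k) y (lX s) (lX s) (dX s t)).
    by rewrite (op_diff1_difference_l (pB k) (X t) y (lX s) (dX s t)) -scalerDr.
  by under eq_bigr do rewrite eq.
Qed.
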